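(* Let $s>0$ and let $b$ be a collision kernel with Debye-Yukawa singularity of parameter $s$ (as specified in the context). Let $\alpha>0$. Then for every $\psi_0\in\mathcal{K}^{\alpha}$ there exists a unique classical solution $\psi\in C([0,+\infty),\mathcal{K}^{\alpha})$ of the Cauchy problem $$\partial_t\psi(t,\xi)=\int_{\mathbb{S}^2}b\left(\frac{\xi\cdot\sigma}{|\xi|}\right)\big(\psi(t,\xi^+)\psi(t,\xi^-)-\psi(t,\xi)\psi(t,0)\big)\,d\sigma,\qquad \psi(0,\xi)=\psi_0(\xi),$$ where $\xi^{\pm}=\frac{\xi}{2}\pm\frac{|\xi|}{2}\sigma$. Furthermore, if $\psi,\varphi\in C([0,+\infty),\mathcal{K}^{\alpha})$ are two solutions of this Cauchy problem with initial data $\psi_0\in\mathcal{K}^{\alpha}$ and $\varphi_0\in\mathcal{K}^{\alpha}$ respectively, then for every $t>0$ $$\|\psi(t)-\varphi(t)\|_{\alpha}\le e^{\lambda_{\alpha}t}\,\|\psi_0-\varphi_0\|_{\alpha},$$ where $$\lambda_{\alpha}=2\pi\int_0^{\pi/2} b(\cos\theta)\sin\theta\left(\cos^{\alpha}\frac{\theta}{2}+\sin^{\alpha}\frac{\theta}{2}-1\right)d\theta .$$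
   Context: Collision kernel: $b:[-1,1)\to[0,\infty)$ is a nonnegative measurable function of $\cos\theta$, supported in $\{\cos\theta\ge 0\}$, i.e. $0\le\theta\le\pi/2$. It has Debye-Yukawa singularity of parameter $s>0$ if $b(\cos\theta)\sim\theta^{-2}\left(\log\big(\theta/2\big)^{-1}\right)^{\frac2s-1}$ as $\theta\to0^+$, where $\sim$ means that for some $\theta_0\in(0,\pi/2)$ the quotient of the two sides lies between two positive constants for $0<\theta\le\theta_0$; moreover $\theta\mapsto b(\cos\theta)\sin\theta$ is integrable on $[\theta_0,\pi/2]$. In the integral over $\mathbb{S}^2$, $\cos\theta=\frac{\xi\cdot\sigma}{|\xi|}$ and $d\sigma$ is the surface measure; for $\xi=0$ the right-hand side of the equation is understood to be $0$. Characteristic functions: $\mathcal{K}$ is the set of functions $\psi:\mathbb{R}^3\to\mathbb{C}$ for which there is a Borel probability measure $\Psi$ on $\mathbb{R}^3$ with $\psi(\xi)=\int_{\mathbb{R}^3}e^{-iv\cdot\xi}\,d\Psi(v)$. For $\alpha\ge0$, $\mathcal{K}^{\alpha}=\{\varphi\in\mathcal{K}:\|\varphi-1\|_{\alpha}<+\infty\}$, where $\|\varphi-\psi\|_{\alpha}=\sup_{\xi\in\mathbb{R}^3\setminus\{0\}}\frac{|\varphi(\xi)-\psi(\xi)|}{|\xi|^{\alpha}}$; $\mathcal{K}^{\alpha}$ is a metric space with distance $\|\varphi-\psi\|_{\alpha}$, and $C([0,+\infty),\mathcal{K}^{\alpha})$ denotes the continuous maps into this metric space. Solution: a (classical) solution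 is a $\psi\in C([0,+\infty),\mathcal{K}^{\alpha})$ such that for each $\xi$ the map $t\mapsto\psi(t,\xi)$ is continuously differentiable on $[0,+\infty)$ and the equation and the initial condition hold pointwise. *)

(* Defs.v *)
From HB Require Import structures.
From mathcomp Require Import all_boot all_order all_algebra.
From mathcomp Require Import all_classical all_reals all_analysis.
From mathcomp Require Import complex.

Set Implicit Arguments.
Unset Strict Implicit.
Unset Printing Implicit Defensive.

Import Order.TTheory GRing.Theory Num.Theory.
Import numFieldNormedType.Exports.

Local Open Scope classical_set_scope.
Local Open Scope ring_scope.
Local Open Scope complex_scope.

(* Vectors of R^3 are row vectors.  The library norm on 'rV[R]_3 is the sup
   norm, so the Euclidean one is introduced here; both give the same open sets. *)
Definition dot (R : realType) (u v : 'rV[R]_3) : R := \sum_i u 0 i * v 0 i.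

Definition enorm (R : realType) (u : 'rV[R]_3) : R := Num.sqrt (dot u u).

Definition borelR3 (R : realType) := g_sigma_algebraType (@open 'rV[R]_3).

(* The library integral is real valued: complex functions are integrated
   componentwise. *)
Definition cintegrable (R : realType) (d : measure_display)
    (T : measurableType d) (mu : {measure set T -> \bar R}) (D : set T)
    (f : T -> R[i]) : Prop :=
  mu.-integrable D (fun x => (complex.Re (f x))%:E) /\
  mu.-integrable D (fun x => (complex.Im (f x))%:E).

Definition cintegral (R : realType) (d : measure_display)
    (T : measurableType d) (mu : {measure set T -> \bar R}) (D : set T)
    (f : T -> R[i]) : R[i] :=
  (\int[mu]_(x in D) complex.Re (f x)) +i* (\int[mu]_(x in D) complex.Im (f x)).

Definition cexpi (R : realType) (x : R) : R[i] := cos x +i* sin x.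

Definition ccvg (R : realType) (F : set_system R) (f : R -> R[i]) (l : R[i]) :
    Prop :=
  ComplexField.Normc.normc (f u - l) @[u --> F] --> (0 : R).

(* Surface measure of the unit sphere, by the parametrization with polar angle
   p.1 and azimuth p.2, whose area element is sin p.1 dp.  The polar axis is
   fixed; it is unrelated to the variable xi of the equation. *)
Definition sphere_point (R : realType) (p : R * R) : 'rV[R]_3 :=
  \row_(i < 3) [:: sin p.1 * cos p.2; sin p.1 * sin p.2; cos p.1]`_i.

Definition sphere_chart (R : realType) : set (R * R) :=
  `[0, pi]%classic `*` `[0, 2 * pi]%classic.

Definition lebesgue2 (R : realType) :
    {measure set (measurableTypeR R * measurableTypeR R)%type -> \bar R} :=
  (@lebesgue_measure R \x @lebesgue_measure R)%E.

Definition sphere_integrable (R : realType) (f : 'rV[R]_3 -> R[i]) : Prop :=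
  cintegrable (@lebesgue2 R) (@sphere_chart R)
    (fun p => f (sphere_point p) * (sin p.1)%:C).

Definition sphere_integral (R : realType) (f : 'rV[R]_3 -> R[i]) : R[i] :=
  cintegral (@lebesgue2 R) (@sphere_chart R)
    (fun p => f (sphere_point p) * (sin p.1)%:C).

(* Only the values of b on [-1, 1[ matter: below, b is evaluated at 1 only
   where it is multiplied by 0. *)
Record collision_kernel (R : realType) (b : R -> R) : Prop := CollisionKernel {
  kernel_measurable : measurable_fun `[(-1 : R), 1[%classic b;
  kernel_ge0 : forall x : R, -1 <= x < 1 -> 0 <= b x;
  kernel_support : forall x : R, -1 <= x < 0 -> b x = 0 }.

Definition debye_yukawa (R : realType) (s : R) (b : R -> R) : Prop :=
  exists theta0 : R, [/\ 0 < theta0 < pi / 2,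
    exists c C : R, [/\ 0 < c, 0 < C &
      forall theta : R, 0 < theta <= theta0 ->
        c <= b (cos theta) /
             (theta ^- 2 * (ln ((theta / 2)^-1)) `^ (2 / s - 1)) <= C] &
    (@lebesgue_measure R).-integrable `[theta0, pi / 2]%classic
      (fun theta => (b (cos theta) * sin theta)%:E)].

Definition is_char_fun (R : realType) (psi : 'rV[R]_3 -> R[i]) : Prop :=
  exists P : probability (borelR3 R) R, forall xi,
    psi xi = cintegral P setT (fun v : borelR3 R => cexpi (- dot v xi)).

Definition dist_alpha (R : realType) (alpha : R) (f g : 'rV[R]_3 -> R[i]) :
    \bar R :=
  ereal_sup [set (ComplexField.Normc.normc (f xi - g xi) / enorm xi `^ alpha)%:E
            | xi in [set xi : 'rV[R]_3 | xi != 0]].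

Definition Kalpha (R : realType) (alpha : R) : set ('rV[R]_3 -> R[i]) :=
  [set f | is_char_fun f /\ (dist_alpha alpha f (fun=> 1%R) < +oo)%E].

Definition xi_plus (R : realType) (xi sigma : 'rV[R]_3) : 'rV[R]_3 :=
  2^-1 *: xi + (enorm xi / 2) *: sigma.

Definition xi_minus (R : realType) (xi sigma : 'rV[R]_3) : 'rV[R]_3 :=
  2^-1 *: xi - (enorm xi / 2) *: sigma.

Definition collision_integrand (R : realType) (b : R -> R)
    (f : 'rV[R]_3 -> R[i]) (xi sigma : 'rV[R]_3) : R[i] :=
  (b (dot xi sigma / enorm xi))%:C *
  (f (xi_plus xi sigma) * f (xi_minus xi sigma) - f xi * f 0).

Definition collision_rhs (R : realType) (b : R -> R)
    (f : 'rV[R]_3 -> R[i]) (xi : 'rV[R]_3) : R[i] :=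
  if xi == 0 then 0 else sphere_integral (collision_integrand b f xi).

(* f is C^1 on [0, +oo[ with derivative df; the derivative at 0 is one-sided. *)
Definition C1_with_derivative (R : realType) (f df : R -> R[i]) : Prop :=
  forall t : R, 0 <= t ->
    ccvg (within [set u : R | 0 <= u /\ u <> t] (nbhs t))
         (fun u => (f u - f t) / (u - t)%:C) (df t) /\
    ccvg (within [set u : R | 0 <= u] (nbhs t)) df (df t).

(* Time is a real number, and only the values at t >= 0 are constrained. *)
Record is_solution (R : realType) (b : R -> R) (alpha : R)
    (psi0 : 'rV[R]_3 -> R[i]) (psi : R -> 'rV[R]_3 -> R[i]) : Prop :=
  IsSolution {
  solution_Kalpha : forall t : R, 0 <= t -> Kalpha alpha (psi t);
  solution_continuous : forall t : R, 0 <= t ->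
    dist_alpha alpha (psi u) (psi t)
      @[u --> within [set u : R | 0 <= u] (nbhs t)] --> 0%E;
  (* the surface integral exists as a Lebesgue integral *)
  solution_integrable : forall (t : R) (xi : 'rV[R]_3), 0 <= t -> xi != 0 ->
    sphere_integrable (collision_integrand b (psi t) xi);
  solution_equation : forall xi, exists2 dpsi : R -> R[i],
    C1_with_derivative (fun t => psi t xi) dpsi &
    forall t : R, 0 <= t -> dpsi t = collision_rhs b (psi t) xi;
  solution_initial : forall xi, psi 0 xi = psi0 xi }.

Definition lambda_alpha (R : realType) (b : R -> R) (alpha : R) : R :=
  2 * pi * \int[@lebesgue_measure R]_(theta in `[0, pi / 2])
    (b (cos theta) * sin theta *
     (cos (theta / 2) `^ alpha + sin (theta / 2) `^ alpha - 1)).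

(* Main.v *)
Require Import Defs.
From HB Require Import structures.
From mathcomp Require Import all_boot all_order all_algebra.
From mathcomp Require Import all_classical all_reals all_analysis.
From mathcomp Require Import complex ring lra zify measurable_realfun.

(** The kernel is truncated at height [n]; its collision operator is then a
    gain minus the mass of the kernel times the identity.  By a computation
    going back to Bobylev, the gain of the characteristic function of [P] is,
    up to that mass, the characteristic function of the velocity after a
    collision of two independent [P]-distributed particles ([gain_char_fun]).
    Hence an explicit Euler step [f + h B_n f] with [h] times the mass at most
    1 is a mixture of characteristic functions and is one itself.  The
    computation exchanges the roles of two axes in an integral over the sphere
    ([surface_exchange]).

    The singular kernel is under control because of a cancellation: when
    [|f - 1| <= M |xi|^alpha], the expression [f(xi+) f(xi-) - f(xi)] is at
    most [2 M |xi|^alpha sin(theta/2)^(alpha/2)] ([collision_defect_bound]),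
    which follows from a Cauchy-Schwarz bound for a covariance
    ([char_fun_product_defect]).  A Debye-Yukawa singularity integrates every
    positive power of [sin(theta/2)] ([kernel_weight_lty]).  So the full
    operator [B] is defined, and [B - B_n] is at most [eps_n M |xi|^alpha] with
    [eps_n] tending to 0.

    In the distance of order [alpha], an Euler step expands by at most the
    factor [exp (h lambda_n)] ([euler_step_contraction]), because
    [|xi+|^alpha] and [|xi-|^alpha] are [|xi|^alpha] times
    [cos(theta/2)^alpha] and [sin(theta/2)^alpha]; and [lambda_n] tends to
    [lambda_alpha] ([growth_rate_cvg]).  The rest is an argument about one-step
    methods.  A curve is called mild when
    [u(t) - u(s) - (t - s) B u(s)] is of smaller order than [t - s], with
    explicit constants.  Two mild curves are both followed by the same Euler
    scheme, which transports their initial distance with the factor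
    [exp (lambda_alpha t)] in the limit ([mild_stability]).  Euler schemes for
    different [n] on nested dyadic grids are close to each other, so they
    converge, and the limit is a mild curve ([mild_existence]).  Finally, mild
    curves are the same as classical solutions: one direction is a
    differentiation, the other the mean value inequality ([classical_mild]).

    The limit has to be a characteristic function again ([char_fun_closed]).
    The bounds [|f_n - 1| <= M |xi|^alpha] make the laws tight, and the limit of
    their expectations along an ultrafilter is a positive functional on bounded
    functions.  A law with these expectations is obtained as the distribution of
    an explicit random vector on the real line, which follows the masses of a
    sequence of cells obtained by repeated bisection
    ([tight_generalized_limit]). *)

Set Implicit Arguments.
Unset Strict Implicit.
Unset Printing Implicit Defensive.

Import Order.TTheory GRing.Theory Num.Theory.
Import numFieldNormedType.Exports.

Local Open Scope classical_set_scope.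
Local Open Scope ring_scope.

(** * Measures with densities and bounded measurable functions *)

Section coordinates.
Variable R : realType.

Lemma measurable_continuous_borelR3 (f : 'rV[R]_3 -> R) :
  continuous f -> measurable_fun setT (f : borelR3 R -> R).
Proof.
move=> cf; apply: (measurability _ (RGenOpens.measurableE R)).
move=> _ [_ [a [b ->] <-]]; rewrite setTI.
apply: sub_sigma_algebra; apply: open_comp; last exact: interval_open.
by move=> x _; exact: cf.
Qed.

Lemma measurable_coord (i : 'I_3) :
  measurable_fun setT (fun v : borelR3 R => (v : 'rV[R]_3) 0 i).
Proof.
apply: measurable_continuous_borelR3; exact: coord_continuous.
Qed.

(** An open set is a countable union of rational boxes, and a box only involves
    the coordinates. *)
Lemma measurable_to_borelR3 d (T : measurableType d) (X : T -> borelR3 R) :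
  (forall i, measurable_fun setT (fun t => (X t : 'rV[R]_3) 0 i)) ->
  measurable_fun setT X.
Proof.
move=> mX; apply: (@measurability _ _ _ _ setT X (@open 'rV[R]_3)) => //.
move=> _ [U oU <-]; rewrite setTI.
pose box (c : 'I_3 -> rat) (r : rat) := [set v : 'rV[R]_3 |
   forall i, `|v 0 i - ratr (c i)| < ratr r].
have bigE : X @^-1` U = \bigcup_(q : {ffun 'I_3 -> rat} * rat)
    (if `[< box q.1 q.2 `<=` U >] then X @^-1` box q.1 q.2 else set0).
  apply/seteqP; split => t /=.
    move=> Ut; have := open_nbhs_nbhs (conj oU Ut).
    move=> /nbhs_ballP[e /= e0 eU].
    have [r /andP[r0 re]] : exists r : rat, (0 < ratr r :> R) && (ratr r < e / 2 :> R).
      have e20 : 0 < e / 2 by rewrite divr_gt0.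
      by have [r] := rat_in_itvoo e20; rewrite in_itv/=; exists r.
    have cex i : exists c : rat, `|(X t : 'rV[R]_3) 0 i - ratr c| < ratr r.
      have lt_i : (X t : 'rV[R]_3) 0 i - ratr r < (X t : 'rV[R]_3) 0 i by lra.
      have [c] := rat_in_itvoo lt_i.
      rewrite in_itv/= => /andP[c1 c2]; exists c.
      by rewrite ger0_norm; lra.
    pose c i := sval (cid (cex i)).
    exists ([ffun i => c i], r) => //=.
    case: asboolP => [_|].
      by move=> i; rewrite ffunE /c; case: cid.
    case; move=> v vb; apply: eU; rewrite -ball_normE /ball_/=.
    rewrite [X in X < _]mx_normrE; apply/bigmax_ltP; split => // -[i j] _ /=.
    rewrite (ord1 i) !mxE.
    have := vb j; rewrite ffunE /c; case: cid => /= cc h1 h2.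
    rewrite (_ : _ - _ = ((X t : 'rV[R]_3) 0 j - ratr cc) - (v 0 j - ratr cc)); last by ring.
    by rewrite (le_lt_trans (ler_normB _ _))//; lra.
  by move=> [q _]; case: asboolP => // qU; exact: qU.
rewrite bigE.
apply: countable_bigcupT_measurable; first exact: countableP.
move=> q; case: ifP => // _.
rewrite [X in measurable X](_ : _ = \bigcap_(i in [set: 'I_3])
   ((fun t => (X t : 'rV[R]_3) 0 i) @^-1` `](ratr (q.1 i) - ratr q.2), (ratr (q.1 i) + ratr q.2)[%classic)).
  apply: fin_bigcap_measurable => // i _; rewrite -[X in measurable X]setTI; exact: mX.
apply/seteqP; split => t /= h i; [move=> _|]; have := h i;
  rewrite /= in_itv/= ltr_norml; [move=> /andP[]; lra|move=> /(_ I)/andP[]; lra].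
Qed.

End coordinates.

Section bounded_measurable.
Context d (T : measurableType d) (R : realType).

Definition bounded_measurable (f : T -> R) :=
  measurable_fun setT f /\ exists M, forall x, `|f x| <= M.

Lemma bounded_measurable_cst c : bounded_measurable (fun=> c).
Proof. by split=> //; exists `|c|. Qed.

Lemma bounded_measurableD f g : bounded_measurable f -> bounded_measurable g ->
  bounded_measurable (fun x => f x + g x).
Proof.
move=> [mf [M fM]] [mg [N gN]]; split; first exact: measurable_funD.
by exists (M + N) => x; rewrite (le_trans (ler_normD _ _))// lerD.
Qed.

Lemma bounded_measurableN f : bounded_measurable f ->
  bounded_measurable (fun x => - f x).
Proof.
move=> [mf [M fM]]; split; first exact: measurableT_comp.
by exists M => x; rewrite normrN.
Qed.

Lemma bounded_measurableB f g : bounded_measurable f -> bounded_measurable g ->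
  bounded_measurable (fun x => f x - g x).
Proof. by move=> bf /bounded_measurableN; exact: bounded_measurableD. Qed.

Lemma bounded_measurableM f g : bounded_measurable f -> bounded_measurable g ->
  bounded_measurable (fun x => f x * g x).
Proof.
move=> [mf [M fM]] [mg [N gN]]; split; first exact: measurable_funM.
by exists (M * N) => x; rewrite normrM ler_pM.
Qed.

Lemma bounded_measurable_indic A : measurable A ->
  bounded_measurable (\1_A : T -> R).
Proof.
move=> mA; split; first exact: measurable_indic.
by exists 1 => x; rewrite indicE; case: (_ \in _); rewrite ?normr1 ?normr0.
Qed.

Lemma integrable_bounded (mu : {measure set T -> \bar R}) f :
  (mu setT < +oo)%E -> bounded_measurable f ->
  mu.-integrable setT (EFin \o f).
Proof.
move=> muoo [mf [M fM]]; apply: measurable_bounded_integrable => //.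
exists M; split; first exact: num_real.
by move=> y My x _ /=; rewrite (le_trans (fM x))// ltW.
Qed.

Lemma integrable_boundedM (mu : {measure set T -> \bar R}) (rho f : T -> R) :
  mu.-integrable setT (EFin \o rho) -> bounded_measurable f ->
  mu.-integrable setT (EFin \o (fun x => rho x * f x)).
Proof.
move=> irho [mf [M fM]].
have -> : EFin \o (fun x => rho x * f x) = ((EFin \o rho) \* (EFin \o f))%E.
  by apply/funext.
apply: integrableMl => //; exists M; split; first exact: num_real.
by move=> y My x _ /=; rewrite (le_trans (fM x))// ltW.
Qed.

End bounded_measurable.

Lemma bounded_measurable_comp d d' (T : measurableType d)
    (T' : measurableType d') (R : realType) (f : T' -> R) (X : T -> T') :
  measurable_fun setT X -> bounded_measurable f ->
  bounded_measurable (fun x => f (X x)).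
Proof.
by move=> mX [mf [M fM]]; split; [exact: measurableT_comp|exists M].
Qed.

Section weighted_measure.
Local Open Scope ereal_scope.
Context d (T : measurableType d) (R : realType).
Variables (mu : {measure set T -> \bar R}) (rho : T -> R).
Hypotheses (mrho : measurable_fun setT rho) (rho0 : forall x, (0 <= rho x)%R).

(** The two proofs are parameters so that the measure structure can be found
    from the term itself. *)
Definition weighted & measurable_fun setT rho & (forall x, (0 <= rho x)%R) :=
  fun A : set T => \int[mu]_(x in A) (rho x)%:E.

Local Notation nu := (weighted mrho rho0).

Let nu0 : nu set0 = 0. Proof. exact: integral_set0. Qed.

Let nu_ge0 A : 0 <= nu A.
Proof. by apply: integral_ge0 => x _; rewrite lee_fin. Qed.

Let nu_additive : semi_sigma_additive nu.
Proof.
move=> F mF tF mUF; rewrite /weighted ge0_integral_bigcup//; last 2 first.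
- by apply/measurable_EFinP; exact: measurable_funTS.
- by move=> x _; rewrite lee_fin.
apply: is_cvg_ereal_nneg_natsum => n _.
by apply: integral_ge0 => x _; rewrite lee_fin.
Qed.

HB.instance Definition _ := isMeasure.Build _ _ _ nu nu0 nu_ge0 nu_additive.

Import HBNNSimple.

Let integral_weighted_nnsfun (f : {nnsfun T >-> R}) :
  \int[nu]_x (f x)%:E = \int[mu]_x ((f x)%:E * (rho x)%:E).
Proof.
rewrite integralT_nnsfun sintegralE.
have EFinf x : (f x)%:E * (rho x)%:E =
    \sum_(k \in range f) k%:E * ((rho \_ (f @^-1` [set k])) x)%:E.
  rewrite -EFinM fimfunE mulr_fsuml -fsumEFin//; apply: eq_fsbigr => k _.
  by rewrite -EFinM patchE indicE; case: ifPn; rewrite ?(mulr1, mulr0, mul0r).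
under [RHS]eq_integral do rewrite EFinf.
have mrk k : measurable_fun setT (rho \_ (f @^-1` [set k])).
  by apply/(measurable_restrictT _ _).1 => //; exact: measurable_funTS.
rewrite ge0_integral_fsum//; last 2 first.
- by move=> k; apply: measurable_funeM; exact/measurable_EFinP.
- move=> k x _; have [k0|k0] := leP 0%R k.
    by rewrite mule_ge0// lee_fin patchE; case: ifP.
  by rewrite preimage_nnfun0// patchE in_set0 mule0.
apply: eq_fsbigr => k; rewrite inE => -[x _ <-].
rewrite ge0_integralZl//; last 3 first.
- exact/measurable_EFinP.
- by move=> y _; rewrite lee_fin patchE; case: ifP.
- by rewrite lee_fin.
congr (_ * _); rewrite /= /weighted integral_mkcond; apply: eq_integral => y _.
by rewrite !patchE; case: ifP.
Qed.

Lemma ge0_integral_weighted (f : T -> \bar R) : measurable_fun setT f ->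
  (forall x, 0 <= f x) -> \int[nu]_x f x = \int[mu]_x (f x * (rho x)%:E).
Proof.
move=> mf f0; pose g := nnsfun_approx measurableT mf.
have nd_g x : {homo (fun n => (g n x)%:E) : n m / (n <= m)%N >-> n <= m}.
  by move=> *; rewrite lee_fin; exact/lefP/nd_nnsfun_approx.
have mg n : measurable_fun setT (EFin \o g n) by exact/measurable_EFinP.
have cg x : EFin \o g ^~ x @ \oo --> f x by exact: cvg_nnsfun_approx.
transitivity (limn (fun n => \int[nu]_x (g n x)%:E)).
  rewrite -monotone_convergence//; last first.
    by move=> n x _; rewrite lee_fin.
  by apply: eq_integral => x _; apply/esym/cvg_lim => //; exact: cg.
under eq_fun do rewrite integral_weighted_nnsfun.
rewrite -monotone_convergence//; last 3 first.
- by move=> n; apply: emeasurable_funM => //; exact/measurable_EFinP.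
- by move=> n x _; rewrite mule_ge0 ?lee_fin.
- by move=> x _ m n mn; rewrite lee_wpmul2r ?lee_fin//; exact/lefP/nd_nnsfun_approx.
apply: eq_integral => x _; apply/cvg_lim => //; apply: cvgeZr => //.
exact: cg.
Qed.

End weighted_measure.

Section weighted_Rintegral.
Context d (T : measurableType d) (R : realType).
Variables (mu : {measure set T -> \bar R}) (rho : T -> R).
Hypotheses (mrho : measurable_fun setT rho) (rho0 : forall x, (0 <= rho x)%R).

Lemma integral_weighted (f : T -> R) : measurable_fun setT f ->
  (\int[weighted mu mrho rho0]_x (f x)%:E =
   \int[mu]_x (f x * rho x)%:E)%E.
Proof.
move=> mf; rewrite [LHS]integralE [RHS]integralE; congr (_ - _)%E.
  rewrite ge0_integral_weighted//; last first.
    by apply: measurable_funepos; exact/measurable_EFinP.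
  apply: eq_integral => x _; rewrite !funeposE -!EFin_max -EFinM.
  by rewrite maxr_pMl// mul0r.
rewrite ge0_integral_weighted//; last first.
  by apply: measurable_funeneg; exact/measurable_EFinP.
apply: eq_integral => x _; rewrite !funenegE -!EFinN -!EFin_max -EFinM.
by rewrite maxr_pMl// mul0r mulNr.
Qed.

Lemma Rintegral_weighted (f : T -> R) : measurable_fun setT f ->
  \int[weighted mu mrho rho0]_x f x = \int[mu]_x (f x * rho x).
Proof. by move=> mf; rewrite /Rintegral integral_weighted. Qed.

End weighted_Rintegral.

(** Laws are produced here as the distribution of a random variable under a
    density; only the expectations of bounded functions matter later. *)
Lemma weighted_law d d' (T : measurableType d) (Y : measurableType d')
    (R : realType) (mu : {measure set T -> \bar R}) (rho : T -> R) (X : T -> Y) :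
  measurable_fun setT rho -> (forall x, 0 <= rho x) ->
  (\int[mu]_x (rho x)%:E = 1)%E -> measurable_fun setT X ->
  exists P : probability Y R, forall g, bounded_measurable g ->
    \int[P]_y g y = \int[mu]_x (g (X x) * rho x).
Proof.
move=> mrho rho0 rho1 mX.
pose X' : {mfun T >-> Y} := HB.pack X (isMeasurableFun.Build _ _ _ _ X mX).
pose nu := weighted mu mrho rho0.
have nuT : nu setT = 1%E by rewrite /nu /weighted/=.
pose nuP : probability T R := HB.pack (weighted mu mrho rho0)
  (Measure_isProbability.Build _ _ _ (weighted mu mrho rho0) nuT).
pose P : probability Y R := distribution nuP X'.
exists P => g bg.
have [mg _] := bg.
rewrite -Rintegral_weighted; last exact: measurableT_comp.
rewrite /Rintegral; congr fine.
have ig : nuP.-integrable (X' @^-1` setT) ((EFin \o g) \o X').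
  rewrite preimage_setT; apply: (integrable_bounded (f := g \o X')).
    have nuoo : (nu setT < +oo)%E by rewrite nuT ltry.
    exact: nuoo.
  exact: bounded_measurable_comp bg.
have mEg : measurable_fun setT (EFin \o g) by exact/measurable_EFinP.
exact: (integral_pushforward mX mEg ig measurableT).
Qed.

Lemma mixture_law d (Y : measurableType d) (R : realType)
    (P Q : probability Y R) (a : R) : 0 <= a <= 1 ->
  exists P' : probability Y R, forall g, bounded_measurable g ->
    \int[P']_y g y = a * \int[P]_y g y + (1 - a) * \int[Q]_y g y.
Proof.
move=> /andP[a0 a1]; have b0 : 0 <= 1 - a by rewrite subr_ge0.
pose mc c := @measurable_cst _ _ Y R setT c.
pose Pa : {measure set Y -> \bar R} := weighted P (mc a) (fun=> a0).
pose Qb : {measure set Y -> \bar R} := weighted Q (mc (1 - a)) (fun=> b0).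
pose m : {measure set Y -> \bar R} := measure_add Pa Qb.
have wT (c : R) (c0 : 0 <= c) (S : probability Y R) :
    weighted S (mc c) (fun=> c0) setT = c%:E.
  have := @integral_cst _ _ _ S setT measurableT c%:E.
  by rewrite /= probability_setT mule1.
have mT : m setT = 1%E.
  rewrite -[m setT]/(measure_add Pa Qb setT) measure_addE [X in (X + _)%E](wT _ a0 P).
  by rewrite [X in (_ + X)%E](wT _ b0 Q) -EFinD subrKC.
have m1 : (\int[m]_x ((cst 1 x)%:E : \bar R) = 1)%E.
  by rewrite (integral_cst m measurableT 1%:E) mT mule1.
have [P' P'E] := weighted_law (mu := m) (mc 1) (fun=> ler01) m1 (@measurable_id _ Y setT).
exists P' => g bg; have [mg _] := bg.
have iPa : Pa.-integrable setT (EFin \o g).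
  by apply: integrable_bounded bg; rewrite [X in (X < _)%E](wT _ a0 P) ltry.
have iQb : Qb.-integrable setT (EFin \o g).
  by apply: integrable_bounded bg; rewrite [X in (X < _)%E](wT _ b0 Q) ltry.
rewrite P'E//; under eq_Rintegral do rewrite mulr1.
rewrite /Rintegral (integral_measure_add measurableT iPa iQb).
rewrite fineD; [|exact: integrable_fin_num iPa|exact: integrable_fin_num iQb].
have iS (S : probability Y R) : S.-integrable setT (EFin \o g).
  by apply: integrable_bounded bg; rewrite /= probability_setT ltry.
congr (_ + _); rewrite integral_weighted//.
- by rewrite -[LHS]/(\int[P]_y (g y * a)) (RintegralZr _ measurableT (iS P)) mulrC.
- by rewrite -[LHS]/(\int[Q]_y (g y * (1 - a))) (RintegralZr _ measurableT (iS Q)) mulrC.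
Qed.

Section Rintegral_limits.
Context d (T : measurableType d) (R : realType).
Variable mu : {measure set T -> \bar R}.

Lemma dominated_cvg_Rintegral (f_ : nat -> T -> R) (f g : T -> R) :
  (forall n, measurable_fun setT (f_ n)) ->
  mu.-integrable setT (EFin \o g) -> (forall n x, `|f_ n x| <= g x) ->
  (forall x, f_ n x @[n --> \oo] --> f x) ->
  [/\ measurable_fun setT f, mu.-integrable setT (EFin \o f) &
   \int[mu]_x f_ n x @[n --> \oo] --> \int[mu]_x f x].
Proof.
move=> mf ig fg cf.
have mf' : measurable_fun setT f by apply: measurable_fun_cvg mf _ => x _; exact: cf.
have mEf n : measurable_fun setT (EFin \o f_ n) by exact/measurable_EFinP.
have mEf' : measurable_fun setT (EFin \o f) by exact/measurable_EFinP.
have cEf : {ae mu, forall x, setT x -> (EFin \o f_ n) x @[n --> \oo] --> (EFin \o f) x}.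
  by apply: aeW => x _; apply: cvg_EFin; [exact: nearW|exact: cf].
have fEg : {ae mu, forall x n, setT x -> (`|(EFin \o f_ n) x| <= (EFin \o g) x)%E}.
  by apply: aeW => x n _ /=; rewrite lee_fin.
have [i1 _ i3] := dominated_convergence measurableT mEf mEf' cEf ig fEg.
split => //; rewrite /Rintegral.
apply: fine_cvg; rewrite fineK; first exact: i3.
exact: integrable_fin_num.
Qed.

Lemma Rintegral_sum (I : Type) (s : seq I) (f : I -> T -> R) :
  (forall i, mu.-integrable setT (EFin \o f i)) ->
  \int[mu]_x (\sum_(i <- s) f i x) = \sum_(i <- s) \int[mu]_x f i x.
Proof.
move=> fi; elim: s => [|i s ih].
  rewrite big_nil; under eq_Rintegral do rewrite big_nil.
  by rewrite /Rintegral integral0_eq.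
rewrite big_cons -ih -RintegralD//; last first.
  have -> : EFin \o (fun x => \sum_(j <- s) f j x) =
      (fun x => \sum_(j <- s) (EFin \o f j) x)%E.
    by apply/funext => x /=; rewrite sumEFin.
  exact: integrable_sum.
by apply: eq_Rintegral => x _; rewrite big_cons.
Qed.

End Rintegral_limits.

(** * The surface measure and the moments of a linear form *)

Section pointwise_derivatives.
Variable R : realType.
Implicit Types (f g : R -> R) (x a b : R).

(** The next lemmas state the rules of differentiation on explicit lambda
    terms, which is the form that the tactic below can match. *)
Lemma is_derive_cst_fun x (c : R) : is_derive x (1 : R) (fun=> c) 0.
Proof. exact: is_derive_cst. Qed.

Lemma is_derive_addfun f g x a b : is_derive x (1 : R) f a ->
  is_derive x (1 : R) g b -> is_derive x (1 : R) (fun y => f y + g y) (a + b).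
Proof. by move=> df dg; exact: (is_deriveD df dg). Qed.

Lemma is_derive_subfun f g x a b : is_derive x (1 : R) f a ->
  is_derive x (1 : R) g b -> is_derive x (1 : R) (fun y => f y - g y) (a - b).
Proof. by move=> df dg; exact: (is_deriveB df dg). Qed.

Lemma is_derive_mulfun f g x a b : is_derive x (1 : R) f a ->
  is_derive x (1 : R) g b ->
  is_derive x (1 : R) (fun y => f y * g y) (a * g x + f x * b).
Proof.
move=> df dg; apply: is_derive_eq (is_deriveM df dg) _.
by rewrite /GRing.scale/= addrC mulrC (mulrC (f x)); ring.
Qed.

Lemma is_derive_expfun f x a n : is_derive x (1 : R) f a ->
  is_derive x (1 : R) (fun y => f y ^+ n) (n%:R * f x ^+ n.-1 * a).
Proof.
move=> df; elim: n => [|n ih]; first by rewrite !mul0r; exact: is_derive_cst_fun.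
have -> : (fun y => f y ^+ n.+1) = (fun y => f y * f y ^+ n).
  by apply/funext => y; rewrite exprS.
apply: is_derive_eq (is_derive_mulfun df ih) _.
case: n {ih} => [|n]/=; first by rewrite expr0; ring.
by rewrite exprS -[n.+2%:R]natr1; ring.
Qed.

End pointwise_derivatives.

Ltac derive_pointwise := repeat first
  [exact: is_derive_cst_fun | exact: is_derive_sin | exact: is_derive_cos
  | apply: is_derive_subfun | apply: is_derive_addfun
  | apply: is_derive_expfun | apply: is_derive_mulfun].

Section dot_product.
Variable R : realType.
Implicit Types u v w : 'rV[R]_3.

Lemma dotE u v : dot u v = u 0 0 * v 0 0 + u 0 1 * v 0 1 + u 0 2 * v 0 2.
Proof.
rewrite /dot !big_ord_recl big_ord0 addr0 addrA; congr (_ + _ * _ + _ * _);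
  by congr (_ _ _); apply/val_inj.
Qed.

End dot_product.

Section sphere.
Variable R : realType.
Local Notation leb := (@lebesgue_measure R).
Local Notation T2 := (measurableTypeR R * measurableTypeR R)%type.
Local Notation chart := (@sphere_chart R : set T2).

Lemma integrable_itv_bounded (f : R -> R) (a b : R) : bounded_measurable f ->
  leb.-integrable `[a, b] (EFin \o f).
Proof.
move=> [mf [M fM]]; apply: measurable_bounded_integrable => //.
- by rewrite /= lebesgue_measure_itv/=; case: ifP => _; rewrite -?EFinB ltry.
- exact: measurable_funTS.
- exists M; split; first exact: num_real.
  by move=> y My x _ /=; rewrite (le_trans (fM x))// ltW.
Qed.

Lemma Rintegral_cst0 (A : set R) : \int[leb]_(x in A) (0 : R) = 0.
Proof. by rewrite /Rintegral integral0_eq. Qed.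

Lemma measurable_chart : measurable chart.
Proof. by apply: measurableX; exact: measurable_itv. Qed.

Lemma bounded_measurable_sin1 : bounded_measurable (fun p : T2 => sin p.1 : R).
Proof.
split; last by exists 1 => p; rewrite ler_norml sin_geN1 sin_le1.
apply: (@measurableT_comp _ _ _ _ _ _ sin) => //.
by apply: continuous_measurable_fun; exact: continuous_sin.
Qed.

Lemma bounded_measurable_cos1 : bounded_measurable (fun p : T2 => cos p.1 : R).
Proof.
split; last by exists 1 => p; rewrite ler_norml cos_geN1 cos_le1.
apply: (@measurableT_comp _ _ _ _ _ _ cos) => //.
by apply: continuous_measurable_fun; exact: continuous_cos.
Qed.

Lemma bounded_measurable_sin2 : bounded_measurable (fun p : T2 => sin p.2 : R).
Proof.
split; last by exists 1 => p; rewrite ler_norml sin_geN1 sin_le1.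
apply: (@measurableT_comp _ _ _ _ _ _ sin) => //.
by apply: continuous_measurable_fun; exact: continuous_sin.
Qed.

Lemma bounded_measurable_cos2 : bounded_measurable (fun p : T2 => cos p.2 : R).
Proof.
split; last by exists 1 => p; rewrite ler_norml cos_geN1 cos_le1.
apply: (@measurableT_comp _ _ _ _ _ _ cos) => //.
by apply: continuous_measurable_fun; exact: continuous_cos.
Qed.

Definition area (p : T2) : R := sin p.1 * \1_chart p.

Lemma bounded_measurable_area : bounded_measurable area.
Proof.
apply: bounded_measurableM; first exact: bounded_measurable_sin1.
apply: bounded_measurable_indic; exact: measurable_chart.
Qed.

Lemma area_ge0 p : 0 <= area p.
Proof.
rewrite /area indicE; have [/set_mem[]|] := boolP (p \in _); last by rewrite mulr0.
by rewrite /= in_itv/= mulr1 => ? _; rewrite sin_ge0_pi.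
Qed.

(** Working with a finite measure on the whole parameter plane avoids carrying
    the chart as a domain of integration. *)
Definition surface : set T2 -> \bar R :=
  weighted (@lebesgue2 R) (proj1 bounded_measurable_area) area_ge0.

HB.instance Definition _ := Measure.on surface.

Lemma lebesgue2_chart_lty : (@lebesgue2 R chart < +oo)%E.
Proof.
rewrite /lebesgue2/= product_measure1E//=.
by rewrite !lebesgue_measure_itv/=; case: ifP => _; case: ifP => _;
  rewrite -?EFinB -?EFinM ?mule0 ?mul0e ltry.
Qed.

Lemma integrable_chart (K : T2 -> R) : bounded_measurable K ->
  (@lebesgue2 R).-integrable setT (EFin \o (K \* \1_chart)%R).
Proof.
move=> bK.
have -> : K \* \1_chart = (fun x => \1_chart x * K x) by apply/funext => x/=; rewrite mulrC.
apply: integrable_boundedM bK.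
apply/integrableP; split; first by apply/measurable_EFinP; apply: measurable_indic; exact: measurable_chart.
under eq_integral do rewrite /= ger0_norm//.
by rewrite integral_indic//= ?setIT//; [exact: lebesgue2_chart_lty|exact: measurable_chart].
Qed.

Lemma integrable_chart_in (K : T2 -> R) : bounded_measurable K ->
  (@lebesgue2 R).-integrable chart (EFin \o K).
Proof.
move=> [mK [M KM]]; apply: measurable_bounded_integrable.
- exact: measurable_chart.
- exact: lebesgue2_chart_lty.
- exact: measurable_funTS.
- exists M; split; first exact: num_real.
  by move=> y My x _ /=; rewrite (le_trans (KM x))// ltW.
Qed.

Lemma surface_lty : (surface setT < +oo)%E.
Proof.
have := integrable_chart bounded_measurable_sin1.
by move=> /integrable_lty; apply.
Qed.

Let surface_fin_num : fin_num_fun surface.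
Proof.
move=> A mA; rewrite ge0_fin_numE// (le_lt_trans _ surface_lty)//.
by apply: le_measure; rewrite ?inE.
Qed.

HB.instance Definition _ := @Measure_isFinite.Build _ _ _ surface surface_fin_num.

Lemma Rintegral_surface (F : T2 -> R) : measurable_fun setT F ->
  \int[surface]_p F p = \int[@lebesgue2 R]_(p in chart) (F p * sin p.1).
Proof.
move=> mF; rewrite Rintegral_weighted// [RHS]Rintegral_mkcond.
apply: eq_Rintegral => p _; rewrite patchE /area indicE.
by case: ifP; rewrite ?(mulr1, mulr0).
Qed.

Lemma integral_surface (F : T2 -> R) : measurable_fun setT F ->
  (\int[surface]_p (F p)%:E = \int[@lebesgue2 R]_(p in chart) (F p * sin p.1)%:E)%E.
Proof.
move=> mF; rewrite integral_weighted// [RHS]integral_mkcond.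
apply: eq_integral => p _; rewrite patchE /area indicE.
by case: ifP; rewrite ?(mulr1, mulr0).
Qed.

Lemma Rintegral_chart12 (K : T2 -> R) : bounded_measurable K ->
  (\int[@lebesgue2 R]_(p in chart) K p)%R =
  \int[leb]_(x in `[0, pi]) \int[leb]_(y in `[0, 2 * pi]) K (x, y).
Proof.
move=> bK.
have iK := integrable_chart bK.
rewrite Rintegral_mkcond [RHS]Rintegral_mkcond.
rewrite /Rintegral.
have -> : (fun p => ((K \_ chart) p)%:E) = EFin \o (K \* \1_chart)%R.
  by apply/funext => p /=; rewrite patchE indicE; case: ifP; rewrite ?(mulr1, mulr0).
rewrite /lebesgue2 -integral12_prod_meas1//; congr fine.
apply: eq_integral => x _; rewrite /fubini_F patchE.
case: ifPn => x0; last first.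
  rewrite integral0_eq// => y _ /=; rewrite indicE memNset ?mulr0// => -[/= xI _].
  by move: x0; rewrite notin_setE.
have -> : (\int[leb]_y (EFin \o (K \* \1_chart)%R) (x, y) =
          \int[leb]_(y in `[0%R, (2 * pi)%R]) (K (x, y))%:E)%E.
  rewrite [RHS]integral_mkcond; apply: eq_integral => y _ /=.
  rewrite patchE indicE /=.
  have -> : ((x, y) \in chart) = (y \in `[0%R, (2 * pi)%R]%classic).
    apply/idP/idP => /set_mem; first by case=> _ /= ?; apply/mem_set.
    by move=> yI; apply/mem_set; split => //; exact/set_mem.
  by case: ifP; rewrite ?(mulr1, mulr0).
rewrite /Rintegral fineK//.
apply: integrable_fin_num; first exact: measurable_itv.
have [mK [M KM]] := bK.
apply: (integrable_itv_bounded (f := fun y => K (x, y))).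
split; last by exists M => z; exact: KM.
by apply: (measurableT_comp mK); exact: measurable_fun_pair.
Qed.

Lemma Rintegral_chart21 (K : T2 -> R) : bounded_measurable K ->
  (\int[@lebesgue2 R]_(p in chart) K p)%R =
  \int[leb]_(y in `[0, 2 * pi]) \int[leb]_(x in `[0, pi]) K (x, y).
Proof.
move=> bK.
have iK := integrable_chart bK.
rewrite Rintegral_mkcond [RHS]Rintegral_mkcond.
rewrite /Rintegral.
have -> : (fun p => ((K \_ chart) p)%:E) = EFin \o (K \* \1_chart)%R.
  by apply/funext => p /=; rewrite patchE indicE; case: ifP; rewrite ?(mulr1, mulr0).
rewrite /lebesgue2 -integral21_prod_meas1//; congr fine.
apply: eq_integral => y _; rewrite /fubini_G patchE.
case: ifPn => y0; last first.
  rewrite integral0_eq// => x _ /=; rewrite indicE memNset ?mulr0// => -[/= _ yI].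
  by move: y0; rewrite notin_setE.
have -> : (\int[leb]_x (EFin \o (K \* \1_chart)%R) (x, y) =
          \int[leb]_(x in `[0%R, pi%R]) (K (x, y))%:E)%E.
  rewrite [RHS]integral_mkcond; apply: eq_integral => x _ /=.
  rewrite patchE indicE /=.
  have -> : ((x, y) \in chart) = (x \in `[0%R, pi%R]%classic).
    apply/idP/idP => /set_mem; first by case=> /= ? _; apply/mem_set.
    by move=> yI; apply/mem_set; split => //; exact/set_mem.
  by case: ifP; rewrite ?(mulr1, mulr0).
rewrite /Rintegral fineK//.
apply: integrable_fin_num; first exact: measurable_itv.
have [mK [M KM]] := bK.
apply: (integrable_itv_bounded (f := fun x => K (x, y))).
split; last by exists M => x; exact: KM.
by apply: (measurableT_comp mK); exact: measurable_fun_pair.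
Qed.

Lemma bounded_measurableX d (T : measurableType d) (f : T -> R) n :
  bounded_measurable f -> bounded_measurable (fun x => f x ^+ n).
Proof.
move=> bf; elim: n => [|n ih]; first exact: bounded_measurable_cst.
have -> : (fun x => f x ^+ n.+1) = (fun x => f x * f x ^+ n).
  by apply/funext => x; rewrite exprS.
exact: bounded_measurableM.
Qed.

Lemma derivable_continuous (f : R -> R) (x : R) :
  (exists l, is_derive x (1 : R) f l) -> {for x, continuous f}.
Proof.
by move=> [l dl]; apply/differentiable_continuous/derivable1_diffP; case: dl.
Qed.

Lemma Rintegral_derive (F f : R -> R) (a b : R) : a < b ->
  (forall x : R, is_derive x (1 : R) F (f x)) -> continuous f ->
  \int[leb]_(x in `[a, b]) f x = F b - F a.
Proof.
move=> ab dF cf; rewrite /Rintegral.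
have cF : continuous F.
  by move=> y; apply/differentiable_continuous/derivable1_diffP; case: (dF y).
rewrite (@continuous_FTC2 _ f F a b)//.
- exact: continuous_subspaceT.
- split => //.
  + by apply: cvg_at_right_filter; exact: cF.
  + by apply: cvg_at_left_filter; exact: cF.
- by move=> x _; rewrite derive1E; case: (dF x).
Qed.

Section power_moments.
Variable xi : 'rV[R]_3.
Local Notation x1 := (xi 0 0).
Local Notation x2 := (xi 0 1).
Local Notation x3 := (xi 0 2).

(** [sphere_dot] is the scalar product of [xi] with a point of the sphere, and
    [sphere_dot_theta], [sphere_dot_phi] are its components along the unit
    vectors tangent to the meridian and to the parallel. *)
Definition sphere_dot (p : T2) : R := sin p.1 * (x1 * cos p.2 + x2 * sin p.2) + cos p.1 * x3.
Definition sphere_dot_theta (p : T2) : R := cos p.1 * (x1 * cos p.2 + x2 * sin p.2) - sin p.1 * x3.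
Definition sphere_dot_phi (p : T2) : R := x2 * cos p.2 - x1 * sin p.2.

Lemma dot_sphere p : dot xi (sphere_point p) = sphere_dot p.
Proof. by rewrite dotE !mxE/= /sphere_dot; ring. Qed.

Lemma bounded_measurable_sphere_dot : bounded_measurable sphere_dot.
Proof.
rewrite /sphere_dot.
by repeat (apply: bounded_measurableD || apply: bounded_measurableM ||
  exact: bounded_measurable_cst || exact: bounded_measurable_sin1 ||
  exact: bounded_measurable_sin2 || exact: bounded_measurable_cos1 ||
  exact: bounded_measurable_cos2).
Qed.

(** The derivatives of the two components of the vector field
    [sphere_dot ^ n] times the tangential gradient; their sum is the surface
    divergence times [sin p.1].  They are regular at the poles. *)
Definition theta_derivative n (p : T2) : R := cos p.1 * sphere_dot p ^+ n * sphere_dot_theta p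
   + sin p.1 * (n%:R * sphere_dot p ^+ n.-1 * sphere_dot_theta p * sphere_dot_theta p) - sin p.1 * sphere_dot p ^+ n * sphere_dot p.
Definition phi_derivative n (p : T2) : R := n%:R * sphere_dot p ^+ n.-1 * (sin p.1 * sphere_dot_phi p) * sphere_dot_phi p
   - sphere_dot p ^+ n * (x1 * cos p.2 + x2 * sin p.2).

Lemma derive_theta n (x y : R) :
  is_derive x (1 : R) (fun x => sin x * sphere_dot (x, y) ^+ n * sphere_dot_theta (x, y)) (theta_derivative n (x, y)).
Proof.
rewrite /sphere_dot /sphere_dot_theta /theta_derivative/= /sphere_dot /sphere_dot_theta/=; set A := x1 * _ + _.
apply: is_derive_eq; first by derive_pointwise.
by case: n => [|n]; rewrite ?expr0 /GRing.scale/=; ring.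
Qed.

Lemma derive_phi n (x y : R) :
  is_derive y (1 : R) (fun y => sphere_dot (x, y) ^+ n * sphere_dot_phi (x, y)) (phi_derivative n (x, y)).
Proof.
rewrite /sphere_dot /sphere_dot_phi /phi_derivative/= /sphere_dot /sphere_dot_phi/=.
apply: is_derive_eq; first by derive_pointwise.
by case: n => [|n]; rewrite ?expr0 /GRing.scale/=; ring.
Qed.

Ltac bounded_trigo :=
  repeat (apply: bounded_measurableB || apply: bounded_measurableD ||
  apply: bounded_measurableM ||
  apply: bounded_measurableX ||
  exact: bounded_measurable_cst || exact: bounded_measurable_sin1 ||
  exact: bounded_measurable_sin2 || exact: bounded_measurable_cos1 ||
  exact: bounded_measurable_cos2).

Lemma bounded_measurable_sphere_dotX n : bounded_measurable (fun p => sphere_dot p ^+ n).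
Proof. rewrite /sphere_dot; bounded_trigo. Qed.

Lemma bounded_measurable_theta_derivative n : bounded_measurable (theta_derivative n).
Proof. rewrite /theta_derivative /sphere_dot /sphere_dot_theta; bounded_trigo. Qed.

Lemma bounded_measurable_phi_derivative n : bounded_measurable (phi_derivative n).
Proof. rewrite /phi_derivative /sphere_dot /sphere_dot_phi; bounded_trigo. Qed.

Ltac derivable_pointwise := eexists; derive_pointwise.

Lemma sphere_dot_frame p : sphere_dot p ^+ 2 + sphere_dot_theta p ^+ 2 + sphere_dot_phi p ^+ 2 = dot xi xi.
Proof.
case: p => x y; apply/esym.
rewrite dotE /sphere_dot /sphere_dot_theta /sphere_dot_phi/=.
  transitivity ((sin x ^+ 2 + cos x ^+ 2) * ((sin y ^+ 2 + cos y ^+ 2) * 0) +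
    (x1 * x1 + x2 * x2) * (cos y ^+ 2 + sin y ^+ 2) + x3 * x3).
    by rewrite cos2Dsin2; ring.
  have -> : x3 * x3 = x3 * x3 * (cos x ^+ 2 + sin x ^+ 2) by rewrite cos2Dsin2 mulr1.
  set A := x1 * cos y + x2 * sin y.
  have -> : (x1 * x1 + x2 * x2) * (cos y ^+ 2 + sin y ^+ 2) =
      A ^+ 2 * (cos x ^+ 2 + sin x ^+ 2) + (x2 * cos y - x1 * sin y) ^+ 2.
    by rewrite (cos2Dsin2 x) mulr1 /A; ring.
  by ring.
Qed.

Definition power_moment n := \int[surface]_p sphere_dot p ^+ n.

(** The divergence of that vector field integrates to 0.  Since the tangential
    gradient has squared length [|xi|^2 - sphere_dot ^ 2] and divergence
    [- 2 sphere_dot], this is a recurrence between moments. *)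
Lemma power_moment_rec n : (n.+2)%:R * power_moment n.+1 = n%:R * dot xi xi * power_moment n.-1.
Proof.
have D1E : \int[@lebesgue2 R]_(p in chart) theta_derivative n p = 0.
  rewrite Rintegral_chart21; last exact: bounded_measurable_theta_derivative.
  rewrite -[RHS](@Rintegral_cst0 (`[0, 2 * pi]%classic)).
  apply: eq_Rintegral => y _.
  rewrite (Rintegral_derive (pi_gt0 R) (fun x => derive_theta n x y)).
    by rewrite sinpi sin0 !mul0r subrr.
  by move=> x; apply: derivable_continuous; rewrite /theta_derivative/= /sphere_dot /sphere_dot_theta/=; derivable_pointwise.
have D2E : \int[@lebesgue2 R]_(p in chart) phi_derivative n p = 0.
  rewrite Rintegral_chart12; last exact: bounded_measurable_phi_derivative.
  rewrite -[RHS](@Rintegral_cst0 (`[0, pi]%classic)).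
  apply: eq_Rintegral => x _.
  have pi2 : 0 < 2 * pi :> R by rewrite mulr_gt0// pi_gt0.
  rewrite (Rintegral_derive pi2 (fun y => derive_phi n x y)).
    by rewrite /sphere_dot /sphere_dot_phi/= (mulrC 2) mulr_natr -[pi *+ 2]add0r sinD2pi cosD2pi subrr.
  by move=> y; apply: derivable_continuous; rewrite /phi_derivative/= /sphere_dot /sphere_dot_phi/=; derivable_pointwise.
have mchart := measurable_chart.
have sgX m : (@lebesgue2 R).-integrable chart (EFin \o (fun p => sphere_dot p ^+ m * sin p.1)).
  apply: integrable_chart_in; apply: bounded_measurableM; last exact: bounded_measurable_sin1.
  exact: bounded_measurable_sphere_dotX.
rewrite /power_moment !Rintegral_surface; [|exact: (bounded_measurable_sphere_dotX _).1..].
rewrite -RintegralZl// -RintegralZl//.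
have iZ m c : (@lebesgue2 R).-integrable chart
    (EFin \o (fun p => c * (sphere_dot p ^+ m * sin p.1))).
  apply: integrable_chart_in; apply: bounded_measurableM; first exact: bounded_measurable_cst.
  apply: bounded_measurableM; last exact: bounded_measurable_sin1.
  exact: bounded_measurable_sphere_dotX.
apply/eqP; rewrite -subr_eq0 -RintegralB//.
apply/eqP; rewrite -[RHS]oppr0 -[in RHS]D1E -[X in - X]addr0 -[in RHS]D2E.
have iD1 := integrable_chart_in (bounded_measurable_theta_derivative n).
have iD2 := integrable_chart_in (bounded_measurable_phi_derivative n).
rewrite -RintegralD// -mulN1r -RintegralZl//; last first.
  by apply: integrable_chart_in; apply: bounded_measurableD;
    [exact: bounded_measurable_theta_derivative|exact: bounded_measurable_phi_derivative].
apply: eq_Rintegral => -[x y] _ /=.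
rewrite -(sphere_dot_frame (x, y)).
rewrite /theta_derivative /phi_derivative/=.
have -> : x1 * cos y + x2 * sin y = cos x * sphere_dot_theta (x, y) + sin x * sphere_dot (x, y).
  rewrite /sphere_dot /sphere_dot_theta/= -[LHS]mulr1 -(cos2Dsin2 x); ring.
case: n {D1E D2E iD1 iD2} => [|n] /=; first by rewrite !expr0; ring.
by rewrite !exprS; ring.
Qed.

End power_moments.
End sphere.

(** * Exchanging two axes on the sphere *)

Section image_measure.
Context d d' (T : measurableType d) (Y : measurableType d') (R : realType).

Definition image_measure (mu : {measure set T -> \bar R}) (X : T -> Y)
    (mX : measurable_fun setT X) : {measure set Y -> \bar R} :=
  measure_function_pushforward__canonical__measure_function_Measure mu mX.

End image_measure.

Section moment_determinacy.
Variable R : realType.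

(** Iterating this polynomial on [0, 1] converges to a step at 1/2.  It gives
    polynomial approximations of indicators of half lines which are uniformly
    bounded, so that moments determine a law without any approximation theorem. *)
Definition smoothstep : {poly R} := 3%:P * 'X^2 - 2%:P * 'X^3.

Lemma smoothstepE y : smoothstep.[y] = 3 * y ^+ 2 - 2 * y ^+ 3.
Proof. by rewrite /smoothstep !hornerE. Qed.

Lemma smoothstep_itv y : 0 <= y <= 1 -> 0 <= smoothstep.[y] <= 1.
Proof.
move=> /andP[y0 y1]; rewrite smoothstepE; apply/andP; split.
  have -> : 3 * y ^+ 2 - 2 * y ^+ 3 = y ^+ 2 * (3 - 2 * y) by ring.
  by apply: mulr_ge0; [exact: sqr_ge0|lra].
rewrite -subr_ge0.
have -> : 1 - (3 * y ^+ 2 - 2 * y ^+ 3) = (1 - y) ^+ 2 * (1 + 2 * y) by ring.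
by apply: mulr_ge0; [exact: sqr_ge0|lra].
Qed.

Fixpoint smoothsteps n (y : R) : R :=
  if n is n'.+1 then smoothstep.[smoothsteps n' y] else y.

Lemma smoothsteps_itv n y : 0 <= y <= 1 -> 0 <= smoothsteps n y <= 1.
Proof. by move=> y01; elim: n => //= n ih; exact: smoothstep_itv. Qed.

Lemma smoothstepsC n y : smoothsteps n (1 - y) = 1 - smoothsteps n y.
Proof. by elim: n => //= n ->; rewrite !smoothstepE; ring. Qed.

Lemma cvg_smoothsteps_lt y : 0 <= y < 2^-1 ->
  smoothsteps n y @[n --> \oo] --> (0 : R).
Proof.
move=> /andP[y0 y1]; pose q := y * (3 - 2 * y).
have q0 : 0 <= q by rewrite /q; nra.
have q1 : q < 1 by rewrite /q; nra.
have le_n n : 0 <= smoothsteps n y <= y /\ smoothsteps n y <= q ^+ n * y.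
  elim: n => [|n [/andP[h1 h2] h3]]; first by rewrite y0 lexx expr0 mul1r lexx.
  have hq : smoothsteps n.+1 y = smoothsteps n y * (smoothsteps n y * (3 - 2 * smoothsteps n y)).
    by rewrite /= smoothstepE; ring.
  have hq2 : 0 <= smoothsteps n y * (3 - 2 * smoothsteps n y) <= q.
    by rewrite /q; apply/andP; split; nra.
  move: hq2 => /andP[c1 c2]; rewrite hq; split.
    apply/andP; split; first exact: mulr_ge0.
    by rewrite (le_trans _ h2)// ler_piMr// (le_trans c2)// ltW.
  by rewrite exprSr mulrAC; apply: ler_pM.
apply: (@squeeze_cvgr _ _ _ _ (fun=> 0) (fun n => q ^+ n * y)).
- by apply: nearW => n; have [/andP[-> _] ->] := le_n n.
- exact: cvg_cst.
- have := @cvg_geometric R y q; rewrite ger0_norm// => /(_ q1).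
  by apply: cvg_trans; apply: near_eq_cvg; apply: nearW => n; rewrite /geometric/= mulrC.
Qed.

(** The value 1/2 at 1/2 is forced by the symmetry of the smoothstep. *)
Definition half_step (y : R) : R :=
  if y < 2^-1 then 0 else if y == 2^-1 then 2^-1 else 1.

Lemma cvg_smoothsteps y : 0 <= y <= 1 ->
  smoothsteps n y @[n --> \oo] --> half_step y.
Proof.
move=> /andP[y0 y1]; rewrite /half_step; case: ltgtP => [yl|yg|->].
- by apply: cvg_smoothsteps_lt; rewrite y0.
- have /cvg_smoothsteps_lt h : 0 <= 1 - y < 2^-1 by lra.
  have -> : (fun n => smoothsteps n y) = (fun n => 1 - smoothsteps n (1 - y)).
    by apply/funext => n; rewrite smoothstepsC subKr.
  rewrite -[X in _ --> X]subr0; apply: cvgB => //; exact: cvg_cst.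
- have -> : (fun n => smoothsteps n 2^-1) = (fun=> 2^-1).
    apply/funext => n; have := smoothstepsC n 2^-1.
    have -> : 1 - 2^-1 = 2^-1 :> R by lra.
    lra.
  exact: cvg_cst.
Qed.

Fixpoint smoothsteps_poly n (p : {poly R}) : {poly R} :=
  if n is n'.+1 then smoothstep \Po smoothsteps_poly n' p else p.

Lemma horner_smoothsteps n p x : (smoothsteps_poly n p).[x] = smoothsteps n p.[x].
Proof. by elim: n => //= n <-; rewrite horner_comp. Qed.

Context d (T : measurableType d) (mu : {measure set T -> \bar R}).
Hypothesis mu_fin : (mu setT < +oo)%E.
Variables (X1 X2 : T -> R).
Hypotheses (mX1 : measurable_fun setT X1) (mX2 : measurable_fun setT X2).
Hypotheses (X1_le1 : forall t, `|X1 t| <= 1) (X2_le1 : forall t, `|X2 t| <= 1).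

Section nonnegative_weight.
Variables (w1 w2 : T -> R).
Hypotheses (bw1 : bounded_measurable w1) (bw2 : bounded_measurable w2).
Hypotheses (w1_ge0 : forall t, 0 <= w1 t) (w2_ge0 : forall t, 0 <= w2 t).
Hypothesis eq_moments : forall n,
  \int[mu]_t (X1 t ^+ n * w1 t) = \int[mu]_t (X2 t ^+ n * w2 t).

Let bX1 : bounded_measurable X1. Proof. by split => //; exists 1. Qed.
Let bX2 : bounded_measurable X2. Proof. by split => //; exists 1. Qed.

Let int_poly (X w : T -> R) (p : {poly R}) :
  bounded_measurable X -> bounded_measurable w ->
  \int[mu]_t (p.[X t] * w t) =
  \sum_(i < size p) p`_i * \int[mu]_t (X t ^+ i * w t).
Proof.
move=> bX bw.
have bXw i : bounded_measurable (fun t => X t ^+ i * w t).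
  by apply: bounded_measurableM => //; exact: bounded_measurableX.
have iXw i : mu.-integrable setT (EFin \o (fun t => X t ^+ i * w t)).
  exact: integrable_bounded.
transitivity (\int[mu]_t \sum_(i < size p) p`_i * (X t ^+ i * w t)).
  apply: eq_Rintegral => t _; rewrite horner_coef mulr_suml.
  by apply: eq_bigr => i _; rewrite mulrA.
rewrite (@Rintegral_sum _ _ _ _ _ _ (fun i t => p`_(i : 'I__) * (X t ^+ i * w t))).
  by apply: eq_bigr => i _; rewrite RintegralZl.
move=> i; apply: integrable_bounded => //; apply: bounded_measurableM => //.
exact: bounded_measurable_cst.
Qed.

Let eq_poly_integral (p : {poly R}) :
  \int[mu]_t (p.[X1 t] * w1 t) = \int[mu]_t (p.[X2 t] * w2 t).
Proof. by rewrite !int_poly//; apply: eq_bigr => i _; rewrite eq_moments. Qed.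

(** An affine map that sends [a] to 1/2 and [-1, 1] into [0, 1]. *)
Let ramp (a : R) : {poly R} := (2^-1)%:P + ((2 * (1 + `|a|))^-1)%:P * ('X - a%:P).

Let rampE a x : (ramp a).[x] = 2^-1 + (x - a) / (2 * (1 + `|a|)).
Proof. by rewrite /ramp !hornerE mulrC. Qed.

Let den_gt0 (a : R) : 0 < 2 * (1 + `|a|) :> R.
Proof. by have := normr_ge0 a; lra. Qed.

Let ramp_itv a x : `|x| <= 1 -> 0 <= (ramp a).[x] <= 1.
Proof.
rewrite rampE => x1; have D := den_gt0 a.
have : `|(x - a) / (2 * (1 + `|a|))| <= 2^-1.
  rewrite normrM normfV (gtr0_norm D) ler_pdivrMr//.
  by rewrite (le_trans (ler_normB _ _))//; lra.
by rewrite ler_norml => /andP[]; lra.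
Qed.

Let sgn_ramp a x : half_step (ramp a).[x] =
  if x < a then 0 else if x == a then 2^-1 else 1.
Proof.
rewrite rampE /half_step; have D := den_gt0 a.
have iD : 0 < (2 * (1 + `|a|))^-1 by rewrite invr_gt0.
have [xa|xa|->] := ltgtP x a.
- by rewrite ifT// -subr_gt0 opprD addNKr -mulNr mulr_gt0// opprB subr_gt0.
- rewrite ifF; last by apply/negbTE; rewrite -leNgt lerDl mulr_ge0 ?subr_ge0 ?ltW.
  by rewrite ifF//; apply/negbTE; rewrite -subr_eq0 addrC addKr mulf_neq0// ?subr_eq0 ?gt_eqF.
- by rewrite subrr mul0r addr0 ltxx eqxx.
Qed.

Let step (a x : R) : R := if x < a then 0 else if x == a then 2^-1 else 1.

Let cvg_step X w a : bounded_measurable X -> (forall t, `|X t| <= 1) ->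
  bounded_measurable w ->
  \int[mu]_t ((smoothsteps_poly n (ramp a)).[X t] * w t) @[n --> \oo] -->
  \int[mu]_t (step a (X t) * w t).
Proof.
move=> [mX _] Xle1 bw; have [mw [M wM]] := bw.
have mp (p : {poly R}) : measurable_fun setT (fun t => p.[X t]).
  apply: (@measurableT_comp _ _ _ _ _ _ (horner p)) => //.
  by apply: continuous_measurable_fun; exact: continuous_horner.
have mf n : measurable_fun setT (fun t => (smoothsteps_poly n (ramp a)).[X t] * w t).
  exact: measurable_funM.
have dom n t : `|(smoothsteps_poly n (ramp a)).[X t] * w t| <= `|w t|.
  rewrite horner_smoothsteps normrM ler_piMl//.
  have /andP[h1 h2] := smoothsteps_itv n (ramp_itv a (Xle1 t)).
  by rewrite ger0_norm.
have iw : mu.-integrable setT (EFin \o (fun t => `|w t|)).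
  by apply: integrable_norm; exact: integrable_bounded.
have cf t : (smoothsteps_poly n (ramp a)).[X t] * w t @[n --> \oo] --> step a (X t) * w t.
  apply: cvgM; last exact: cvg_cst.
  rewrite /step -sgn_ramp; under eq_fun do rewrite horner_smoothsteps.
  by apply: cvg_smoothsteps; exact: ramp_itv.
by have [] := dominated_cvg_Rintegral mf iw dom cf.
Qed.

Let eq_step a : \int[mu]_t (step a (X1 t) * w1 t) = \int[mu]_t (step a (X2 t) * w2 t).
Proof.
have h1 := @cvg_step X1 w1 a bX1 X1_le1 bw1.
have h2 := @cvg_step X2 w2 a bX2 X2_le1 bw2.
have E : (fun n => \int[mu]_t ((smoothsteps_poly n (ramp a)).[X1 t] * w1 t)) =
         (fun n => \int[mu]_t ((smoothsteps_poly n (ramp a)).[X2 t] * w2 t)).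
  by apply/funext => n; exact: eq_poly_integral.
by rewrite E in h1; exact: (cvg_unique _ h1 h2).
Qed.

(** Moving the threshold to the right of [a] removes the value 1/2 at [a]. *)
Let step_limit (a x : R) :
  step (a + m.+1%:R^-1) x @[m --> \oo] --> (\1_(`]a, +oo[%classic) x : R).
Proof.
rewrite indicE; have [ax|xa] := ltP a x.
  rewrite mem_set; last by rewrite /= in_itv/= ax.
  have xa0 : 0 < x - a by rewrite subr_gt0.
  apply: cvg_near_cst; have [N _ HN] := near_infty_natSinv_lt (PosNum xa0).
  exists N => // m /= Nm; have /= := HN m Nm; rewrite ltrBrDl => h.
  by rewrite /step ltNge (ltW h)/= gt_eqF.
rewrite memNset; last by rewrite /= in_itv/= andbT; apply/negP; rewrite -leNgt.
have -> : (fun m => step (a + m.+1%:R^-1) x) = (fun=> 0); last exact: cvg_cst.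
apply/funext => m; rewrite /step ifT// (le_lt_trans xa)// ltrDl invr_gt0.
by rewrite ltr0n.
Qed.

Let measurable_step a : measurable_fun setT (step a).
Proof.
have -> : step a = (fun x => \1_(`]a, +oo[%classic) x + 2^-1 * \1_([set a]) x).
  apply/funext => x; rewrite /step !indicE.
  have -> : (x \in `]a, +oo[%classic) = (a < x).
    by apply/idP/idP => [/set_mem|h]; [|apply/mem_set]; rewrite /= in_itv/= andbT.
  have -> : (x \in [set a]) = (x == a).
    by apply/idP/eqP => [/set_mem//|->]; exact/mem_set.
  by case: ltgtP => /=; rewrite ?(mulr0, mulr1, add0r, addr0).
apply: measurable_funD; first by apply: measurable_indic; exact: measurable_itv.
apply: measurable_funM => //; exact: measurable_indic.
Qed.

Let cvg_ray X w a : measurable_fun setT X -> bounded_measurable w ->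
  \int[mu]_t (step (a + n.+1%:R^-1) (X t) * w t) @[n --> \oo] -->
  \int[mu]_t (\1_(`]a, +oo[%classic) (X t) * w t).
Proof.
move=> mX bw; have [mw _] := bw.
have iw : mu.-integrable setT (EFin \o (fun t => `|w t|)).
  by apply: integrable_norm; exact: integrable_bounded.
have mf (n : nat) : measurable_fun setT (fun t => step (a + n.+1%:R^-1) (X t) * w t).
  apply: measurable_funM => //; exact: measurableT_comp (measurable_step _) mX.
have dom (n : nat) t : `|step (a + n.+1%:R^-1) (X t) * w t| <= `|w t|.
  rewrite normrM ler_piMl// /step; case: ifP => _; first by rewrite normr0.
  by case: ifP => _; rewrite ger0_norm//; lra.
have cf t : step (a + n.+1%:R^-1) (X t) * w t @[n --> \oo] -->
    \1_(`]a, +oo[%classic) (X t) * w t.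
  by apply: cvgM; [exact: step_limit|exact: cvg_cst].
by have [] := dominated_cvg_Rintegral mf iw dom cf.
Qed.

Let eq_ray (a : R) : \int[mu]_t (\1_(`]a, +oo[%classic) (X1 t) * w1 t) =
  \int[mu]_t (\1_(`]a, +oo[%classic) (X2 t) * w2 t).
Proof.
have h1 := @cvg_ray X1 w1 a mX1 bw1.
have h2 := @cvg_ray X2 w2 a mX2 bw2.
have E : (fun n => \int[mu]_t (step (a + n.+1%:R^-1) (X1 t) * w1 t)) =
         (fun n => \int[mu]_t (step (a + n.+1%:R^-1) (X2 t) * w2 t)).
  by apply/funext => n; exact: eq_step.
by rewrite E in h1; exact: (cvg_unique _ h1 h2).
Qed.

(** Equal moments give equal integrals of half-line indicators, hence equal
    image measures, since the half lines generate the Borel sets. *)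
Lemma eq_moments_integral_ge0 (beta : R -> R) : bounded_measurable beta ->
  \int[mu]_t (beta (X1 t) * w1 t) = \int[mu]_t (beta (X2 t) * w2 t).
Proof.
move=> bb; have [mb _] := bb.
pose nu1 := weighted mu (proj1 bw1) w1_ge0.
pose nu2 := weighted mu (proj1 bw2) w2_ge0.
pose p1 := image_measure nu1 mX1; pose p2 := image_measure nu2 mX2.
have mA (a : R) : measurable `]a, +oo[%classic by exact: measurable_itv.
have fin (X w : T -> R) (mX : measurable_fun setT X) (bw : bounded_measurable w)
    (w0 : forall t, 0 <= w t) A : measurable A ->
    (image_measure (weighted mu (proj1 bw) w0) mX A < +oo)%E /\
    fine (image_measure (weighted mu (proj1 bw) w0) mX A) =
      \int[mu]_t (\1_A (X t) * w t).
  move=> mA'; have mXA : measurable (X @^-1` A) by rewrite -[X in measurable X]setTI; exact: mX.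
  have iw := integrable_bounded mu_fin bw.
  have pE : image_measure (weighted mu (proj1 bw) w0) mX A =
      (\int[mu]_t (\1_A (X t) * w t)%:E)%E.
    rewrite -[LHS]/(\int[mu]_(t in X @^-1` A) (w t)%:E)%E integral_mkcond.
    apply: eq_integral => t _; rewrite patchE indicE.
    have -> : (t \in X @^-1` A) = (X t \in A) by apply/idP/idP => /set_mem ?; exact/mem_set.
    by case: ifP; rewrite ?(mul1r, mul0r).
  rewrite pE; split => //; apply: integrable_lty => //; apply: integrable_bounded => //.
  by apply: bounded_measurableM => //; apply: (bounded_measurable_comp mX);
    exact: bounded_measurable_indic.
have p12 A : measurable A -> p1 A = p2 A.
  apply: (measure_unique (@RGenOInfty.G R) (fun n => `](- n%:R), +oo[%classic)).
  - exact: RGenOInfty.measurableE.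
  - move=> _ _ [a ->] [c ->]; exists (Order.max a c); apply/seteqP.
    by split => x /=; rewrite !in_itv/= !andbT gt_max => /andP.
  - by move=> n; exists (- n%:R).
  - apply/seteqP; split => // x _; exists (Num.truncn `|x|).+1 => //=.
    rewrite in_itv/= andbT ltrNl (le_lt_trans (ler_norm _))// normrN.
    exact: truncnS_gt.
  - move=> _ [a ->].
    have [f1 e1] := fin _ _ mX1 bw1 w1_ge0 _ (mA a).
    have [f2 e2] := fin _ _ mX2 bw2 w2_ge0 _ (mA a).
    rewrite -(@fineK _ (p1 _)) ?ge0_fin_numE// -(@fineK _ (p2 _)) ?ge0_fin_numE//.
    by rewrite /p1 /p2 e1 e2 eq_ray.
  - by move=> n; have [] := fin _ _ mX1 bw1 w1_ge0 _ (mA (- n%:R)).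
have imE (X w : T -> R) (mX : measurable_fun setT X) (bw : bounded_measurable w)
    (w0 : forall t, 0 <= w t) :
    \int[image_measure (weighted mu (proj1 bw) w0) mX]_x beta x =
    \int[mu]_t (beta (X t) * w t).
  have bbX : bounded_measurable (beta \o X) by exact: bounded_measurable_comp bb.
  transitivity (\int[weighted mu (proj1 bw) w0]_t (beta \o X) t); last first.
    by rewrite Rintegral_weighted//; case: bbX.
  congr fine.
  have mEb : measurable_fun setT (EFin \o beta) by exact/measurable_EFinP.
  apply: (integral_pushforward mX mEb _ measurableT).
  rewrite preimage_setT; apply: (integrable_bounded (f := beta \o X)) => //.
  by have [] := fin _ _ mX bw w0 _ measurableT.
rewrite -(imE _ _ mX1 bw1 w1_ge0) -(imE _ _ mX2 bw2 w2_ge0) /Rintegral; congr fine.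
by apply: eq_measure_integral => A mA' _; exact: p12.
Qed.

End nonnegative_weight.

(** Signed weights reduce to the previous lemma by adding a constant; this is
    why the moments without weight are also assumed to agree. *)
Lemma eq_moments_integral (w1 w2 : T -> R) (beta : R -> R) :
  bounded_measurable w1 -> bounded_measurable w2 ->
  (forall n, \int[mu]_t (X1 t ^+ n) = \int[mu]_t (X2 t ^+ n)) ->
  (forall n, \int[mu]_t (X1 t ^+ n * w1 t) = \int[mu]_t (X2 t ^+ n * w2 t)) ->
  bounded_measurable beta ->
  \int[mu]_t (beta (X1 t) * w1 t) = \int[mu]_t (beta (X2 t) * w2 t).
Proof.
move=> bw1 bw2 e0 e1 bb.
have [_ [M1 wM1]] := bw1; have [_ [M2 wM2]] := bw2.
pose M := Order.max M1 M2.
have bM (w : T -> R) : bounded_measurable w -> bounded_measurable (fun t => w t + M).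
  by move=> bw; apply: bounded_measurableD => //; exact: bounded_measurable_cst.
have p1 t : 0 <= w1 t + M.
  have := wM1 t; rewrite ler_norml => /andP[h _]; have : M1 <= M by rewrite /M le_max lexx.
     lra.
have p2 t : 0 <= w2 t + M.
  have := wM2 t; rewrite ler_norml => /andP[h _]; have : M2 <= M by rewrite /M le_max lexx orbT.
     lra.
have bX (X : T -> R) : measurable_fun setT X -> (forall t, `|X t| <= 1) -> bounded_measurable X.
  by move=> mX X1'; split => //; exists 1.
have split_int (X w : T -> R) (g : R -> R) : measurable_fun setT X -> bounded_measurable w ->
   bounded_measurable (g \o X) ->
   \int[mu]_t (g (X t) * (w t + M)) =
   \int[mu]_t (g (X t) * w t) + M * \int[mu]_t g (X t).
  move=> mX bw bg.
  have i1 : mu.-integrable setT (EFin \o (g \o X)) by exact: integrable_bounded.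
  rewrite -RintegralZl// -RintegralD//.
  - by apply: eq_Rintegral => t _; rewrite mulrDr [M * _]mulrC.
  - by apply: integrable_bounded => //; exact: bounded_measurableM.
  - apply: integrable_bounded => //; apply: bounded_measurableM => //.
    exact: bounded_measurable_cst.
have e2 n : \int[mu]_t (X1 t ^+ n * (w1 t + M)) = \int[mu]_t (X2 t ^+ n * (w2 t + M)).
  rewrite (split_int X1 w1 (fun x => x ^+ n))//; last first.
    by apply: bounded_measurableX; exact: bX.
  rewrite (split_int X2 w2 (fun x => x ^+ n))//; last first.
    by apply: bounded_measurableX; exact: bX.
  by rewrite e1 e0.
have c1 := bounded_measurable_cst T (1 : R).
have e0' n : \int[mu]_t (X1 t ^+ n * 1) = \int[mu]_t (X2 t ^+ n * 1).
  by under eq_Rintegral do rewrite mulr1; rewrite e0; under [RHS]eq_Rintegral do rewrite mulr1.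
have q0 := eq_moments_integral_ge0 c1 c1 (fun=> ler01) (fun=> ler01) e0' bb.
have q1 := eq_moments_integral_ge0 (bM _ bw1) (bM _ bw2) p1 p2 e2 bb.
have q0' : \int[mu]_t beta (X1 t) = \int[mu]_t beta (X2 t).
  by move: q0; under eq_Rintegral do rewrite mulr1; move=> ->;
     under eq_Rintegral do rewrite mulr1.
move: q1; rewrite !split_int//; try exact: bounded_measurable_comp bb.
by rewrite q0' => /addIr.
Qed.

End moment_determinacy.

Section rotation_symmetry.
Variable R : realType.
Local Notation T2 := (measurableTypeR R * measurableTypeR R)%type.
Local Notation surf := (@surface R).
Implicit Types k l xi eta : 'rV[R]_3.

Lemma dotDl k l xi : dot (k + l) xi = dot k xi + dot l xi.
Proof. by rewrite !dotE !mxE; ring. Qed.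

Lemma dotZl t k xi : dot (t *: k) xi = t * dot k xi.
Proof. by rewrite !dotE !mxE; ring. Qed.

Lemma dotC k l : dot k l = dot l k.
Proof. by rewrite !dotE; ring. Qed.

Lemma dotDr k l xi : dot xi (k + l) = dot xi k + dot xi l.
Proof. by rewrite !dotE !mxE; ring. Qed.

Lemma dotZr t k xi : dot xi (t *: k) = t * dot xi k.
Proof. by rewrite !dotE !mxE; ring. Qed.

(** The recurrence determines the moments from [dot xi xi], starting from the
    total mass and from the vanishing first moment. *)
Lemma power_moment_radial xi eta n : dot xi xi = dot eta eta -> power_moment xi n = power_moment eta n.
Proof.
move=> e; have [n' le_n] := ubnP n.
elim: n' n le_n => // n' ih [|[|n]] le_n.
- by rewrite /power_moment; apply: eq_Rintegral => p _; rewrite !expr0.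
- apply: (@mulfI _ 2%:R); first by rewrite pnatr_eq0.
  by rewrite !power_moment_rec !mul0r.
- apply: (@mulfI _ n.+3%:R); first by rewrite pnatr_eq0.
  by rewrite !power_moment_rec/= e ih// -ltnS ltnW.
Qed.

Lemma poly_eq_horner (p q : {poly R}) : (forall t, p.[t] = q.[t]) -> p = q.
Proof.
move=> pq; apply/eqP; rewrite -subr_eq0; apply/negPn/negP => r0.
have := @max_poly_roots _ (p - q) [seq i%:R | i <- iota 0 (size (p - q))] r0.
rewrite size_map size_iota ltnn => H.
suff : false by [].
apply: H.
  by apply/allP => x _; rewrite /root hornerD hornerN pq subrr.
rewrite map_inj_uniq ?iota_uniq// => i j /eqP; rewrite eqr_nat => /eqP; exact.
Qed.

Lemma sphere_dotDZ k l t p : sphere_dot (k + t *: l) p = sphere_dot k p + t * sphere_dot l p.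
Proof. by rewrite -!dot_sphere dotDl dotZl. Qed.

(** Polarization: the polynomial [power_moment (k + t l)] in [t] has the mixed
    moments as coefficients, and [k + t l], [l + t k] have the same length. *)
Lemma mixed_moments_sym k l m n : dot k k = 1 -> dot l l = 1 ->
  \int[surf]_p (sphere_dot k p ^+ m * sphere_dot l p ^+ n) =
  \int[surf]_p (sphere_dot l p ^+ m * sphere_dot k p ^+ n).
Proof.
move=> k1 l1; pose N := (m + n)%N.
pose M k l i := \int[surf]_p (sphere_dot k p ^+ (N - i) * sphere_dot l p ^+ i).
pose P k l := \poly_(i < N.+1) ('C(N, i)%:R * M k l i).
have bM u v i : surf.-integrable setT (EFin \o (fun p => sphere_dot u p ^+ (N - i) * sphere_dot v p ^+ i)).
  apply: integrable_bounded; first exact: surface_lty.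
  by apply: bounded_measurableM; exact: bounded_measurable_sphere_dotX.
have PE u v t : (P u v).[t] = power_moment (u + t *: v) N.
  rewrite /P horner_poly /power_moment.
  transitivity (\int[surf]_p \sum_(i < N.+1) ('C(N, i)%:R * t ^+ i) *
      (sphere_dot u p ^+ (N - i) * sphere_dot v p ^+ i)).
    rewrite (@Rintegral_sum _ _ _ _ _ _ (fun (i : 'I_N.+1) p => ('C(N, i)%:R * t ^+ i) *
      (sphere_dot u p ^+ (N - i) * sphere_dot v p ^+ i))).
      by apply: eq_bigr => i _; rewrite RintegralZl// mulrAC.
    move=> i; apply: integrable_bounded; first exact: surface_lty.
    apply: bounded_measurableM; first exact: bounded_measurable_cst.
    by apply: bounded_measurableM; exact: bounded_measurable_sphere_dotX.
  apply: eq_Rintegral => p _; rewrite sphere_dotDZ exprDn; apply: eq_bigr => i _.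
  by rewrite exprMn_comm; [rewrite -mulr_natl; ring|exact: mulrC].
have PP : P k l = P l k.
  apply: poly_eq_horner => t; rewrite !PE; apply: power_moment_radial.
  by rewrite !(dotDl, dotZl, dotDr, dotZr) k1 l1 (dotC l k); ring.
have := congr1 (fun p : {poly R} => p`_n) PP.
rewrite !coef_poly ltnS leq_addl => /mulfI.
rewrite /M /N addnK; apply.
by rewrite pnatr_eq0 -lt0n bin_gt0 leq_addl.
Qed.

Lemma sphere_dot_le1 k p : dot k k = 1 -> `|sphere_dot k p| <= 1.
Proof.
move=> k1; have : sphere_dot k p ^+ 2 + sphere_dot_theta k p ^+ 2 + sphere_dot_phi k p ^+ 2 = 1 by rewrite -k1 sphere_dot_frame.
move=> h; rewrite -(@expr_le1 _ 2)// real_normK ?num_real//; have := sqr_ge0 (sphere_dot_theta k p); have := sqr_ge0 (sphere_dot_phi k p); lra.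
Qed.

(** For a rotation invariant measure this is the reflection that swaps [k] and
    [l].  Here it follows from the symmetry of the mixed moments, first in one
    variable and then in the other. *)
Theorem surface_exchange k l (f g : R -> R) : dot k k = 1 -> dot l l = 1 ->
  bounded_measurable f -> bounded_measurable g ->
  \int[surf]_p (f (sphere_dot k p) * g (sphere_dot l p)) = \int[surf]_p (f (sphere_dot l p) * g (sphere_dot k p)).
Proof.
move=> k1 l1 bf bg.
have mk u := proj1 (bounded_measurable_sphere_dot u).
have fin := @surface_lty R.
have kk n : \int[surf]_p (sphere_dot k p ^+ n) = \int[surf]_p (sphere_dot l p ^+ n).
  by apply: power_moment_radial; rewrite k1 l1.
have bX n u : bounded_measurable (fun p => sphere_dot u p ^+ n).
  exact: bounded_measurable_sphere_dotX.
have H n : \int[surf]_p (f (sphere_dot k p) * sphere_dot l p ^+ n) =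
           \int[surf]_p (f (sphere_dot l p) * sphere_dot k p ^+ n).
  apply: eq_moments_integral => //; try by move=> t; exact: sphere_dot_le1.
  by move=> m; exact: mixed_moments_sym.
transitivity (\int[surf]_p (g (sphere_dot l p) * f (sphere_dot k p))).
  by apply: eq_Rintegral => p _; rewrite mulrC.
transitivity (\int[surf]_p (g (sphere_dot k p) * f (sphere_dot l p))); last first.
  by apply: eq_Rintegral => p _; rewrite mulrC.
apply: eq_moments_integral => //; try by move=> t; exact: sphere_dot_le1.
- by apply: bounded_measurable_comp bf; exact: mk.
- by apply: bounded_measurable_comp bf; exact: mk.
- move=> n.
  transitivity (\int[surf]_p (f (sphere_dot k p) * sphere_dot l p ^+ n)).
    by apply: eq_Rintegral => p _; rewrite mulrC.
  by rewrite H; apply: eq_Rintegral => p _; rewrite mulrC.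
Qed.

Definition e3 : 'rV[R]_3 := \row_i (i == 2)%:R.

Lemma sphere_dot_e3 p : sphere_dot e3 p = cos p.1.
Proof. by rewrite /sphere_dot !mxE/=; ring. Qed.

Lemma dot_e3 : dot e3 e3 = 1.
Proof. by rewrite dotE !mxE/=; ring. Qed.

(** The distribution of [sphere_dot k] is the same for all unit vectors [k],
    by [surface_exchange] with a constant second function; the polar axis gives
    [cos p.1]. *)
Lemma zonal_ge0 k (F : R -> \bar R) : dot k k = 1 ->
  measurable_fun setT F -> (forall x, 0 <= F x)%E ->
  (\int[surf]_p F (sphere_dot k p) = \int[surf]_p F (cos p.1))%E.
Proof.
move=> k1 mF F0.
have mk := proj1 (bounded_measurable_sphere_dot k).
have mc := proj1 (bounded_measurable_cos1 R).
rewrite -[LHS](@ge0_integral_pushforward _ _ _ _ _ _ mk surf setT F)//.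
rewrite -[RHS](@ge0_integral_pushforward _ _ _ _ _ _ mc surf setT F)//.
apply: eq_measure_integral => A mA _.
have fin X : measurable_fun setT X -> bounded_measurable (\1_A \o X : T2 -> R).
  by move=> mX; apply: (bounded_measurable_comp mX); exact: bounded_measurable_indic.
have E (X : T2 -> R) : measurable_fun setT X ->
    surf (X @^-1` A) = (\int[surf]_p (\1_A (X p)))%:E.
  move=> mX; rewrite /Rintegral fineK; last first.
    apply: integrable_fin_num => //; apply: integrable_bounded; first exact: surface_lty.
    exact: fin.
  transitivity (\int[surf]_p ((\1_(X @^-1` A) p)%:E : \bar R))%E.
    by rewrite integral_indic ?setIT// -[X in measurable X]setTI; exact: mX.
  by apply: eq_integral => p _; rewrite !indicE.
transitivity (surf (sphere_dot k @^-1` A)) => //.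
transitivity (surf ((fun p => cos p.1) @^-1` A)) => //.
rewrite !E//; congr EFin.
have bA : bounded_measurable (\1_A : R -> R) by exact: bounded_measurable_indic.
transitivity (\int[surf]_p (\1_A (sphere_dot k p) * cst 1 (sphere_dot e3 p))).
  by apply: eq_Rintegral => p _; rewrite mulr1.
rewrite (surface_exchange k1 dot_e3 bA (bounded_measurable_cst _ 1)).
by apply: eq_Rintegral => p _; rewrite mulr1 sphere_dot_e3.
Qed.

Lemma surface_fubini_inner (F : R -> R) x :
  fubini_F (@lebesgue_measure R) (fun p : T2 => (F (cos p.1) * area p)%:E) x =
  ((F (cos x) * sin x * \1_(`[0, pi]%classic) x) * (2 * pi))%:E.
Proof.
rewrite /fubini_F.
pose c := F (cos x) * sin x * \1_(`[0, pi]%classic) x.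
transitivity (\int[@lebesgue_measure R]_(y in `[0%R, (2 * pi)%R]) cst c%:E y)%E.
  rewrite [RHS]integral_mkcond; apply: eq_integral => y _.
  rewrite patchE /area/= /c !indicE.
  have -> : ((x, y) \in @sphere_chart R) = (x \in `[0%R, pi]%classic) && (y \in `[0%R, (2 * pi)%R]%classic).
    apply/idP/andP => [/set_mem[/= h1 h2]|[/set_mem h1 /set_mem h2]].
      by split; exact/mem_set.
    exact/mem_set.
  by case: (x \in _); case: (y \in _); rewrite /= ?(mulr0, mulr1).
rewrite integral_cst//= lebesgue_measure_itv/= lte_fin mulr_gt0 ?pi_gt0//.
by rewrite sube0.
Qed.

Lemma surface_cos_ge0 (F : R -> R) : measurable_fun setT F -> (forall x, 0 <= F x) ->
  (\int[surf]_p (F (cos p.1))%:E =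
   (2 * pi)%:E * \int[@lebesgue_measure R]_(x in `[0%R, pi]) (F (cos x) * sin x)%:E)%E.
Proof.
move=> mF F0.
have mc := proj1 (bounded_measurable_cos1 R).
have [ma _] := bounded_measurable_area R.
rewrite integral_weighted; last exact: measurableT_comp.
rewrite /lebesgue2 fubini_tonelli1; last 2 first.
- by apply/measurable_EFinP; apply: measurable_funM => //; exact: measurableT_comp mF mc.
- by move=> p; rewrite lee_fin mulr_ge0// area_ge0.
under eq_integral do rewrite surface_fubini_inner.
rewrite muleC -ge0_integralZr//; last 3 first.
- apply/measurable_EFinP; apply: measurable_funTS; apply: measurable_funM.
    apply: measurableT_comp mF _; apply: continuous_measurable_fun; exact: continuous_cos.
  by apply: continuous_measurable_fun; exact: continuous_sin.
- by move=> x /=; rewrite in_itv/= => h; rewrite lee_fin mulr_ge0// sin_ge0_pi.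
- by rewrite lee_fin mulr_ge0// pi_ge0.
rewrite [RHS]integral_mkcond; apply: eq_integral => x _.
by rewrite patchE indicE; case: ifP; rewrite ?(mulr1, mulr0, mul0r).
Qed.

Lemma surface_cos (F : R -> R) : measurable_fun setT F ->
  surf.-integrable setT (fun p => (F (cos p.1))%:E) ->
  \int[surf]_p F (cos p.1) =
   (2 * pi) * \int[@lebesgue_measure R]_(x in `[0, pi]) (F (cos x) * sin x).
Proof.
move=> mF iF.
have pi2 : 0 < 2 * pi :> R by rewrite mulr_gt0// pi_gt0.
have main (P : R -> R) : measurable_fun setT P -> (forall x, 0 <= P x) ->
   (forall x, P x <= `|F x|) ->
   [/\ surf.-integrable setT (EFin \o (fun p : T2 => P (cos p.1))),
     (@lebesgue_measure R).-integrable `[0, pi] (EFin \o (fun x => P (cos x) * sin x)) &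
     \int[surf]_p P (cos p.1) =
     (2 * pi) * \int[@lebesgue_measure R]_(x in `[0, pi]) (P (cos x) * sin x)].
  move=> mP P0 PF.
  have iP : surf.-integrable setT (EFin \o (fun p : T2 => P (cos p.1))).
    apply: le_integrable iF => //.
      by apply/measurable_EFinP; apply: measurableT_comp mP _; case: (bounded_measurable_cos1 R).
    by move=> p _ /=; rewrite lee_fin ger0_norm.
  have Ps0 x : x \in `[0%R, pi]%classic -> 0 <= P (cos x) * sin x.
    by move=> /set_mem/=; rewrite in_itv/= => h; rewrite mulr_ge0// sin_ge0_pi.
  have fin := integrable_fin_num measurableT iP.
  have E := surface_cos_ge0 mP P0.
  have mPs : measurable_fun `[0, pi] (fun x => P (cos x) * sin x).
    apply: measurable_funTS; apply: measurable_funM.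
      apply: measurableT_comp mP _; apply: continuous_measurable_fun; exact: continuous_cos.
    by apply: continuous_measurable_fun; exact: continuous_sin.
  have I0 : (0 <= \int[@lebesgue_measure R]_(x in `[0%R, pi]) (P (cos x) * sin x)%:E)%E.
    by apply: integral_ge0 => x /mem_set h; rewrite lee_fin Ps0.
  have Ioo : (\int[@lebesgue_measure R]_(x in `[0%R, pi]) (P (cos x) * sin x)%:E < +oo)%E.
    rewrite ltey; apply/eqP => h; move: fin; rewrite /= E h gt0_muley ?lte_fin//.
  split => //.
    apply/integrableP; split; first exact/measurable_EFinP.
    move: Ioo; apply: le_lt_trans; rewrite le_eqVlt; apply/orP; left; apply/eqP.
    by apply: eq_integral => x xI /=; rewrite ger0_norm// Ps0.
  by rewrite /Rintegral E fineM// ge0_fin_numE.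
have [||x|i1 j1 e1] := main (fun x => Order.max (F x) 0).
- by apply: measurable_maxr.
- by move=> x; rewrite le_max lexx orbT.
- by rewrite ge_max ler_norm normr_ge0.
have [||x|i2 j2 e2] := main (fun x => Order.max (- F x) 0).
- by apply: measurable_maxr => //; exact: measurableT_comp.
- by move=> x; rewrite le_max lexx orbT.
- by rewrite ge_max normr_ge0 -normrN ler_norm.
have FE x : F x = Order.max (F x) 0 - Order.max (- F x) 0.
  by case: (ltgtP (F x) 0) => h; rewrite ?h ?oppr0 ?maxxx ?subrr//;
   [rewrite max_l ?sub0r ?opprK// oppr_ge0 ltW|rewrite max_r ?subr0// oppr_le0 ltW].
transitivity (\int[surf]_p (Order.max (F (cos p.1)) 0 - Order.max (- F (cos p.1)) 0)).
  by apply: eq_Rintegral => p _; exact: FE.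
rewrite RintegralB// e1 e2 -mulrBr -RintegralB//; congr (_ * _).
by apply: eq_Rintegral => x _; rewrite -mulrBl -FE.
Qed.

End rotation_symmetry.

(** * Tails of a law and its characteristic function near the origin *)

Section tails.
Variable R : realType.
Local Notation leb := (@lebesgue_measure R).
Implicit Types (v xi : 'rV[R]_3).

Lemma measurable_dotl xi :
  measurable_fun setT (fun v : borelR3 R => dot (v : 'rV[R]_3) xi).
Proof.
under eq_fun do rewrite dotE.
by repeat apply: measurable_funD; apply: measurable_funM => //; exact: measurable_coord.
Qed.

Lemma bounded_measurable_cos d (T : measurableType d) (X : T -> R) :
  measurable_fun setT X -> bounded_measurable (fun t => cos (X t)).
Proof.
move=> mX; split; last by exists 1 => p; rewrite ler_norml cos_geN1 cos_le1.
by apply: measurableT_comp mX; apply: continuous_measurable_fun; exact: continuous_cos.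
Qed.

Lemma bounded_measurable_sin d (T : measurableType d) (X : T -> R) :
  measurable_fun setT X -> bounded_measurable (fun t => sin (X t)).
Proof.
move=> mX; split; last by exists 1 => p; rewrite ler_norml sin_geN1 sin_le1.
by apply: measurableT_comp mX; apply: continuous_measurable_fun; exact: continuous_sin.
Qed.

Definition axis (i : 'I_3) : 'rV[R]_3 := delta_mx 0 i.

Lemma dot_axis v i u : dot v (u *: axis i) = u * v 0 i.
Proof.
rewrite /dot (bigD1 i)//= !mxE !eqxx mulr1 mulrC big1 ?addr0// => j ji.
by rewrite !mxE eqxx/= (negbTE ji) mulr0 mulr0.
Qed.

Lemma enorm_axis i u : 0 <= u -> enorm (u *: axis i) = u.
Proof.
move=> u0; rewrite /enorm dot_axis !mxE !eqxx mulr1.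
by rewrite -expr2 sqrtr_sqr ger0_norm.
Qed.

Lemma Rintegral_1Bcos (x delta : R) : 0 < delta -> x != 0 ->
  \int[leb]_(u in `[0, delta]) (1 - cos (u * x)) = delta - sin (delta * x) / x.
Proof.
move=> d0 x0.
have dF (u : R) : is_derive u (1 : R) (fun u => u - sin (u * x) / x) (1 - cos (u * x)).
  have dx : is_derive u (1 : R) (fun u => u * x) x.
    apply: is_derive_eq (is_derive_mulfun (is_derive_id u 1) (is_derive_cst_fun u x)) _.
    by rewrite mul1r mulr0 addr0.
  have ds : is_derive u (1 : R) (fun u => sin (u * x)) (cos (u * x) * x).
    apply: is_derive_eq (is_derive1_comp (f := sin) (g := fun u => u * x) _ _) _.
    by rewrite /GRing.scale/= mulrC.
  apply: is_derive_eq (is_derive_subfun (is_derive_id _ _) (is_derive_mulfun ds (is_derive_cst_fun u x^-1))) _.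
  by rewrite mulr0 addr0 mulfK.
rewrite (Rintegral_derive d0 dF).
  by rewrite mul0r sin0 mul0r !subr0.
move=> u; apply: cvgB; first exact: cvg_cst.
apply: continuous_comp; last exact: continuous_cos.
by apply: cvgM; [exact: cvg_id|exact: cvg_cst].
Qed.

Variables (P : probability (borelR3 R) R) (M alpha : R).
Hypotheses (M0 : 0 <= M) (alpha_gt0 : 0 < alpha).
Hypothesis char_near0 : forall xi,
  1 - \int[P]_v cos (dot (v : 'rV[R]_3) xi) <= M * enorm xi `^ alpha.

(** The average of [1 - cos (u v_i)] over [u] in [0, delta] is at least 1/2 as
    soon as [delta |v_i| >= 2]; its expectation is controlled by the
    characteristic function on the i-th axis. *)
Lemma coord_tail_bound i (delta : R) : 0 < delta ->
  (P [set v : borelR3 R | (2 / delta <= `|(v : 'rV[R]_3) 0 i|)%R] <=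
   (2 * M * delta `^ alpha)%:E)%E.
Proof.
move=> d0.
pose f (z : borelR3 R * measurableTypeR R) : R :=
  (1 - cos (z.2 * (z.1 : 'rV[R]_3) 0 i)) * \1_(`[0, delta]%classic) z.2.
have f0 z : 0 <= f z.
  by rewrite mulr_ge0// subr_ge0 cos_le1.
have mf : measurable_fun setT (EFin \o f).
  apply/measurable_EFinP; apply: measurable_funM; last first.
    by apply: measurableT_comp => //; apply: measurable_indic; exact: measurable_itv.
  apply: measurable_funB => //.
  apply: (@measurableT_comp _ _ _ _ _ _ cos).
    by apply: continuous_measurable_fun; exact: continuous_cos.
  apply: measurable_funM => //.
  by apply: (measurableT_comp (measurable_coord i)).
have bcos (v : borelR3 R) :
    bounded_measurable (fun u : measurableTypeR R => 1 - cos (u * (v : 'rV[R]_3) 0 i)).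
  apply: bounded_measurableB; first exact: bounded_measurable_cst.
  by apply: bounded_measurable_cos; exact: measurable_funM.
have inner1 v : (\int[leb]_u (EFin \o f) (v, u) =
    (\int[leb]_(u in `[0, delta]) (1 - cos (u * (v : 'rV[R]_3) 0 i)))%:E)%E.
  rewrite /Rintegral fineK; last first.
    apply: integrable_fin_num; first exact: measurable_itv.
    exact: (integrable_itv_bounded _ _ (bcos v)).
  rewrite [RHS]integral_mkcond; apply: eq_integral => u _.
  by rewrite patchE /f/= indicE; case: ifP; rewrite ?(mulr1, mulr0).
have inner2 u : (\int[P]_v (EFin \o f) (v, u) <=
    (\1_(`[0%R, delta]%classic) u * (M * delta `^ alpha))%:E)%E.
  have [u0d|u0d] := boolP (u \in `[0%R, delta]%classic); last first.
    rewrite indicE (negbTE u0d) mul0r integral0_eq// => v _ /=.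
    by rewrite /f/= indicE (negbTE u0d) mulr0.
  move: (set_mem u0d); rewrite /= in_itv/= => /andP[u0 ud].
  have icos : P.-integrable setT (EFin \o (fun v : borelR3 R => cos (u * (v : 'rV[R]_3) 0 i))).
    apply: integrable_bounded; first by rewrite /= probability_setT ltry.
    by apply: bounded_measurable_cos; apply: measurable_funM => //; exact: measurable_coord.
  have -> : (\int[P]_v (EFin \o f) (v, u) =
      (1 - \int[P]_v cos (dot (v : 'rV[R]_3) (u *: axis i)))%:E)%E.
    transitivity (\int[P]_v ((cst 1 v)%:E - (cos (u * (v : 'rV[R]_3) 0 i))%:E))%E.
      by apply: eq_integral => v _; rewrite /f/= indicE u0d mulr1 -EFinB.
    rewrite integralB_EFin//; last exact: finite_measure_integrable_cst.
    have -> : (\int[P]_v (cst 1 v)%:E = 1)%E.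
      by have := integral_cst P measurableT 1%E; rewrite /= probability_setT mule1.
    rewrite EFinB; congr (_ - _)%E.
    rewrite /Rintegral; under [in RHS]eq_integral do rewrite dot_axis.
    by rewrite fineK//; exact: integrable_fin_num.
  rewrite lee_fin indicE u0d mul1r (le_trans (char_near0 _))// enorm_axis//.
  by rewrite ler_wpM2l// ge0_ler_powR// ?nnegrE ?(le_trans u0 ud) ?ltW.
pose A := [set v : borelR3 R | 2 / delta <= `|(v : 'rV[R]_3) 0 i|].
have mA : measurable A.
  rewrite [A](_ : _ = (fun v : borelR3 R => `|(v : 'rV[R]_3) 0 i|) @^-1` `[2 / delta, +oo[%classic).
    rewrite -[X in measurable X]setTI.
    by apply: (measurableT_comp (@normr_measurable _ _) (measurable_coord i)).
  by apply/seteqP; split => v /=; rewrite in_itv/= andbT.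
have lower v : delta / 2 * \1_A v <=
    \int[leb]_(u in `[0, delta]) (1 - cos (u * (v : 'rV[R]_3) 0 i)).
  rewrite indicE; have [/set_mem vA|] := boolP (v \in A); last first.
    by rewrite mulr0 => _; apply: Rintegral_ge0 => u _; rewrite subr_ge0 cos_le1.
  set x := (v : 'rV[R]_3) 0 i in vA *.
  have x0 : 0 < `|x| by apply: lt_le_trans vA; rewrite divr_gt0.
  rewrite Rintegral_1Bcos//; last by rewrite -normr_gt0.
  have : sin (delta * x) / x <= delta / 2.
    rewrite (le_trans (ler_norm _))// normrM normfV ler_pdivrMr//.
    apply: (@le_trans _ _ 1); first by rewrite ler_norml sin_geN1 sin_le1.
    by move: vA; rewrite /A/= ler_pdivrMr//; lra.
  by rewrite mulr1; lra.
have Ef0 z : (0 <= (EFin \o f) z)%E by rewrite lee_fin.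
have F := @fubini_tonelli _ _ _ _ R P leb (EFin \o f) mf Ef0.
have h1 : ((delta / 2)%:E * P A <= \int[P]_v \int[leb]_u (EFin \o f) (v, u))%E.
  rewrite -(setIT A) -integral_indic// -ge0_integralZl//; last 2 first.
  - by apply/measurable_EFinP; exact: measurable_indic.
  - by rewrite lee_fin divr_ge0// ltW.
  apply: ge0_le_integral => //.
  - by move=> v _; rewrite -EFinM lee_fin mulr_ge0// divr_ge0// ltW.
  - by apply: measurable_funeM; apply/measurable_EFinP; exact: measurable_indic.
  - exact: measurable_fun_fubini_tonelli_F.
  - by move=> v _; rewrite inner1 -EFinM lee_fin.
have h2 : (\int[leb]_u \int[P]_v (EFin \o f) (v, u) <= (M * delta `^ alpha * delta)%:E)%E.
  apply: (@le_trans _ _ (\int[leb]_u (\1_(`[0%R, delta]%classic) u * (M * delta `^ alpha))%:E)%E).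
    apply: ge0_le_integral => //.
    - by move=> u _; apply: integral_ge0 => v _; rewrite lee_fin.
    - exact: measurable_fun_fubini_tonelli_G.
    - apply/measurable_EFinP; apply: measurable_funM; last exact: measurable_cst.
      by apply: measurable_indic; exact: measurable_itv.
  under eq_integral do rewrite EFinM.
  rewrite ge0_integralZr//.
  - rewrite integral_indic//= setIT lebesgue_measure_itv/= lte_fin d0 sube0.
    by rewrite -EFinM mulrC.
  - by apply/measurable_EFinP; apply: measurable_indic; exact: measurable_itv.
  - by rewrite lee_fin mulr_ge0// powR_ge0.
rewrite F in h1; have h := le_trans h1 h2.
rewrite -(@lee_pmul2l _ (delta / 2)%:E) ?lte_fin ?divr_gt0//.
rewrite (le_trans h)// -EFinM lee_fin le_eqVlt; apply/orP; left; apply/eqP.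
by field.
Qed.

Lemma measurable_normR3 : measurable_fun setT (fun v : borelR3 R => `|v : 'rV[R]_3|).
Proof. by apply: measurable_continuous_borelR3; exact: norm_continuous. Qed.

Lemma norm_tail_bound (r : R) : 0 < r ->
  (P [set v : borelR3 R | (r <= `|v : 'rV[R]_3|)%R] <=
   (6 * M * (2 / r) `^ alpha)%:E)%E.
Proof.
move=> r0; have d0 : 0 < 2 / r by rewrite divr_gt0.
pose A i := [set v : borelR3 R | 2 / (2 / r) <= `|(v : 'rV[R]_3) 0 i|].
have mA i : measurable (A i).
  rewrite [A i](_ : _ = (fun v : borelR3 R => `|(v : 'rV[R]_3) 0 i|) @^-1` `[2 / (2 / r), +oo[%classic).
    rewrite -[X in measurable X]setTI.
    by apply: (measurableT_comp (@normr_measurable _ _) (measurable_coord i)).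
  by apply/seteqP; split => v /=; rewrite in_itv/= andbT.
have rE : 2 / (2 / r) = r by field; rewrite gt_eqF.
apply: (@le_trans _ _ (P (A 0 `|` A 1 `|` A 2))).
  apply: le_measure; rewrite ?inE.
  - rewrite [X in measurable X](_ : _ = (fun v : borelR3 R => `|v : 'rV[R]_3|) @^-1` `[r, +oo[%classic).
      by rewrite -[X in measurable X]setTI; apply: measurable_normR3.
    by apply/seteqP; split => v /=; rewrite in_itv/= andbT.
  - by repeat apply: measurableU.
  move=> v /=; rewrite [X in _ <= X]mx_normrE => rv.
  have [j rj] : exists j, r <= `|(v : 'rV[R]_3) 0 j|.
    apply/not_existsP => H; have : \big[Order.max/0]_ij `|(v : 'rV[R]_3) ij.1 ij.2| < r.
      apply/bigmax_ltP; split => // -[i j] _ /=; rewrite (ord1 i) ltNge.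
      by apply/negP; exact: H.
    by rewrite ltNge rv.
  rewrite /A/= rE; case: j rj => -[|[|[|//]]] /= h rj.
  - by left; left; rewrite (_ : 0 = Ordinal h)//; exact/val_inj.
  - by left; right; rewrite (_ : 1 = Ordinal h)//; exact/val_inj.
  - by right; rewrite (_ : 2 = Ordinal h)//; exact/val_inj.
rewrite (le_trans (measureU2 _ _ _))//; first exact: measurableU.
rewrite (_ : 6 * M * _ = (2 * M * (2 / r) `^ alpha + 2 * M * (2 / r) `^ alpha) + 2 * M * (2 / r) `^ alpha); last by ring.
rewrite EFinD leeD//; last exact: coord_tail_bound.
rewrite (le_trans (measureU2 _ _ _))// EFinD leeD//; exact: coord_tail_bound.
Qed.

End tails.

(** * Limits of expectations along an ultrafilter *)

Section generalized_limit.
Context d (Y : measurableType d) (R : realType).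
Variables (P : nat -> probability Y R) (U : set_system nat).
Hypotheses (UU : UltraFilter U) (ooU : \oo%classic `<=` U).

(** A positive linear functional of mass 1 on bounded functions; it need not be
    countably additive. *)
Definition mean_lim (g : Y -> R) : R := lim (\int[P n]_y g y @[n --> U]).

Lemma ultra_bounded_cvg (u : nat -> R) (M : R) :
  (forall n, `|u n| <= M) -> cvg (u n @[n --> U]).
Proof.
move=> uM.
have cI : compact (`[(- M), M]%classic : set R) by exact: segment_compact.
have PF : ProperFilter (u @ U) by exact: fmap_proper_filter.
have uI : U (u @^-1` `[(- M), M]%classic).
  by apply: filterE => n; rewrite /= in_itv/= -ler_norml.
have [p [_ clp]] := cI _ PF uI.
apply/cvg_ex; exists p => V nV.
have [//|nVU] := in_ultra_setVsetC (u @^-1` V) UU.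
by have [x [/= nVx Vx]] := clp (~` V) V nVU nV.
Qed.

Let int (n : nat) (g : Y -> R) : bounded_measurable g -> (P n).-integrable setT (EFin \o g).
Proof. by move=> bg; apply: integrable_bounded => //; rewrite /= probability_setT ltry. Qed.

Lemma le_mean (n : nat) (g : Y -> R) (M : R) : bounded_measurable g ->
  (forall y, `|g y| <= M) -> `|\int[P n]_y g y| <= M.
Proof.
move=> bg gM; rewrite (le_trans (le_normr_Rintegral _ _))//; first exact: int.
rewrite (le_trans (le_Rintegral (f2 := cst M) measurableT _ _ _))//.
- by apply: integrable_norm; exact: int.
- exact: finite_measure_integrable_cst.
- by rewrite Rintegral_cst//= probability_setT mulr1.
Qed.

Lemma cvg_mean_lim g : bounded_measurable g ->
  \int[P n]_y g y @[n --> U] --> mean_lim g.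
Proof.
move=> bg; have [_ [M gM]] := bg.
by apply: (@ultra_bounded_cvg _ M) => n; exact: le_mean.
Qed.

Lemma mean_limP g l : bounded_measurable g ->
  \int[P n]_y g y @[n --> U] --> l -> mean_lim g = l.
Proof. by move=> bg cl; exact: (cvg_unique _ (cvg_mean_lim bg) cl). Qed.

(** An ultrafilter that contains the neighborhoods of infinity computes ordinary
    limits. *)
Lemma mean_lim_oo g l : bounded_measurable g ->
  \int[P n]_y g y @[n --> \oo] --> l -> mean_lim g = l.
Proof.
move=> bg cl; apply: mean_limP => //.
by move=> V nV; apply: ooU; exact: cl.
Qed.

Lemma mean_limD f g : bounded_measurable f -> bounded_measurable g ->
  mean_lim (fun y => f y + g y) = mean_lim f + mean_lim g.
Proof.
move=> bf bg; apply: mean_limP; first exact: bounded_measurableD.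
have -> : (fun n => \int[P n]_y (f y + g y)) =
    (fun n => \int[P n]_y f y + \int[P n]_y g y).
  by apply/funext => n; rewrite RintegralD//; exact: int.
by apply: cvgD; exact: cvg_mean_lim.
Qed.

Lemma mean_limZ c g : bounded_measurable g ->
  mean_lim (fun y => c * g y) = c * mean_lim g.
Proof.
move=> bg; apply: mean_limP.
  by apply: bounded_measurableM => //; exact: bounded_measurable_cst.
have -> : (fun n => \int[P n]_y (c * g y)) = (fun n => c * \int[P n]_y g y).
  by apply/funext => n; rewrite RintegralZl//; exact: int.
by apply: cvgM; [exact: cvg_cst|exact: cvg_mean_lim].
Qed.

Lemma mean_lim_cst c : mean_lim (fun=> c) = c.
Proof.
apply: mean_limP; first exact: bounded_measurable_cst.
have -> : (fun n => \int[P n]_y c) = (fun=> c); last exact: cvg_cst.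
by apply/funext => n; rewrite Rintegral_cst//= probability_setT mulr1.
Qed.

Lemma le_mean_lim f g : bounded_measurable f -> bounded_measurable g ->
  (forall y, f y <= g y) -> mean_lim f <= mean_lim g.
Proof.
move=> bf bg fg; apply: ler_lim; [exact: cvg_mean_lim..|].
by apply: nearW => n; apply: le_Rintegral => //; exact: int.
Qed.

Lemma mean_lim_ge0 f : bounded_measurable f -> (forall y, 0 <= f y) -> 0 <= mean_lim f.
Proof.
move=> bf f0; rewrite -(mean_lim_cst 0); apply: le_mean_lim => //.
exact: bounded_measurable_cst.
Qed.

Lemma mean_lim_dist f g h : bounded_measurable f -> bounded_measurable g ->
  bounded_measurable h ->
  (forall y, `|f y - g y| <= h y) -> `|mean_lim f - mean_lim g| <= mean_lim h.
Proof.
move=> bf bg bh fgh.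
have bN k : bounded_measurable k -> bounded_measurable (fun y => - 1 * k y).
  by move=> bk; apply: bounded_measurableM => //; exact: bounded_measurable_cst.
have -> : mean_lim f - mean_lim g = mean_lim (fun y => f y + - 1 * g y).
  by rewrite mean_limD ?mean_limZ ?mulN1r//; exact: bN.
have bfg : bounded_measurable (fun y => f y + - 1 * g y).
  by apply: bounded_measurableD => //; exact: bN.
rewrite ler_norml; apply/andP; split.
  have -> : - mean_lim h = mean_lim (fun y => - 1 * h y) by rewrite mean_limZ// mulN1r.
  apply: le_mean_lim => //; first exact: bN.
  by move=> y; have := fgh y; rewrite ler_norml !mulN1r => /andP[].
apply: le_mean_lim => // y.
by have := fgh y; rewrite ler_norml mulN1r => /andP[].
Qed.

End generalized_limit.

(** * A law realizing a tight ultrafilter limit *)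

Lemma bounded_measurable_if d (T : measurableType d) (R : realType)
    (A : set T) (f g : T -> R) : measurable A ->
  bounded_measurable f -> bounded_measurable g ->
  bounded_measurable (fun x => if x \in A then f x else g x).
Proof.
move=> mA bf bg.
have -> : (fun x => if x \in A then f x else g x) =
    (fun x => \1_A x * f x + \1_(~` A) x * g x).
  apply/funext => x; rewrite !indicE in_setC.
  by case: (x \in A); rewrite /= ?mul1r ?mul0r ?addr0 ?add0r.
by apply: bounded_measurableD; apply: bounded_measurableM => //;
  apply: bounded_measurable_indic => //; exact: measurableC.
Qed.

Lemma cvg_geometric_increments (R : realType) (u : nat -> R) (C : R) :
  (forall n, `|u n.+1 - u n| <= C * 2^-1 ^+ n) -> cvg (u n @[n --> \oo]).
Proof.
move=> uC; pose d n := u n.+1 - u n.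
have cd : cvg (series d @ \oo).
  apply: normed_cvg; apply: (@series_le_cvg _ _ (geometric C 2^-1)) => //.
  - by move=> n; exact: normr_ge0.
  - by move=> n; rewrite (le_trans _ (uC n)).
  - by apply: is_cvg_geometric_series; rewrite ger0_norm// invf_lt1// ltr1n.
have -> : u = (fun n => u 0%N + series d n).
  by apply/funext => n; rewrite /series/= telescope_sumr// addrC subrK.
by apply: is_cvgD => //; exact: is_cvg_cst.
Qed.

Lemma measurable_fun_nat_cases d (T : measurableType d) (R : realType)
    (k : T -> nat) (F : nat -> T -> R) :
  (forall m, measurable (k @^-1` [set m])) ->
  (forall m, measurable_fun setT (F m)) ->
  measurable_fun setT (fun x => F (k x) x).
Proof.
move=> mk mF _ B mB; rewrite setTI.
have -> : (fun x => F (k x) x) @^-1` B =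
    \bigcup_m (k @^-1` [set m] `&` F m @^-1` B).
  apply/seteqP; split => x /=; first by move=> h; exists (k x).
  by move=> [m _ [/= -> ]].
apply: bigcupT_measurable => m; apply: measurableI => //.
by rewrite -[X in measurable X]setTI; exact: mF.
Qed.

Lemma measurable_truncn (R : realType) m :
  measurable ((@Num.truncn R : measurableTypeR R -> nat) @^-1` [set m]).
Proof.
case: m => [|m].
  rewrite [X in measurable X](_ : _ = `]-oo, 1[%classic); first exact: measurable_itv.
  by apply/seteqP; split => x /=; rewrite in_itv/= -(truncn_le_nat x 0) leqn0 => /eqP.
rewrite [X in measurable X](_ : _ = `[m.+1%:R, m.+2%:R[%classic); first exact: measurable_itv.
apply/seteqP; split => x /=; rewrite in_itv/=; last exact: truncn_def.
move=> xm; rewrite -{1 2}xm; apply: truncn_itv.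
by rewrite leNgt; apply/negP => x0; have := ltn0Sn m; rewrite -xm truncn_gt0 leNgt (lt_trans x0).
Qed.

Section bisection.
Variable R : realType.
Local Notation leb := (@lebesgue_measure R).
Local Notation R3 := (borelR3 R).
Variables (P : nat -> probability R3 R) (U : set_system nat).
Hypotheses (UU : UltraFilter U) (ooU : \oo%classic `<=` U).
Local Notation Lam := (mean_lim P U).

Section one_shell.
Variable rho : R.
Hypothesis rho_gt0 : 0 < rho.

(** The cube of half-width [rho] is cut in halves, cyclically in the three
    directions; after the cut of index [q] a cell is known by its center. *)
Definition bisect_axis (q : nat) : 'I_3 := inord (q %% 3).

Definition bisect_center (q : nat) (b : bool) (c : 'rV[R]_3) : 'rV[R]_3 :=
  c + ((-1) ^+ (~~ b) * (rho * 2^-1 ^+ (q %/ 3).+1)) *: axis R (bisect_axis q).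

Definition upper_half (q : nat) (c : 'rV[R]_3) : set R3 :=
  [set v : R3 | c 0 (bisect_axis q) <= (v : 'rV[R]_3) 0 (bisect_axis q)].

Lemma measurable_upper_half q c : measurable (upper_half q c).
Proof.
rewrite [X in measurable X](_ : _ =
    (fun v : R3 => (v : 'rV[R]_3) 0 (bisect_axis q)) @^-1` `[c 0 (bisect_axis q), +oo[%classic).
  by rewrite -[X in measurable X]setTI; apply: measurable_coord.
by apply/seteqP; split => v /=; rewrite in_itv/= andbT.
Qed.

Fixpoint cell_center j q c (v : R3) : 'rV[R]_3 :=
  if j is j'.+1 then
    if v \in upper_half q c then cell_center j' q.+1 (bisect_center q true c) v
    else cell_center j' q.+1 (bisect_center q false c) v
  else c.

(** The interval [l, l + Lam 1_A[ is cut in the proportion of the masses of the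
    two halves of the cell [A], and [x] selects a half.  Each level involves
    finite additivity of [Lam] alone, which an ultrafilter limit has. *)
Fixpoint sampled_center j q (A : set R3) (l : R) c (x : R) : 'rV[R]_3 :=
  if j is j'.+1 then
    let A0 := A `&` ~` upper_half q c in let A1 := A `&` upper_half q c in
    if x \in `]-oo, (l + Lam \1_A0)[%classic
    then sampled_center j' q.+1 A0 l (bisect_center q false c) x
    else sampled_center j' q.+1 A1 (l + Lam \1_A0) (bisect_center q true c) x
  else c.

Lemma bounded_measurable_cell_center (G : 'rV[R]_3 -> R) j q c :
  bounded_measurable (fun v => G (cell_center j q c v)).
Proof.
elim: j q c => [|j ih] q c /=; first exact: bounded_measurable_cst.
have -> : (fun v => G (if v \in upper_half q c
     then cell_center j q.+1 (bisect_center q true c) v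
     else cell_center j q.+1 (bisect_center q false c) v)) =
  (fun v => if v \in upper_half q c
     then G (cell_center j q.+1 (bisect_center q true c) v)
     else G (cell_center j q.+1 (bisect_center q false c) v)).
  by apply/funext => v; case: ifP.
by apply: bounded_measurable_if => //; exact: measurable_upper_half.
Qed.

Lemma bounded_measurable_sampled_center (G : 'rV[R]_3 -> R) j q A l c :
  bounded_measurable (fun x : R => G (sampled_center j q A l c x)).
Proof.
elim: j q A l c => [|j ih] q A l c /=; first exact: bounded_measurable_cst.
set I := `]-oo, _[%classic.
set f0 := sampled_center _ _ _ _ _; set f1 := sampled_center _ _ _ _ _.
have -> : (fun x => G (if x \in I then f0 x else f1 x)) =
  (fun x => if x \in I then G (f0 x) else G (f1 x)).
  by apply/funext => v; case: ifP.
apply: bounded_measurable_if; [exact: measurable_itv|exact: ih|exact: ih].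
Qed.

Lemma Rintegral_itv_split (f : R -> R) (a b c : R) : a <= b -> b <= c ->
  bounded_measurable f ->
  \int[leb]_(x in `[a, c[) f x =
  \int[leb]_(x in `[a, b[) f x + \int[leb]_(x in `[b, c[) f x.
Proof.
move=> ab bc bf.
have -> : `[a, c[%classic = `[a, b[%classic `|` `[b, c[%classic.
  by rewrite -itv_bndbnd_setU// bnd_simp.
rewrite Rintegral_setU//=.
- rewrite -itv_bndbnd_setU ?bnd_simp//.
  apply: integrableS (integrable_itv_bounded a c bf) => //.
  by apply: subset_itvl; rewrite bnd_simp.
- apply/disj_set2P/seteqP; split => // x /= []; rewrite !in_itv/= => /andP[_ xb] /andP[bx _].
  by have := lt_le_trans xb bx; rewrite ltxx.
Qed.

(** By construction, the center selected by a uniform [x] is distributed as the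
    center of the cell that contains [v]. *)
Lemma sampled_center_law j q A l c (G : 'rV[R]_3 -> R) : measurable A ->
  \int[leb]_(x in `[l, (l + Lam \1_A)[) G (sampled_center j q A l c x) =
  Lam (fun v => \1_A v * G (cell_center j q c v)).
Proof.
elim: j q A l c => [|j ih] q A l c mA.
  rewrite /= Rintegral_cst//= lebesgue_measure_itv/= lte_fin.
  have w0 : 0 <= Lam (\1_A : R3 -> R).
    by apply: mean_lim_ge0 => //; exact: bounded_measurable_indic.
  have -> : (fun v => \1_A v * G c) = (fun v => G c * \1_A v).
    by apply/funext => v; rewrite mulrC.
  rewrite mean_limZ//; last exact: bounded_measurable_indic.
  congr (_ * _); case: ifPn => [_|]; first by rewrite -EFinB/= addrC addKr.
  by rewrite -leNgt gerDl/= => w1; apply/eqP; rewrite eq_le w0.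
set A0 := A `&` ~` upper_half q c; set A1 := A `&` upper_half q c.
have mU := measurable_upper_half q c.
have mA0 : measurable A0 by apply: measurableI => //; exact: measurableC.
have mA1 : measurable A1 by exact: measurableI.
have b0 : bounded_measurable (\1_A0 : R3 -> R) by exact: bounded_measurable_indic.
have b1 : bounded_measurable (\1_A1 : R3 -> R) by exact: bounded_measurable_indic.
have w0 : 0 <= Lam (\1_A0 : R3 -> R) by exact: mean_lim_ge0.
have w1 : 0 <= Lam (\1_A1 : R3 -> R) by exact: mean_lim_ge0.
have AE v : \1_A v = \1_A0 v + \1_A1 v :> R.
  by rewrite !indicE /A0 /A1 !in_setI in_setC; case: (v \in A); case: (v \in _);
     rewrite /= ?addr0 ?add0r.
have -> : Lam \1_A = Lam \1_A0 + Lam \1_A1.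
  by rewrite -mean_limD//; congr (Lam _); apply/funext => v; exact: AE.
rewrite addrA (@Rintegral_itv_split _ _ (l + Lam \1_A0)) ?lerDl//; last first.
  exact: bounded_measurable_sampled_center.
have -> : \int[leb]_(x in `[l, (l + Lam \1_A0)[) G (sampled_center j.+1 q A l c x) =
   Lam (fun v => \1_A0 v * G (cell_center j q.+1 (bisect_center q false c) v)).
  rewrite -(ih _ _ l)//; apply: eq_Rintegral => x /set_mem/=; rewrite in_itv/= => /andP[_ xl].
  by rewrite mem_set//= in_itv.
have -> : \int[leb]_(x in `[(l + Lam \1_A0), (l + Lam \1_A0 + Lam \1_A1)[)
     G (sampled_center j.+1 q A l c x) =
   Lam (fun v => \1_A1 v * G (cell_center j q.+1 (bisect_center q true c) v)).
  rewrite -(ih _ _ (l + Lam \1_A0))//; apply: eq_Rintegral => x /set_mem/=; rewrite in_itv/= => /andP[xl _].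
  by rewrite memNset//= in_itv/=; apply/negP; rewrite -leNgt.
rewrite -mean_limD//; last 2 first.
- by apply: bounded_measurableM => //; exact: bounded_measurable_cell_center.
- by apply: bounded_measurableM => //; exact: bounded_measurable_cell_center.
congr (Lam _); apply/funext => v /=; rewrite !indicE /A0 /A1 !in_setI in_setC.
by case: (v \in A); case: (v \in _); rewrite /= ?mul0r ?mul1r ?addr0 ?add0r.
Qed.

Lemma sampled_center_last j q A l c x : exists b,
  sampled_center j.+1 q A l c x = bisect_center (q + j) b (sampled_center j q A l c x).
Proof.
elim: j q A l c => [|j ih] q A l c.
  by rewrite addn0 /=; case: ifP => _; [exists false|exists true].
rewrite [sampled_center j.+1 _ _ _ _ _]/= [sampled_center j.+2 _ _ _ _ _]/=.
by case: ifP => _; rewrite -[in X in exists b, _ = X b]addSnnS; exact: ih.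
Qed.

Lemma bisect_center_dist q b c k :
  `|bisect_center q b c 0 k - c 0 k| <= rho * 2^-1 ^+ (q %/ 3).+1.
Proof.
have h0 : 0 <= rho * 2^-1 ^+ (q %/ 3).+1 by rewrite mulr_ge0 ?ltW// exprn_ge0.
rewrite !mxE eqxx/= addrAC subrr add0r; case: (_ == _); rewrite /= ?mulr0 ?normr0//.
by rewrite mulr1 normrM normr_sign mul1r ger0_norm.
Qed.

(** The number of cuts in direction [k] among the first [q] ones. *)
Definition halvings (q : nat) (k : 'I_3) : nat := q %/ 3 + (k < q %% 3)%N.

Lemma bisect_center_box q (c : 'rV[R]_3) (v : R3) :
  (forall k, `|(v : 'rV[R]_3) 0 k - c 0 k| <= rho * 2^-1 ^+ halvings q k) ->
  forall k, `|(v : 'rV[R]_3) 0 k - (bisect_center q (v \in upper_half q c) c) 0 k| <=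
    rho * 2^-1 ^+ halvings q.+1 k.
Proof.
move=> box k; have := box k; rewrite /bisect_center !mxE eqxx/=.
have ib : val (bisect_axis q) = (q %% 3)%N by rewrite /= inordK// ltn_mod.
have [kE|kE] := eqVneq k (bisect_axis q).
  have -> : halvings q k = (q %/ 3)%N.
    by rewrite /halvings kE ib ltnn addn0.
  have -> : halvings q.+1 k = (q %/ 3).+1.
    by rewrite /halvings kE ib; lia.
  rewrite mulr1 exprS; set h := rho * (2^-1 * _).
  have hE : rho * 2^-1 ^+ (q %/ 3) = 2 * h by rewrite /h; field.
  rewrite hE {}kE.
  have [/set_mem|/negP] := boolP (v \in _).
    by rewrite /upper_half/= expr0 mul1r !ler_norml => ? /andP[? ?]; lra.
  rewrite inE /upper_half/= => /negP; rewrite -ltNge expr1 mulN1r !ler_norml => ? /andP[? ?].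
  lra.
have -> : halvings q.+1 k = halvings q k.
  move: kE; rewrite -val_eqE/= ib /halvings => kE.
  have := ltn_ord k; move: kE => /eqP; lia.
by rewrite mulr0 addr0.
Qed.

Lemma cell_center_box j q (c : 'rV[R]_3) (v : R3) :
  (forall k, `|(v : 'rV[R]_3) 0 k - c 0 k| <= rho * 2^-1 ^+ halvings q k) ->
  forall k, `|(v : 'rV[R]_3) 0 k - (cell_center j q c v) 0 k| <=
    rho * 2^-1 ^+ halvings (q + j) k.
Proof.
elim: j q c => [|j ih] q c box; first by rewrite addn0.
move=> k; have := bisect_center_box box; rewrite -addSnnS /=.
by case: ifP => _ box'; exact: ih.
Qed.

Variables (A : set R3) (l : R).
Hypotheses (mA : measurable A).
Hypothesis A_box : forall v k, A v -> `|(v : 'rV[R]_3) 0 k| <= rho.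

Let Z a x := sampled_center (3 * a) 0 A l 0 x.

Let Z_step a x k : `|Z a.+1 x 0 k - Z a x 0 k| <= (2 * rho) * 2^-1 ^+ a.
Proof.
rewrite /Z mulnS addnC !addnS addn0.
have [b1 ->] := sampled_center_last (3 * a).+2 0 A l 0 x.
have [b2 ->] := sampled_center_last (3 * a).+1 0 A l 0 x.
have [b3 ->] := sampled_center_last (3 * a) 0 A l 0 x.
set z := sampled_center _ _ _ _ _ _.
have h2 := bisect_center_dist (0 + (3 * a)) b3 z k.
set z2 := bisect_center _ b3 z in h2 *.
have h1 := bisect_center_dist (0 + (3 * a).+1) b2 z2 k.
set z1 := bisect_center _ b2 z2 in h1 *.
have h0 := bisect_center_dist (0 + (3 * a).+2) b1 z1 k.
set z0 := bisect_center _ b1 z1 in h0 *.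
have e0 : ((0 + (3 * a).+2) %/ 3 = a)%N by lia.
have e1 : ((0 + (3 * a).+1) %/ 3 = a)%N by lia.
have e2 : ((0 + 3 * a) %/ 3 = a)%N by lia.
move: h0 h1 h2; rewrite e0 e1 e2 exprS; set h := rho * _ => h0 h1 h2.
have -> : 2 * rho * 2^-1 ^+ a = 4 * h by rewrite /h; field.
have -> : z0 0 k - z 0 k = (z0 0 k - z1 0 k) + ((z1 0 k - z2 0 k) + (z2 0 k - z 0 k)) by ring.
rewrite (le_trans (ler_normD _ _))// (le_trans (lerD h0 (ler_normD _ _)))//.
have := normr_ge0 (z2 0 k - z 0 k); lra.
Qed.

Definition sampled_limit (x : R) : 'rV[R]_3 :=
  \row_k lim (sampled_center (3 * a) 0 A l 0 x 0 k @[a --> \oo]).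

Lemma cvg_sampled_limit x k :
  sampled_center (3 * a) 0 A l 0 x 0 k @[a --> \oo] --> sampled_limit x 0 k.
Proof.
rewrite mxE; apply: (@cvg_geometric_increments _ (fun a => Z a x 0 k) (2 * rho)).
by move=> a; exact: Z_step.
Qed.

Lemma measurable_sampled_limit k : measurable_fun setT (fun x => sampled_limit x 0 k).
Proof.
apply: (measurable_fun_cvg (h := fun a x => Z a x 0 k)).
- by move=> a; have [] := bounded_measurable_sampled_center (fun c => c 0 k) (3 * a) 0 A l 0.
- by move=> x _; exact: cvg_sampled_limit.
Qed.

(** The sampled centers converge geometrically, and the center of the cell of
    [v] is within [rho 2^-a] of [v]; a Lipschitz [g] sees both limits. *)
Lemma sampled_limit_law (g : 'rV[R]_3 -> R) (K : R) : 0 <= K ->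
  bounded_measurable (g : R3 -> R) ->
  (forall u v : 'rV[R]_3, `|g u - g v| <= K * \sum_k `|u 0 k - v 0 k|) ->
  \int[leb]_(x in `[l, (l + Lam \1_A)[) g (sampled_limit x) =
  Lam (fun v => \1_A v * g v).
Proof.
move=> K0 bg gK; set I := `[l, _[%classic; have [mg [M gM]] := bg.
have mI : measurable I by exact: measurable_itv.
have cg x : g (Z a x) @[a --> \oo] --> g (sampled_limit x).
  apply/cvgrPdist_le => e e0.
  have h : K * \sum_k `|sampled_limit x 0 k - Z a x 0 k| @[a --> \oo] --> (0 : R).
    rewrite -[X in _ --> X](mulr0 K); apply: cvgM; first exact: cvg_cst.
    have E0 : (0 : R) = \sum_(k < 3) 0 by rewrite big1.
    rewrite [X in _ --> X]E0.
    apply: cvg_big => [|k _]; first exact: add_continuous.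
    rewrite -[X in _ --> X](@normr0 _ R); apply: cvg_norm.
    rewrite -(subrr (sampled_limit x 0 k)); apply: cvgB; first exact: cvg_cst.
    exact: cvg_sampled_limit.
  move/cvgrPdist_le : h => /(_ _ e0); apply: filterS => a.
  by rewrite sub0r normrN => h; rewrite (le_trans (gK _ _))// (le_trans (ler_norm _)).
have wA : 0 <= Lam (\1_A : R3 -> R).
  by apply: mean_lim_ge0 => //; exact: bounded_measurable_indic.
have L : \int[leb]_(x in I) g (Z a x) @[a --> \oo] --> \int[leb]_(x in I) g (sampled_limit x).
  rewrite (_ : (fun a => _) = (fun a => \int[leb]_x (\1_I x * g (Z a x)))); last first.
    apply/funext => a; rewrite Rintegral_mkcond; apply: eq_Rintegral => x _.
    by rewrite patchE indicE; case: ifP; rewrite ?mul1r ?mul0r.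
  rewrite (_ : \int[leb]_(x in I) _ = \int[leb]_x (\1_I x * g (sampled_limit x))); last first.
    rewrite Rintegral_mkcond; apply: eq_Rintegral => x _.
    by rewrite patchE indicE; case: ifP; rewrite ?mul1r ?mul0r.
  have mf a : measurable_fun setT (fun x => \1_I x * g (Z a x)).
    apply: measurable_funM; first exact: measurable_indic.
    by have [] := bounded_measurable_sampled_center g (3 * a) 0 A l 0.
  have iM : leb.-integrable setT (EFin \o (fun x => \1_I x * M)).
    apply: integrable_boundedM; last exact: bounded_measurable_cst.
    exact: integrable_indic_itv.
  have dom a x : `|\1_I x * g (Z a x)| <= \1_I x * M.
    by rewrite normrM indicE ger0_norm// ler_wpM2l.
  have cf x : \1_I x * g (Z a x) @[a --> \oo] --> \1_I x * g (sampled_limit x).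
    by apply: cvgM; [exact: cvg_cst|exact: cg].
  by have [] := @dominated_cvg_Rintegral _ (measurableTypeR R) R leb _ _ _ mf iM dom cf.
have L2 : \int[leb]_(x in I) g (Z a x) @[a --> \oo] --> Lam (fun v => \1_A v * g v).
  rewrite (_ : (fun a => _) = (fun a => Lam (fun v => \1_A v * g (cell_center (3 * a) 0 0 v)))); last first.
    by apply/funext => a; exact: sampled_center_law.
  apply/cvgrPdist_le => e e0.
  have h : K * (3 * rho) * 2^-1 ^+ a @[a --> \oo] --> (0 : R).
    by apply: cvg_geometric; rewrite ger0_norm// invf_lt1// ltr1n.
  move/cvgrPdist_le : h => /(_ _ e0); apply: filterS => a.
  rewrite sub0r normrN => h; rewrite (le_trans _ h)// (le_trans _ (ler_norm _))//.
  have bA : bounded_measurable (\1_A : R3 -> R) by exact: bounded_measurable_indic.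
  set C := K * _ * _; rewrite -[C](mean_lim_cst P UU).
  apply: mean_lim_dist => //.
  - exact: bounded_measurableM.
  - by apply: bounded_measurableM => //; exact: bounded_measurable_cell_center.
  - exact: bounded_measurable_cst.
  move=> v; rewrite -mulrBr normrM indicE.
  have C0 : 0 <= C by rewrite /C !mulr_ge0 ?exprn_ge0// ltW.
  have [/set_mem vA|] := boolP (v \in A); last by rewrite normr0 mul0r.
  rewrite normr1 mul1r (le_trans (gK _ _))// /C -!mulrA ler_wpM2l//.
  have bound k : `|(v : 'rV[R]_3) 0 k - (cell_center (3 * a) 0 0 v) 0 k| <= rho * 2^-1 ^+ a.
    have box k' : `|(v : 'rV[R]_3) 0 k' - (0 : 'rV[R]_3) 0 k'| <= rho * 2^-1 ^+ halvings 0 k'.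
      by rewrite mxE subr0 (le_trans (A_box k' vA))// /halvings expr0 mulr1.
    have := cell_center_box (3 * a) box k.
    by have -> : halvings (0 + 3 * a) k = a by rewrite /halvings; lia.
  rewrite (le_trans (ler_sum _ (fun k _ => bound k)))//.
  by rewrite sumr_const card_ord -[X in X <= _]mulr_natl.
exact: (cvg_unique _ L L2).
Qed.

End one_shell.

Hypothesis tight : forall e : R, 0 < e -> exists N : nat, forall n,
  \int[P n]_v \1_[set v : R3 | N%:R <= `|v : 'rV[R]_3|] v <= e.

(** Unbounded vectors are treated shell by shell: the shell of index [m] is
    sampled on an interval of length its mass, placed at the integer [m], so
    that the intervals do not overlap. *)
Let ball N : set R3 := [set v : R3 | `|v : 'rV[R]_3| < N%:R].
Let shell m : set R3 := [set v : R3 | m%:R <= `|v : 'rV[R]_3| < m.+1%:R].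

Let measurable_ball N : measurable (ball N).
Proof.
rewrite [ball N](_ : _ = (fun v : R3 => `|v : 'rV[R]_3|) @^-1` `]-oo, N%:R[%classic).
  by rewrite -[X in measurable X]setTI; apply: measurable_normR3.
by apply/seteqP; split => v /=; rewrite in_itv.
Qed.

Let measurable_shell m : measurable (shell m).
Proof.
rewrite [shell m](_ : _ = (fun v : R3 => `|v : 'rV[R]_3|) @^-1` `[m%:R, m.+1%:R[%classic).
  by rewrite -[X in measurable X]setTI; apply: measurable_normR3.
by apply/seteqP; split => v /=; rewrite in_itv.
Qed.

Let bball N : bounded_measurable (\1_(ball N) : R3 -> R).
Proof. exact: bounded_measurable_indic. Qed.

Let bshell N : bounded_measurable (\1_(shell N) : R3 -> R).
Proof. exact: bounded_measurable_indic. Qed.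

Let w m := Lam \1_(shell m).

Let w_ge0 m : 0 <= w m. Proof. exact: mean_lim_ge0. Qed.

Let w_le1 m : w m <= 1.
Proof.
rewrite -(mean_lim_cst P UU 1); apply: le_mean_lim => //.
exact: bounded_measurable_cst.
Qed.

Let I m : set R := `[m%:R, m%:R + w m[%classic.

Let I_truncn m x : I m x -> Num.truncn x = m.
Proof.
rewrite /I/= in_itv/= => /andP[mx xm]; apply: truncn_def; rewrite mx/=.
by rewrite (lt_le_trans xm)// -natr1 lerD2l.
Qed.

Let X (m : nat) (x : R) : 'rV[R]_3 := sampled_limit m.+1%:R (shell m) m%:R x.

Let X_law (g : 'rV[R]_3 -> R) (K : R) m : 0 <= K ->
  bounded_measurable (g : R3 -> R) ->
  (forall u v : 'rV[R]_3, `|g u - g v| <= K * \sum_k `|u 0 k - v 0 k|) ->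
  \int[leb]_x (\1_(I m) x * g (X m x)) = Lam (fun v => \1_(shell m) v * g v).
Proof.
move=> K0 bg gK.
have m0 : 0 < m.+1%:R :> R by rewrite ltr0n.
have box v k : shell m v -> `|(v : 'rV[R]_3) 0 k| <= m.+1%:R.
  move=> /andP[_ /ltW]; apply: le_trans.
  rewrite [leRHS]mx_normrE; exact: (le_bigmax _ _ (0, k)).
rewrite -(sampled_limit_law m0 m%:R (measurable_shell m) box K0 bg gK).
rewrite [RHS]Rintegral_mkcond; apply: eq_Rintegral => x _.
by rewrite patchE indicE; case: ifP; rewrite ?mul1r ?mul0r.
Qed.

Let partial_sum (g : nat -> R -> R) N x :
  \sum_(m < N) \1_(I m) x * g m x =
  if (Num.truncn x < N)%N then \1_(I (Num.truncn x)) x * g (Num.truncn x) x else 0.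
Proof.
have I0 m : m != Num.truncn x -> \1_(I m) x = 0 :> R.
  by move=> mx; rewrite indicE memNset// => /I_truncn xm; rewrite xm eqxx in mx.
case: ifPn => xN.
  rewrite (bigD1 (Ordinal xN))//= big1 ?addr0// => m mx.
  by rewrite I0 ?mul0r//; apply: contraNneq mx => h; apply/eqP/val_inj.
rewrite big1// => m _; rewrite I0 ?mul0r//.
by apply: contraNneq xN => <-.
Qed.

Let ball_sum (g : R3 -> R) N : bounded_measurable g ->
  \sum_(m < N) Lam (fun v => \1_(shell m) v * g v) = Lam (fun v => \1_(ball N) v * g v).
Proof.
move=> bg; elim: N => [|N ih].
  rewrite big_ord0 -(mean_lim_cst P UU 0); congr (Lam _); apply/funext => v.
  by rewrite indicE memNset ?mul0r//= /ball/=; apply/negP; rewrite -leNgt normr_ge0.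
rewrite big_ord_recr/= ih -mean_limD; [|exact: bounded_measurableM..].
congr (Lam _); apply/funext => v; rewrite -mulrDl; congr (_ * _).
rewrite !indicE /ball /shell.
have E (b : bool) : (v \in [set _ : R3 | b]) = b by apply/idP/idP => [/set_mem|/mem_set].
have -> : (v \in [set v0 : R3 | `|v0 : 'rV[R]_3| < N%:R]) = (`|v : 'rV[R]_3| < N%:R).
  by apply/idP/idP => [/set_mem|h]//; exact/mem_set.
have -> : (v \in [set v0 : R3 | `|v0 : 'rV[R]_3| < N.+1%:R]) = (`|v : 'rV[R]_3| < N.+1%:R).
  by apply/idP/idP => [/set_mem|h]//; exact/mem_set.
have -> : (v \in [set v0 : R3 | N%:R <= `|v0 : 'rV[R]_3| < N.+1%:R]) =
    (N%:R <= `|v : 'rV[R]_3| < N.+1%:R).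
  by apply/idP/idP => [/set_mem|h]//; exact/mem_set.
have NS : N%:R < N.+1%:R :> R by rewrite ltr_nat.
have [vN|vN] /= := ltP `|v : 'rV[R]_3| N%:R.
  by rewrite (lt_trans vN NS) addr0.
by rewrite add0r.
Qed.

(** Tightness: [Lam] is not countably additive, but no mass escapes to
    infinity. *)
Let cvg_ball (g : R3 -> R) : bounded_measurable g ->
  Lam (fun v => \1_(ball N) v * g v) @[N --> \oo] --> Lam g.
Proof.
move=> bg; have [_ [M gM]] := bg.
have M0 : 0 <= M by apply: le_trans (gM 0).
apply/cvgrPdist_le => e e0.
have eM : 0 < e / (M + 1) by rewrite divr_gt0// ltr_wpDl.
have [N0 HN0] := tight eM.
near=> N.
have N0N : (N0 <= N)%N by near: N; exists N0.
pose out : set R3 := [set v : R3 | N0%:R <= `|v : 'rV[R]_3|].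
have mout : measurable out.
  rewrite [out](_ : _ = (fun v : R3 => `|v : 'rV[R]_3|) @^-1` `[N0%:R, +oo[%classic).
    by rewrite -[X in measurable X]setTI; apply: measurable_normR3.
  by apply/seteqP; split => v /=; rewrite in_itv/= andbT.
have bout : bounded_measurable (\1_out : R3 -> R) by exact: bounded_measurable_indic.
apply: (@le_trans _ _ (Lam (fun v => M * \1_out v))).
  apply: mean_lim_dist => //.
  - exact: bounded_measurableM.
  - by apply: bounded_measurableM => //; exact: bounded_measurable_cst.
  move=> v; rewrite !indicE; have [vo|vo] := boolP (v \in out).
    rewrite mulr1 (le_trans _ (gM v))//; case: (v \in ball N); rewrite ?mul1r ?subrr ?normr0//.
    by rewrite mul0r subr0.
  rewrite mem_set ?mul1r ?subrr ?normr0 ?mulr0//.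
  move: vo; rewrite notin_setE /out /ball/= => /negP; rewrite -ltNge => h.
  by rewrite (lt_le_trans h)// ler_nat.
rewrite mean_limZ//.
have : Lam (\1_out : R3 -> R) <= e / (M + 1).
  apply: limr_le; first exact: cvg_mean_lim.
  by apply: nearW => n; exact: HN0.
move=> h; rewrite (le_trans (ler_wpM2l M0 h))//.
rewrite mulrCA; apply: ler_piMr; first exact: ltW.
by rewrite ler_pdivrMr ?mul1r ?lerDl// ltr_wpDl.
Unshelve. all: by end_near.
Qed.

Let Xs (x : R) : R3 := X (Num.truncn x) x.
Let dens (x : R) : R := \1_(I (Num.truncn x)) x.

Let measurable_I m : measurable (I m).
Proof. exact: measurable_itv. Qed.

Let bounded_dens : bounded_measurable (dens : measurableTypeR R -> R).
Proof.
split; last first.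
  by exists 1 => x; rewrite /dens indicE; case: (_ \in _); rewrite ?normr1 ?normr0.
apply: (measurable_fun_nat_cases (F := fun m x => \1_(I m) x)); first exact: measurable_truncn.
by move=> m; exact: measurable_indic.
Qed.

Let measurable_Xs : measurable_fun setT (Xs : measurableTypeR R -> R3).
Proof.
apply: measurable_to_borelR3 => k.
apply: (measurable_fun_nat_cases (F := fun m x => X m x 0 k)); first exact: measurable_truncn.
by move=> m; apply: measurable_sampled_limit; rewrite ltr0n.
Qed.

Let partial (g : 'rV[R]_3 -> R) N (x : measurableTypeR R) : R :=
  \sum_(m < N) \1_(I m) x * g (X m x).

Let partialE g N x : partial g N x =
  if (Num.truncn x < N)%N then dens x * g (Xs x) else 0.
Proof. exact: (partial_sum (fun m x => g (X m x))). Qed.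

Let integrable_partial_term (g : 'rV[R]_3 -> R) m : bounded_measurable (g : R3 -> R) ->
  leb.-integrable setT (EFin \o (fun x => \1_(I m) x * g (X m x))).
Proof.
move=> bg; apply: integrable_boundedM; first exact: integrable_indic_itv.
apply: (bounded_measurable_comp (X := fun x : measurableTypeR R => X m x : R3)) bg.
by apply: measurable_to_borelR3 => k; apply: measurable_sampled_limit; rewrite ltr0n.
Qed.

Let measurable_partial g N : bounded_measurable (g : R3 -> R) ->
  measurable_fun setT (partial g N).
Proof.
move=> bg; apply: measurable_sum => m.
by have /measurable_int/measurable_EFinP := integrable_partial_term m bg.
Qed.

Let integrable_partial g N : bounded_measurable (g : R3 -> R) ->
  leb.-integrable setT (EFin \o partial g N).
Proof.
move=> bg.
have -> : EFin \o partial g N =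
    (fun x => \sum_(m < N) (\1_(I m) x * g (X m x))%R%:E)%E.
  by apply/funext => x /=; rewrite /partial sumEFin.
by apply: integrable_sum => // m _; exact: integrable_partial_term.
Qed.

Let Rintegral_partial (g : 'rV[R]_3 -> R) (K : R) N : 0 <= K ->
  bounded_measurable (g : R3 -> R) ->
  (forall u v : 'rV[R]_3, `|g u - g v| <= K * \sum_k `|u 0 k - v 0 k|) ->
  \int[leb]_x partial g N x = Lam (fun v => \1_(ball N) v * g v).
Proof.
move=> K0 bg gK; rewrite -ball_sum//.
rewrite (@Rintegral_sum _ _ _ leb _ _ (fun (m : 'I_N) x => \1_(I m) x * g (X m x))).
  by apply: eq_bigr => m _; exact: X_law K0 bg gK.
by move=> m; exact: integrable_partial_term.
Qed.

Let integral_dens : (\int[leb]_x (dens x)%:E = 1)%E.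
Proof.
pose one : 'rV[R]_3 -> R := fun=> 1.
have b1 : bounded_measurable (one : R3 -> R) by exact: bounded_measurable_cst.
have L1 : forall u v : 'rV[R]_3, `|one u - one v| <= 0 * \sum_k `|u 0 k - v 0 k|.
  by move=> u v; rewrite subrr normr0 mul0r.
have cd x : (partial one N x)%:E @[N --> \oo] --> (dens x)%:E.
  apply: cvg_near_cst; exists (Num.truncn x).+1 => // N /= xN.
  by rewrite partialE xN mulr1.
have nd x : {homo (fun N => (partial one N x)%:E) : m n / (m <= n)%N >-> (m <= n)%E}.
  move=> m n mn; rewrite lee_fin !partialE /one mulr1.
  case: ifPn => xm; first by rewrite (leq_trans xm mn).
  by case: ifP => // _; rewrite /dens indicE; case: (_ \in _).
have p0 N x : (0 <= (partial one N x)%:E)%E.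
  by rewrite lee_fin partialE /one mulr1; case: ifP => // _; rewrite /dens indicE; case: (_ \in _).
transitivity (limn (fun N => \int[leb]_x (partial one N x)%:E)%E).
  rewrite -monotone_convergence//.
  - by apply: eq_integral => x _; apply/esym/cvg_lim => //; exact: cd.
  - by move=> N; apply/measurable_EFinP; exact: measurable_partial.
have -> : (fun N => \int[leb]_x (partial one N x)%:E)%E =
    (fun N => (Lam (fun v => \1_(ball N) v * one v))%:E).
  apply/funext => N; rewrite -(Rintegral_partial N (lexx 0) b1 L1) /Rintegral fineK//.
  exact: integrable_fin_num (integrable_partial N b1).
apply/cvg_lim => //; apply: cvg_EFin; first exact: nearW.
by have := cvg_ball b1; rewrite [Lam one](mean_lim_cst P UU 1).
Qed.

(** Lipschitz test functions are compatible with the approximation of a vector by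
    the center of its cell, and they include the real and imaginary parts of
    [exp (- i v.xi)].  The density is the indicator of the sampling intervals;
    its total mass is 1 by tightness. *)
Theorem tight_generalized_limit : exists Q : probability R3 R,
  forall (g : 'rV[R]_3 -> R) (K : R), 0 <= K ->
    bounded_measurable (g : R3 -> R) ->
    (forall u v : 'rV[R]_3, `|g u - g v| <= K * \sum_k `|u 0 k - v 0 k|) ->
    \int[Q]_v g v = Lam g.
Proof.
have dens0 x : 0 <= dens x by rewrite /dens indicE; case: (_ \in _).
have [md _] := bounded_dens.
have [Q QE] := @weighted_law _ _ (measurableTypeR R) _ R leb dens Xs md dens0
  integral_dens measurable_Xs.
exists Q => g K K0 bg gK; rewrite QE//.
have idens : leb.-integrable setT (EFin \o dens).
  apply/integrableP; split; first exact/measurable_EFinP.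
  under eq_integral do rewrite /= ger0_norm//.
  by rewrite integral_dens ltry.
have [_ [M gM]] := bg.
have idM : leb.-integrable setT (EFin \o (fun x => dens x * M)).
  by apply: integrable_boundedM => //; exact: bounded_measurable_cst.
have dom N x : `|partial g N x| <= dens x * M.
  rewrite partialE; case: ifP => _; first by rewrite normrM ger0_norm// ler_wpM2l.
  by rewrite normr0 mulr_ge0// (le_trans _ (gM 0)).
have cf x : partial g N x @[N --> \oo] --> g (Xs x) * dens x.
  apply: cvg_near_cst; exists (Num.truncn x).+1 => // N /= xN.
  by rewrite partialE xN mulrC.
have [_ _ L1] := @dominated_cvg_Rintegral _ (measurableTypeR R) R leb _ _ _
  (fun N => measurable_partial N bg) idM dom cf.
have L2 := cvg_ball bg.
have E : (fun N => \int[leb]_x partial g N x) =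
    (fun N => Lam (fun v => \1_(ball N) v * g v)).
  by apply/funext => N; exact: Rintegral_partial K0 bg gK.
by rewrite E in L1; exact: (cvg_unique _ L1 L2).
Qed.

End bisection.

(** * Characteristic functions *)

Local Open Scope complex_scope.
Local Notation normc := ComplexField.Normc.normc.

Section complex_modulus.
Variable R : realType.
Implicit Types z : R[i].

Lemma normc_ge0 z : 0 <= normc z.
Proof. by case: z => a b; exact: sqrtr_ge0. Qed.

Lemma normcB z1 z2 : normc (z1 - z2) <= normc z1 + normc z2.
Proof.
by rewrite -(normcN z2); exact: le_normcD.
Qed.

Lemma normc_distC z1 z2 : normc (z1 - z2) = normc (z2 - z1).
Proof. by rewrite -normcN opprB. Qed.

Lemma normc_dist_trans z2 z1 z3 : normc (z1 - z3) <= normc (z1 - z2) + normc (z2 - z3).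
Proof.
have -> : z1 - z3 = (z1 - z2) + (z2 - z3) by rewrite addrA subrK.
exact: le_normcD.
Qed.

Lemma sqr_normc z : normc z ^+ 2 = complex.Re z ^+ 2 + complex.Im z ^+ 2.
Proof. by case: z => a b /=; rewrite sqr_sqrtr// addr_ge0// sqr_ge0. Qed.

Lemma normc_real (x : R) : normc x%:C = `|x|.
Proof. by rewrite /= expr0n/= addr0 sqrtr_sqr. Qed.

Lemma Re_le_normc z : `|complex.Re z| <= normc z.
Proof.
rewrite -(@ler_pXn2r _ 2) ?nnegrE ?normc_ge0// sqr_normc real_normK ?num_real//.
by rewrite lerDl sqr_ge0.
Qed.

Lemma Im_le_normc z : `|complex.Im z| <= normc z.
Proof.
rewrite -(@ler_pXn2r _ 2) ?nnegrE ?normc_ge0// sqr_normc real_normK ?num_real//.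
by rewrite lerDr sqr_ge0.
Qed.

Lemma normc_le_ReIm z : normc z <= `|complex.Re z| + `|complex.Im z|.
Proof.
rewrite -(@ler_pXn2r _ 2) ?nnegrE ?normc_ge0 ?addr_ge0// sqr_normc.
rewrite sqrrD !real_normK ?num_real// addrAC lerDl.
by rewrite mulrn_wge0// mulr_ge0.
Qed.

(** Reduces a bound on a complex integral to bounds on real integrals. *)
Lemma normc_le_directions z (B : R) : 0 <= B ->
  (forall a b : R, a ^+ 2 + b ^+ 2 = 1 -> a * complex.Re z + b * complex.Im z <= B) ->
  normc z <= B.
Proof.
move=> B0 H; have [z0|z0] := eqVneq (normc z) 0; first by rewrite z0.
have := H (complex.Re z / normc z) (complex.Im z / normc z).
rewrite !expr_div_n -mulrDl -sqr_normc divff ?expf_neq0// => /(_ erefl).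
rewrite mulrAC [X in _ + X]mulrAC -mulrDl -!expr2 -sqr_normc expr2.
by rewrite mulfK.
Qed.

Lemma normc_direction z (a b : R) : a ^+ 2 + b ^+ 2 = 1 ->
  a * complex.Re z + b * complex.Im z <= normc z.
Proof.
move=> ab; rewrite (le_trans (ler_norm _))// -(@ler_pXn2r _ 2) ?nnegrE ?normc_ge0//.
rewrite sqr_normc real_normK ?num_real//.
set x := complex.Re z; set y := complex.Im z.
have -> : x ^+ 2 + y ^+ 2 = (x ^+ 2 + y ^+ 2) * (a ^+ 2 + b ^+ 2) by rewrite ab mulr1.
have := sqr_ge0 (a * y - b * x); nra.
Qed.

End complex_modulus.

Section mean.
Context d (T : measurableType d) (R : realType) (P : probability T R).

Lemma integrable_mean (f : T -> R) : bounded_measurable f -> P.-integrable setT (EFin \o f).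
Proof. by move=> bf; apply: integrable_bounded => //; rewrite /= probability_setT ltry. Qed.

Lemma meanD f g : bounded_measurable f -> bounded_measurable g ->
  \int[P]_x (f x + g x) = \int[P]_x f x + \int[P]_x g x.
Proof. by move=> bf bg; rewrite RintegralD//; exact: integrable_mean. Qed.

Lemma meanZ c f : bounded_measurable f ->
  \int[P]_x (c * f x) = c * \int[P]_x f x.
Proof. by move=> bf; rewrite RintegralZl//; exact: integrable_mean. Qed.

Lemma mean_cst c : \int[P]_x (c : R) = c.
Proof. by rewrite Rintegral_cst//= probability_setT mulr1. Qed.

Lemma mean_ge0 f : (forall x, 0 <= f x) -> 0 <= \int[P]_x f x.
Proof. by move=> f0; apply: Rintegral_ge0. Qed.

Lemma mean_affine6 (k a1 a2 a3 a4 a5 a6 : R) (g1 g2 g3 g4 g5 g6 : T -> R) :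
  bounded_measurable g1 -> bounded_measurable g2 -> bounded_measurable g3 ->
  bounded_measurable g4 -> bounded_measurable g5 -> bounded_measurable g6 ->
  \int[P]_x (k + a1 * g1 x + a2 * g2 x + a3 * g3 x + a4 * g4 x + a5 * g5 x + a6 * g6 x) =
  k + a1 * \int[P]_x g1 x + a2 * \int[P]_x g2 x + a3 * \int[P]_x g3 x +
  a4 * \int[P]_x g4 x + a5 * \int[P]_x g5 x + a6 * \int[P]_x g6 x.
Proof.
move=> b1 b2 b3 b4 b5 b6; have bk := bounded_measurable_cst T k.
have bZ c g : bounded_measurable g -> bounded_measurable (fun x => c * g x).
  by move=> bg; apply: bounded_measurableM => //; exact: bounded_measurable_cst.
rewrite meanD; [|by repeat apply: bounded_measurableD => //; exact: bZ|exact: bZ].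
rewrite meanD; [|by repeat apply: bounded_measurableD => //; exact: bZ|exact: bZ].
rewrite meanD; [|by repeat apply: bounded_measurableD => //; exact: bZ|exact: bZ].
rewrite meanD; [|by repeat apply: bounded_measurableD => //; exact: bZ|exact: bZ].
rewrite meanD; [|by repeat apply: bounded_measurableD => //; exact: bZ|exact: bZ].
rewrite meanD; [|by []|exact: bZ].
by rewrite !meanZ// mean_cst.
Qed.

End mean.

Section characteristic_functions.
Variable R : realType.
Local Notation R3 := (borelR3 R).
Implicit Types (P : probability R3 R) (xi eta : 'rV[R]_3) (f g : 'rV[R]_3 -> R[i]).

Definition charC P xi := \int[P]_v cos (dot (v : 'rV[R]_3) xi).
Definition charS P xi := \int[P]_v sin (dot (v : 'rV[R]_3) xi).

Lemma bounded_cos_dot xi : bounded_measurable (fun v : R3 => cos (dot (v : 'rV[R]_3) xi)).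
Proof. by apply: bounded_measurable_cos; exact: measurable_dotl. Qed.

Lemma bounded_sin_dot xi : bounded_measurable (fun v : R3 => sin (dot (v : 'rV[R]_3) xi)).
Proof. by apply: bounded_measurable_sin; exact: measurable_dotl. Qed.

Lemma is_char_funP f :
  is_char_fun f <-> exists P, forall xi, f xi = (charC P xi) +i* (- charS P xi).
Proof.
have E P xi : cintegral P setT (fun v : R3 => cexpi (- dot (v : 'rV[R]_3) xi)) =
    (charC P xi) +i* (- charS P xi).
  rewrite /cintegral /cexpi/=; congr (_ +i* _).
    by apply: eq_Rintegral => v _; rewrite cosN.
  rewrite -mulN1r -meanZ; last exact: bounded_sin_dot.
  by apply: eq_Rintegral => v _; rewrite sinN mulN1r.
by split=> -[P H]; exists P => xi; rewrite H E.
Qed.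

Lemma normc_char_le1 f xi : is_char_fun f -> normc (f xi) <= 1.
Proof.
move=> /is_char_funP[P ->]; apply: normc_le_directions => // a b ab /=.
have -> : a * charC P xi + b * - charS P xi =
  \int[P]_v (a * cos (dot (v : 'rV[R]_3) xi) + (- b) * sin (dot (v : 'rV[R]_3) xi)).
  rewrite meanD ?meanZ ?mulrN ?mulNr//; try exact: bounded_cos_dot; try exact: bounded_sin_dot.
  - by apply: bounded_measurableM; [exact: bounded_measurable_cst|exact: bounded_cos_dot].
  - by apply: bounded_measurableM; [exact: bounded_measurable_cst|exact: bounded_sin_dot].
rewrite -(mean_cst P 1); apply: le_Rintegral => //.
- apply: (@integrable_mean _ _ _ _ (fun v : R3 => a * cos (dot (v : 'rV[R]_3) xi) + (- b) * sin (dot (v : 'rV[R]_3) xi))).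
  by apply: bounded_measurableD; apply: bounded_measurableM; rewrite ?(bounded_measurable_cst);
    [exact: bounded_measurable_cst|exact: bounded_cos_dot|exact: bounded_measurable_cst|exact: bounded_sin_dot].
- by apply: integrable_mean; exact: bounded_measurable_cst.
move=> v _; set x := dot _ _; have := cos2Dsin2 x => h.
have : (a * cos x + - b * sin x) ^+ 2 <= 1.
  have -> : 1 = (a ^+ 2 + b ^+ 2) * (cos x ^+ 2 + sin x ^+ 2) by rewrite ab h mulr1.
  have := sqr_ge0 (a * sin x + b * cos x); nra.
nra.
Qed.

Lemma char_fun0 f : is_char_fun f -> f 0 = 1.
Proof.
move=> /is_char_funP[P ->]; rewrite /charC /charS.
have d0 v : dot v (0 : 'rV[R]_3) = 0 by rewrite dotE !mxE; ring.
under eq_Rintegral do rewrite d0 cos0.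
under [X in _ +i* (- X)]eq_Rintegral do rewrite d0 sin0.
by rewrite !mean_cst oppr0.
Qed.

(** The left-hand side is the covariance of [exp(-i v.xi)] and
    [exp(-i v.eta)], whose variances are [1 - |f xi|^2] and [1 - |f eta|^2]:
    this is Cauchy-Schwarz in the form of Young's inequality.  The proof
    integrates the pointwise inequality for the real part of a rotated product
    of the centered variables. *)
Lemma char_fun_product_defect f xi eta (c : R) : is_char_fun f -> 0 < c ->
  normc (f xi * f eta - f (xi + eta)) <=
  (c * (1 - normc (f xi) ^+ 2) + c^-1 * (1 - normc (f eta) ^+ 2)) / 2.
Proof.
move=> fK c0; have n1 := normc_char_le1 xi fK; have n2 := normc_char_le1 eta fK.
have p1 : 0 <= 1 - normc (f xi) ^+ 2 by have := normc_ge0 (f xi); nra.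
have p2 : 0 <= 1 - normc (f eta) ^+ 2 by have := normc_ge0 (f eta); nra.
have ci0 : 0 < c^-1 by rewrite invr_gt0.
apply: normc_le_directions.
  by rewrite divr_ge0// addr_ge0// mulr_ge0// ltW.
move: fK {n1 n2 p1 p2} => /is_char_funP[P fE] w1 w2 w12.
rewrite !sqr_normc !fE /=.
set C1 := charC P xi; set S1 := charS P xi; set C2 := charC P eta; set S2 := charS P eta.
set C12 := charC P (xi + eta); set S12 := charS P (xi + eta).
pose x (v : R3) := dot (v : 'rV[R]_3) xi; pose y (v : R3) := dot (v : 'rV[R]_3) eta.
pose X a b := (cos a - C1) * (cos b - C2) - (sin a - S1) * (sin b - S2).
pose Y a b := (cos a - C1) * (sin b - S2) + (cos b - C2) * (sin a - S1).
pose Q a b : R := (c * ((cos a - C1) ^+ 2 + (sin a - S1) ^+ 2) +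
   c^-1 * ((cos b - C2) ^+ 2 + (sin b - S2) ^+ 2)) / 2.
have Q0 a b : 0 <= Q a b + (w1 * X a b - w2 * Y a b).
  rewrite /Q /X /Y.
  set p := cos a - C1; set q := sin a - S1; set r := cos b - C2; set t := sin b - S2.
  pose u := w1 * r - w2 * t; pose z := w1 * t + w2 * r.
  have ruz : r ^+ 2 + t ^+ 2 = u ^+ 2 + z ^+ 2.
    by rewrite -[LHS]mul1r -w12 /u /z; ring.
  have -> : w1 * (p * r - q * t) - w2 * (p * t + r * q) = p * u - q * z.
    by rewrite /u /z; ring.
  rewrite ruz.
  have -> : (c * (p ^+ 2 + q ^+ 2) + c^-1 * (u ^+ 2 + z ^+ 2)) / 2 + (p * u - q * z) =
     c / 2 * ((p + c^-1 * u) ^+ 2 + (q - c^-1 * z) ^+ 2).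
    by field; rewrite gt_eqF.
  by apply: mulr_ge0; [rewrite divr_ge0// ltW|rewrite addr_ge0// sqr_ge0].
have := mean_ge0 P (fun v => Q0 (x v) (y v)).
pose k := (c * (1 + C1 ^+ 2 + S1 ^+ 2) + c^-1 * (1 + C2 ^+ 2 + S2 ^+ 2)) / 2 +
  w1 * (C1 * C2 - S1 * S2) - w2 * (C1 * S2 + C2 * S1).
have -> : \int[P]_v (Q (x v) (y v) + (w1 * X (x v) (y v) - w2 * Y (x v) (y v))) =
  \int[P]_v (k + w1 * cos (dot (v : 'rV[R]_3) (xi + eta))
   + (- w2) * sin (dot (v : 'rV[R]_3) (xi + eta))
   + (- c * C1 - w1 * C2 + w2 * S2) * cos (x v)
   + (- c * S1 + w1 * S2 + w2 * C2) * sin (x v)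
   + (- c^-1 * C2 - w1 * C1 + w2 * S1) * cos (y v)
   + (- c^-1 * S2 + w1 * S1 + w2 * C1) * sin (y v)).
  apply: eq_Rintegral => v _; rewrite dotDr -/(x v) -/(y v) cosD sinD.
  have h1 := cos2Dsin2 (x v); have h2 := cos2Dsin2 (y v).
  have e1 : (cos (x v) - C1) ^+ 2 + (sin (x v) - S1) ^+ 2 =
     1 - 2 * C1 * cos (x v) - 2 * S1 * sin (x v) + C1 ^+ 2 + S1 ^+ 2.
    rewrite -[X in X - 2 * C1 * _]h1; ring.
  have e2 : (cos (y v) - C2) ^+ 2 + (sin (y v) - S2) ^+ 2 =
     1 - 2 * C2 * cos (y v) - 2 * S2 * sin (y v) + C2 ^+ 2 + S2 ^+ 2.
    rewrite -[X in X - 2 * C2 * _]h2; ring.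
  by rewrite /Q e1 e2 /X /Y /k; field; rewrite gt_eqF.
rewrite mean_affine6; try exact: bounded_cos_dot; try exact: bounded_sin_dot.
rewrite -/(charC P _) -/(charS P _) -/C12 -/S12 -/(charC P xi) -/(charS P xi)
  -/(charC P eta) -/(charS P eta) -/C1 -/C2 -/S1 -/S2 /k.
set ci := c^-1; lra.
Qed.

End characteristic_functions.

(** * Limits of characteristic functions *)

Section closure.
Variable R : realType.
Local Notation R3 := (borelR3 R).
Implicit Types (xi eta : 'rV[R]_3) (f : 'rV[R]_3 -> R[i]).

Lemma derivative_le1_lipschitz (h dh : R -> R) (x y : R) :
  (forall t : R, is_derive t (1 : R) h (dh t)) -> (forall t, `|dh t| <= 1) ->
  `|h x - h y| <= `|x - y|.
Proof.
move=> hd dh1; wlog xy : x y / y <= x.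
  by move=> W; case: (leP y x) => [|/ltW] ?; [exact: W|rewrite distrC (distrC x); exact: W].
have hc : continuous h by move=> t; apply: derivable_continuous; exists (dh t).
have [c _ ->] := @MVT_segment R h dh y x xy (fun t _ => hd t) (continuous_subspaceT hc).
by rewrite normrM ler_piMl.
Qed.

Lemma cos_lipschitz (x y : R) : `|cos x - cos y| <= `|x - y|.
Proof.
apply: (derivative_le1_lipschitz (dh := fun t => - sin t)) => t.
by rewrite normrN ler_norml sin_geN1 sin_le1.
Qed.

Lemma sin_lipschitz (x y : R) : `|sin x - sin y| <= `|x - y|.
Proof.
apply: (derivative_le1_lipschitz (dh := cos)) => t.
by rewrite ler_norml cos_geN1 cos_le1.
Qed.

Lemma dot_lipschitz (u v xi : 'rV[R]_3) :
  `|dot u xi - dot v xi| <= (\sum_k `|xi 0 k|) * \sum_k `|u 0 k - v 0 k|.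
Proof.
have -> : dot u xi - dot v xi = \sum_k (u 0 k - v 0 k) * xi 0 k.
  by rewrite /dot -sumrB; apply: eq_bigr => k _; rewrite mulrBl.
rewrite (le_trans (ler_norm_sum _ _ _))// mulr_sumr; apply: ler_sum => k _.
rewrite normrM mulrC ler_wpM2r// (bigD1 k)//= lerDl.
by apply: sumr_ge0.
Qed.

(** The exponent [alpha > 0] makes the tail bound of [norm_tail_bound] vanish at
    infinity, with a rate that depends only on [M]. *)
Lemma tight_of_near_one (alpha M : R) (P : nat -> probability R3 R) :
  0 < alpha -> 0 <= M ->
  (forall n xi, 1 - charC (P n) xi <= M * enorm xi `^ alpha) ->
  forall e : R, 0 < e -> exists N : nat, forall n,
    \int[P n]_v \1_[set v : R3 | N%:R <= `|v : 'rV[R]_3|] v <= e.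
Proof.
move=> a0 M0 HP e e0.
pose t := e / (6 * M + 1); have t0 : 0 < t by rewrite divr_gt0//; nra.
pose r := 2 / (t `^ alpha^-1); have r0 : 0 < r by rewrite divr_gt0// powR_gt0.
exists (Num.truncn r).+1 => n.
have N0 : 0 < (Num.truncn r).+1%:R :> R by rewrite ltr0n.
have := norm_tail_bound M0 a0 (HP n) N0.
set A := [set v | _] => h.
have mA : measurable A.
  rewrite [A](_ : _ = (fun v : R3 => `|v : 'rV[R]_3|) @^-1` `[(Num.truncn r).+1%:R, +oo[%classic).
    by rewrite -[X in measurable X]setTI; apply: measurable_normR3.
  by apply/seteqP; split => v /=; rewrite in_itv/= andbT.
rewrite -lee_fin /Rintegral fineK; last first.
  apply: integrable_fin_num => //; apply: (@integrable_mean _ _ _ _ \1_A).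
  exact: bounded_measurable_indic.
rewrite integral_indic// setIT (le_trans h)// lee_fin.
have : (2 / (Num.truncn r).+1%:R) `^ alpha <= t.
  have -> : t = (t `^ alpha^-1) `^ alpha by rewrite -powRrM mulVf ?gt_eqF// powRr1// ltW.
  apply: ge0_ler_powR; rewrite ?nnegrE ?powR_ge0 ?divr_ge0 ?ltW//.
  have := truncnS_gt r; rewrite {1}/r ltr_pdivrMr ?powR_gt0//.
  by move=> lt2; rewrite ltr_pdivrMr// mulrC.
have e1 : t * (6 * M + 1) = e by rewrite /t mulfVK// gt_eqF//; nra.
have := powR_ge0 (2 / (Num.truncn r).+1%:R) alpha; nra.
Qed.

(** A form of the continuity theorem of Levy in which tightness comes from the
    uniform bound on [f_n - 1]. *)
Theorem char_fun_closed (alpha M : R) (f_ : nat -> 'rV[R]_3 -> R[i]) f :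
  0 < alpha -> 0 <= M -> (forall n, is_char_fun (f_ n)) ->
  (forall n xi, normc (f_ n xi - 1) <= M * enorm xi `^ alpha) ->
  (forall xi, normc (f_ n xi - f xi) @[n --> \oo] --> (0 : R)) ->
  is_char_fun f.
Proof.
move=> a0 M0 f_K f_M f_f.
have /choice[P fE] n : exists P : probability R3 R,
    forall xi, f_ n xi = (charC P xi) +i* (- charS P xi).
  exact/is_char_funP.
have [U [UU ooU]] := ultraFilterLemma (@eventually_filter : ProperFilter \oo).
have cvgRe xi : charC (P n) xi @[n --> \oo] --> complex.Re (f xi).
  apply/cvgrPdist_le => e e0; have /cvgrPdist_le/(_ _ e0) := f_f xi.
  apply: filterS => n; rewrite sub0r normrN ger0_norm ?normc_ge0//.
  apply: le_trans; rewrite distrC (le_trans _ (Re_le_normc _))//.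
  by rewrite fE; case: (f xi).
have cvgIm xi : charS (P n) xi @[n --> \oo] --> - complex.Im (f xi).
  apply/cvgrPdist_le => e e0; have /cvgrPdist_le/(_ _ e0) := f_f xi.
  apply: filterS => n; rewrite sub0r normrN ger0_norm ?normc_ge0//.
  apply: le_trans; rewrite (le_trans _ (Im_le_normc _))//.
  by rewrite fE; case: (f xi) => a b /=; rewrite addrC.
have near1 n xi : 1 - charC (P n) xi <= M * enorm xi `^ alpha.
  rewrite (le_trans _ (f_M n xi))// (le_trans _ (Re_le_normc _))// fE /=.
  by rewrite distrC ler_norm.
have [Q QE] := tight_generalized_limit UU (tight_of_near_one a0 M0 near1).
apply/is_char_funP; exists Q => xi.
have K0 : 0 <= \sum_k `|xi 0 k| by exact: sumr_ge0.
have CE : charC Q xi = complex.Re (f xi).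
  rewrite /charC (QE (fun v => cos (dot v xi)) _ K0 (bounded_cos_dot xi)); last first.
    by move=> u v; rewrite (le_trans (cos_lipschitz _ _))// dot_lipschitz.
  by apply: (mean_lim_oo UU ooU (bounded_cos_dot xi)); exact: cvgRe.
have SE : charS Q xi = - complex.Im (f xi).
  rewrite /charS (QE (fun v => sin (dot v xi)) _ K0 (bounded_sin_dot xi)); last first.
    by move=> u v; rewrite (le_trans (sin_lipschitz _ _))// dot_lipschitz.
  by apply: (mean_lim_oo UU ooU (bounded_sin_dot xi)); exact: cvgIm.
by rewrite CE SE opprK; case: (f xi).
Qed.

End closure.

(** * The gain operator on characteristic functions *)

Section bounded_fubini.
Context d1 d2 (T1 : measurableType d1) (T2 : measurableType d2) (R : realType).
Variables (m1 : {finite_measure set T1 -> \bar R}) (m2 : {finite_measure set T2 -> \bar R}).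
Variable K : T1 * T2 -> R.
Hypothesis bK : bounded_measurable K.

Let finite_lty d (T : measurableType d) (m : {finite_measure set T -> \bar R}) :
  (m setT < +oo)%E.
Proof. by rewrite -ge0_fin_numE// fin_num_measure. Qed.

Let iK : (m1 \x m2)%E.-integrable setT (EFin \o K).
Proof.
apply: integrable_bounded => //.
rewrite -setXTT [ltLHS](@product_measure1E _ _ _ _ R m1 m2)//.
by rewrite lte_mul_pinfty// ?fin_num_measure// finite_lty.
Qed.

Let bK1 x : bounded_measurable (fun y => K (x, y)).
Proof.
have [mK [M KM]] := bK; split; last by exists M => y; exact: KM.
by apply: (measurableT_comp mK); exact: measurable_fun_pair.
Qed.

Let bK2 y : bounded_measurable (fun x => K (x, y)).
Proof.
have [mK [M KM]] := bK; split; last by exists M => x; exact: KM.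
by apply: (measurableT_comp mK); exact: measurable_fun_pair.
Qed.

Lemma bounded_Fubini12 :
  \int[(m1 \x m2)%E]_z K z = \int[m1]_x \int[m2]_y K (x, y).
Proof.
rewrite {1}/Rintegral -[X in fine X](integral12_prod_meas1 iK); congr fine.
apply: eq_integral => x _; rewrite /fubini_F /Rintegral fineK//.
by apply: integrable_fin_num => //; apply: integrable_bounded => //; exact: finite_lty.
Qed.

Lemma bounded_Fubini21 :
  \int[(m1 \x m2)%E]_z K z = \int[m2]_y \int[m1]_x K (x, y).
Proof.
rewrite {1}/Rintegral -[X in fine X](integral21_prod_meas1 iK); congr fine.
apply: eq_integral => y _; rewrite /fubini_G /Rintegral fineK//.
by apply: integrable_fin_num => //; apply: integrable_bounded => //; exact: finite_lty.
Qed.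

End bounded_fubini.

Section gain.
Variable R : realType.
Local Notation R3 := (borelR3 R).
Local Notation T2 := (measurableTypeR R * measurableTypeR R)%type.
Local Notation surf := (@surface R).
Implicit Types (xi eta u : 'rV[R]_3) (f : 'rV[R]_3 -> R[i]).

Lemma dot_ge0 u : 0 <= dot u u.
Proof. by rewrite dotE -!expr2 !addr_ge0 ?sqr_ge0. Qed.

Lemma sqr_enorm u : enorm u ^+ 2 = dot u u.
Proof. by rewrite sqr_sqrtr// dot_ge0. Qed.

Lemma enorm_ge0 u : 0 <= enorm u. Proof. exact: sqrtr_ge0. Qed.

Lemma enorm_eq0 u : (enorm u == 0) = (u == 0).
Proof.
apply/eqP/eqP => [u0|->]; last by rewrite /enorm dotE !mxE !mul0r !addr0 sqrtr0.
have : dot u u = 0 by rewrite -sqr_enorm u0 expr0n.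
rewrite dotE -!expr2 => /eqP; rewrite !paddr_eq0 ?addr_ge0 ?sqr_ge0// !sqrf_eq0.
move=> /andP[/andP[/eqP h0 /eqP h1] /eqP h2]; apply/rowP => -[[|[|[|//]]] hi]; rewrite mxE.
- by rewrite -h0; congr (u _ _); exact/val_inj.
- by rewrite -h1; congr (u _ _); exact/val_inj.
- by rewrite -h2; congr (u _ _); exact/val_inj.
Qed.

Lemma enorm0 : enorm (0 : 'rV[R]_3) = 0. Proof. by apply/eqP; rewrite enorm_eq0. Qed.

Lemma enorm_gt0 u : (0 < enorm u) = (u != 0).
Proof. by rewrite lt_def enorm_ge0 andbT enorm_eq0. Qed.

(** The value at 0 is a unit vector as well, so that no case distinction is
    needed when integrating over the directions. *)
Definition direction u : 'rV[R]_3 := if u == 0 then e3 R else (enorm u)^-1 *: u.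

Lemma dot_direction u : dot (direction u) (direction u) = 1.
Proof.
rewrite /direction; case: eqVneq => [_|u0]; first exact: dot_e3.
by rewrite dotZl dotZr -sqr_enorm; field; rewrite enorm_eq0.
Qed.

Lemma direction_scale u : enorm u *: direction u = u.
Proof.
rewrite /direction; case: eqVneq => [->|u0]; first by rewrite enorm0 scale0r.
by rewrite scalerA divff ?scale1r// enorm_eq0.
Qed.

Lemma dot_enorm_direction u eta : dot u eta = enorm u * dot (direction u) eta.
Proof. by rewrite -dotZl direction_scale. Qed.

Variable beta : R -> R.
Hypotheses (bbeta : bounded_measurable beta) (beta_ge0 : forall x, 0 <= beta x).
Let gamma := \int[surf]_p beta (cos p.1).
Hypothesis gamma_gt0 : 0 < gamma.

Lemma gamma_zonal k : dot k k = 1 -> \int[surf]_p beta (sphere_dot k p) = gamma.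
Proof.
move=> k1; rewrite /Rintegral (zonal_ge0 k1 (F := fun x => (beta x)%:E))//.
by apply/measurable_EFinP; case: bbeta.
Qed.

Section collision.
Variable P : probability R3 R.

(** Two particles with velocities [z.1] and [z.2] collide; after the collision
    one of them has velocity [post], and the direction of scattering has density
    [rho] with respect to the surface measure. *)
Let half_diff (z : R3 * R3) : 'rV[R]_3 := 2^-1 *: ((z.1 : 'rV[R]_3) - z.2).
Let half_sum (z : R3 * R3) : 'rV[R]_3 := 2^-1 *: ((z.1 : 'rV[R]_3) + z.2).

Let post (z : (R3 * R3) * T2) : R3 :=
  half_sum z.1 + enorm (half_diff z.1) *: sphere_point z.2.

Let rho (z : (R3 * R3) * T2) : R := gamma^-1 * beta (sphere_dot (direction (half_diff z.1)) z.2).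

Lemma measurable_sphere_point i :
  measurable_fun setT (fun p : T2 => (sphere_point p : 'rV[R]_3) 0 i).
Proof.
have b1 := proj1 (bounded_measurable_sin1 R); have b2 := proj1 (bounded_measurable_sin2 R).
have c1 := proj1 (bounded_measurable_cos1 R); have c2 := proj1 (bounded_measurable_cos2 R).
case: i => -[|[|[|//]]] hi; under eq_fun do rewrite !mxE/=.
- exact: measurable_funM.
- exact: measurable_funM.
- exact: c1.
Qed.

Let mcoord1 i : measurable_fun setT (fun z : R3 * R3 => (z.1 : 'rV[R]_3) 0 i).
Proof. by apply: (measurableT_comp (measurable_coord i)). Qed.

Let mcoord2 i : measurable_fun setT (fun z : R3 * R3 => (z.2 : 'rV[R]_3) 0 i).
Proof. by apply: (measurableT_comp (measurable_coord i)). Qed.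

Let mdiff i : measurable_fun setT (fun z : R3 * R3 => half_diff z 0 i).
Proof.
under eq_fun do rewrite !mxE.
by apply: measurable_funM => //; exact: measurable_funB.
Qed.

Let msum i : measurable_fun setT (fun z : R3 * R3 => half_sum z 0 i).
Proof.
under eq_fun do rewrite !mxE.
by apply: measurable_funM => //; exact: measurable_funD.
Qed.

Let menorm : measurable_fun setT (fun z : R3 * R3 => enorm (half_diff z)).
Proof.
apply: (@measurableT_comp _ _ _ _ _ _ (@Num.sqrt R)).
  by apply: continuous_measurable_fun; exact: sqrt_continuous.
under eq_fun do rewrite dotE.
by repeat apply: measurable_funD; apply: measurable_funM.
Qed.

Let mdirection i : measurable_fun setT (fun z : R3 * R3 => direction (half_diff z) 0 i).
Proof.
have -> : (fun z : R3 * R3 => direction (half_diff z) 0 i) =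
  (fun z => if enorm (half_diff z) == 0 then e3 R 0 i else (enorm (half_diff z))^-1 * half_diff z 0 i).
  apply/funext => z; rewrite /direction enorm_eq0; case: ifP => // _.
  by rewrite mxE.
apply: measurable_fun_ifT; first by apply: measurable_fun_eqr.
  exact: measurable_cst.
apply: measurable_funM => //.
have -> : (fun z : R3 * R3 => (enorm (half_diff z))^-1) =
    (fun z => enorm (half_diff z) `^ (- 1)).
  by apply/funext => z; rewrite powR_inv1// enorm_ge0.
exact: (measurableT_comp (measurable_powR _) menorm).
Qed.

Let measurable_post : measurable_fun setT post.
Proof.
apply: measurable_to_borelR3 => i.
have -> : (fun z => (post z : 'rV[R]_3) 0 i) =
  (fun z : (R3 * R3) * T2 => half_sum z.1 0 i +
     enorm (half_diff z.1) * (sphere_point z.2 : 'rV[R]_3) 0 i).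
  by apply/funext => z; rewrite mxE [in RHS]/= mxE [X in _ + X]mxE.
apply: measurable_funD; first exact: (measurableT_comp (msum i)).
apply: measurable_funM; first exact: (measurableT_comp menorm).
exact: (measurableT_comp (measurable_sphere_point i)).
Qed.

Let measurable_sphere_dot_direction :
  measurable_fun setT (fun z : (R3 * R3) * T2 => sphere_dot (direction (half_diff z.1)) z.2).
Proof.
under eq_fun do rewrite -dot_sphere dotE.
by repeat apply: measurable_funD; apply: measurable_funM;
  (exact: (measurableT_comp (mdirection _)) ||
   exact: (measurableT_comp (measurable_sphere_point _))).
Qed.

Let bounded_rho : bounded_measurable rho.
Proof.
apply: bounded_measurableM; first exact: bounded_measurable_cst.
exact: (bounded_measurable_comp measurable_sphere_dot_direction bbeta).
Qed.

Let PP : probability (R3 * R3)%type R := (P \x P)%E.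

Let mu := (PP \x surf)%E.

Let integral_rho : (\int[mu]_z (rho z)%:E = 1)%E.
Proof.
have E : \int[mu]_z rho z = 1.
  rewrite (@bounded_Fubini12 _ _ _ _ R PP surf)//.
  rewrite -(mean_cst PP (1 : R)); apply: eq_Rintegral => z _.
  rewrite /rho/= RintegralZl//; last first.
    apply: integrable_bounded; first exact: surface_lty.
    apply: (bounded_measurable_comp (X := sphere_dot (direction (half_diff z)))) bbeta.
    by case: (bounded_measurable_sphere_dot (direction (half_diff z))).
  by rewrite gamma_zonal ?dot_direction// mulVf// gt_eqF.
rewrite -[LHS]fineK; first by rewrite -[fine _]/(\int[mu]_z rho z) E.
apply: integrable_fin_num => //; apply: integrable_bounded bounded_rho.
rewrite -setXTT [ltLHS](@product_measure1E _ _ _ _ R PP surf)//.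
rewrite lte_mul_pinfty// ?fin_num_measure//.
exact: surface_lty.
Qed.

(** Bobylev's identity: with [k] the direction of the relative velocity and [l]
    that of [xi], the left integrand is a function of [k.sigma] times one of
    [l.sigma], and the right one is obtained by exchanging [k] and [l]. *)
Let collision_swap (h : R -> R) xi (z : R3 * R3) : bounded_measurable h -> xi != 0 ->
  \int[surf]_p (h (dot (post (z, p)) xi) * rho (z, p)) =
  gamma^-1 * \int[surf]_p (beta (sphere_dot (direction xi) p) *
    h (dot (z.1 : 'rV[R]_3) (xi_plus xi (sphere_point p)) +
       dot (z.2 : 'rV[R]_3) (xi_minus xi (sphere_point p)))).
Proof.
move=> bh xi0; set k := direction (half_diff z); set l := direction xi.
set a := dot (half_sum z) xi; set c := enorm (half_diff z) * enorm xi.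
have bg : bounded_measurable (fun y => h (a + c * y)).
  apply: (bounded_measurable_comp (X := fun y => a + c * y)) bh.
  by apply: measurable_funD => //; exact: measurable_funM.
have bS u : bounded_measurable (fun p : T2 => beta (sphere_dot u p)).
  by apply: (bounded_measurable_comp (X := sphere_dot u)) bbeta; case: (bounded_measurable_sphere_dot u).
have bS' u : bounded_measurable (fun p : T2 => h (a + c * sphere_dot u p)).
  by apply: (bounded_measurable_comp (X := sphere_dot u)) bg; case: (bounded_measurable_sphere_dot u).
have E := surface_exchange (dot_direction (half_diff z)) (dot_direction xi) bbeta bg.
have postE p : dot (post (z, p)) xi = a + c * sphere_dot l p.
  rewrite /post/= dotDl dotZl -/a /c -mulrA -dot_sphere -dot_enorm_direction.
  by rewrite (dotC xi).
have preE p : dot (z.1 : 'rV[R]_3) (xi_plus xi (sphere_point p)) +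
       dot (z.2 : 'rV[R]_3) (xi_minus xi (sphere_point p)) = a + c * sphere_dot k p.
  rewrite /c (mulrC (enorm _)) -mulrA -dot_sphere -dot_enorm_direction /a /half_sum /half_diff.
  rewrite /xi_plus /xi_minus !dotE !mxE; ring.
rewrite -RintegralZl//; last first.
  apply: integrable_bounded; first exact: surface_lty.
  apply: bounded_measurableM => //.
  by under eq_fun do rewrite preE; exact: bS'.
transitivity (gamma^-1 * \int[surf]_p (beta (sphere_dot k p) * h (a + c * sphere_dot l p))).
  rewrite -RintegralZl//; last first.
    apply: integrable_bounded; first exact: surface_lty.
    exact: bounded_measurableM.
  by apply: eq_Rintegral => p _; rewrite postE /rho/= -/k; ring.
rewrite E -RintegralZl//; last first.
  apply: integrable_bounded; first exact: surface_lty.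
  exact: bounded_measurableM.
by apply: eq_Rintegral => p _; rewrite preE.
Qed.

Let mpre xi : measurable_fun setT (fun t : (R3 * R3) * T2 =>
  dot (t.1.1 : 'rV[R]_3) (xi_plus xi (sphere_point t.2)) +
  dot (t.1.2 : 'rV[R]_3) (xi_minus xi (sphere_point t.2))).
Proof.
have ms (a b : R) i : measurable_fun setT (fun t : (R3 * R3) * T2 =>
    a + b * (sphere_point t.2 : 'rV[R]_3) 0 i).
  apply: measurable_funD => //; apply: measurable_funM => //.
  exact: (measurableT_comp (measurable_sphere_point _)).
have m1 i : measurable_fun setT (fun t : (R3 * R3) * T2 => (t.1.1 : 'rV[R]_3) 0 i).
  exact: (measurableT_comp (mcoord1 i)).
have m2 i : measurable_fun setT (fun t : (R3 * R3) * T2 => (t.1.2 : 'rV[R]_3) 0 i).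
  exact: (measurableT_comp (mcoord2 i)).
have pE i (p : T2) : xi_plus xi (sphere_point p) 0 i =
    2^-1 * xi 0 i + enorm xi / 2 * (sphere_point p : 'rV[R]_3) 0 i.
  by rewrite /xi_plus mxE [X in X + _]mxE [X in _ + X]mxE.
have mE i (p : T2) : xi_minus xi (sphere_point p) 0 i =
    2^-1 * xi 0 i + (- (enorm xi / 2)) * (sphere_point p : 'rV[R]_3) 0 i.
  by rewrite /xi_minus mxE [X in X + _]mxE [X in _ + X]mxE [X in - X]mxE mulNr.
under eq_fun do rewrite !dotE !pE !mE.
by repeat apply: measurable_funD; apply: measurable_funM => //; exact: ms.
Qed.

Lemma collision_mean : exists Q : probability R3 R,
  forall (h : R -> R) xi, bounded_measurable h -> xi != 0 ->
  gamma * \int[Q]_v h (dot (v : 'rV[R]_3) xi) =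
  \int[surf]_p (beta (sphere_dot (direction xi) p) * \int[(P \x P)%E]_z h
    (dot (z.1 : 'rV[R]_3) (xi_plus xi (sphere_point p)) +
       dot (z.2 : 'rV[R]_3) (xi_minus xi (sphere_point p)))).
Proof.
have rho_ge0 t : 0 <= rho t.
  by rewrite mulr_ge0// invr_ge0 ltW.
have [Q QE] := weighted_law (proj1 bounded_rho) rho_ge0 integral_rho measurable_post.
exists Q => h xi bh xi0.
have bhd : bounded_measurable (fun v : R3 => h (dot (v : 'rV[R]_3) xi)).
  exact: (bounded_measurable_comp (measurable_dotl xi) bh).
rewrite QE// (@bounded_Fubini12 _ _ _ _ R PP surf); last first.
  by apply: bounded_measurableM => //; exact: (bounded_measurable_comp measurable_post bhd).
under eq_Rintegral do rewrite collision_swap//.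
pose K (t : (R3 * R3) * T2) := beta (sphere_dot (direction xi) t.2) *
  h (dot (t.1.1 : 'rV[R]_3) (xi_plus xi (sphere_point t.2)) +
     dot (t.1.2 : 'rV[R]_3) (xi_minus xi (sphere_point t.2))).
have bh2 : bounded_measurable (fun t : (R3 * R3) * T2 =>
    h (dot (t.1.1 : 'rV[R]_3) (xi_plus xi (sphere_point t.2)) +
     dot (t.1.2 : 'rV[R]_3) (xi_minus xi (sphere_point t.2)))).
  exact: (bounded_measurable_comp (mpre xi) bh).
have bK : bounded_measurable K.
  apply: bounded_measurableM => //.
  apply: (bounded_measurable_comp (X := fun t : (R3 * R3) * T2 => sphere_dot (direction xi) t.2)) bbeta.
  by apply: (measurableT_comp (proj1 (bounded_measurable_sphere_dot (direction xi)))).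
have F12 := @bounded_Fubini12 _ _ _ _ R PP surf K bK.
have F21 := @bounded_Fubini21 _ _ _ _ R PP surf K bK.
have iin : PP.-integrable setT (EFin \o (fun z => \int[surf]_p K (z, p))).
  have iK : (PP \x surf)%E.-integrable setT (EFin \o K).
    apply: integrable_bounded bK.
    rewrite -setXTT [ltLHS](@product_measure1E _ _ _ _ R PP surf)//.
    by rewrite lte_mul_pinfty// ?fin_num_measure//; exact: surface_lty.
  have := integrable_fubini_F iK; apply: eq_integrable => // z _.
  rewrite /fubini_F /Rintegral /= fineK//; apply: integrable_fin_num => //.
  apply: (integrable_bounded (f := fun p => K (z, p))); first exact: surface_lty.
  have [mK [M KM]] := bK; split; last by exists M => p; exact: KM.
  by apply: (measurableT_comp mK); exact: measurable_fun_pair.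
rewrite RintegralZl// mulrA divff ?gt_eqF// mul1r -F12 F21.
apply: eq_Rintegral => p _; rewrite /K/= meanZ//.
have [m2 [M hM]] := bh2; split; last by exists M => z; exact: (hM (z, p)).
by apply: (measurableT_comp m2 (measurable_fun_pair (@measurable_id _ _ setT) (measurable_cst p))).
Qed.

Lemma mean_cos_sum (a b : 'rV[R]_3) :
  \int[(P \x P)%E]_z cos (dot (z.1 : 'rV[R]_3) a + dot (z.2 : 'rV[R]_3) b) =
  charC P a * charC P b - charS P a * charS P b.
Proof.
have bZ c g : bounded_measurable g -> bounded_measurable (fun v : R3 => c * g v).
  by move=> bg; apply: bounded_measurableM => //; exact: bounded_measurable_cst.
have bC := bounded_cos_dot; have bS := bounded_sin_dot.
have bK : bounded_measurable (fun z : R3 * R3 =>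
    cos (dot (z.1 : 'rV[R]_3) a + dot (z.2 : 'rV[R]_3) b)).
  apply: bounded_measurable_cos; apply: measurable_funD.
    exact: (measurableT_comp (measurable_dotl a)).
  exact: (measurableT_comp (measurable_dotl b)).
rewrite (@bounded_Fubini12 _ _ _ _ R P P)//.
transitivity (\int[P]_v (charC P b * cos (dot (v : 'rV[R]_3) a) +
    (- charS P b) * sin (dot (v : 'rV[R]_3) a))).
  apply: eq_Rintegral => v _ /=.
  transitivity (\int[P]_w (cos (dot (v : 'rV[R]_3) a) * cos (dot (w : 'rV[R]_3) b) +
      (- sin (dot (v : 'rV[R]_3) a)) * sin (dot (w : 'rV[R]_3) b))).
    by apply: eq_Rintegral => w _; rewrite cosD; ring.
  rewrite meanD; [|exact: bZ|exact: bZ].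
  by rewrite !meanZ// -/(charC P b) -/(charS P b); ring.
rewrite meanD; [|exact: bZ|exact: bZ].
by rewrite !meanZ// -/(charC P a) -/(charS P a); ring.
Qed.

Lemma mean_sin_sum (a b : 'rV[R]_3) :
  \int[(P \x P)%E]_z sin (dot (z.1 : 'rV[R]_3) a + dot (z.2 : 'rV[R]_3) b) =
  charS P a * charC P b + charC P a * charS P b.
Proof.
have bZ c g : bounded_measurable g -> bounded_measurable (fun v : R3 => c * g v).
  by move=> bg; apply: bounded_measurableM => //; exact: bounded_measurable_cst.
have bC := bounded_cos_dot; have bS := bounded_sin_dot.
have bK : bounded_measurable (fun z : R3 * R3 =>
    sin (dot (z.1 : 'rV[R]_3) a + dot (z.2 : 'rV[R]_3) b)).
  apply: bounded_measurable_sin; apply: measurable_funD.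
    exact: (measurableT_comp (measurable_dotl a)).
  exact: (measurableT_comp (measurable_dotl b)).
rewrite (@bounded_Fubini12 _ _ _ _ R P P)//.
transitivity (\int[P]_v (charC P b * sin (dot (v : 'rV[R]_3) a) +
    charS P b * cos (dot (v : 'rV[R]_3) a))).
  apply: eq_Rintegral => v _ /=.
  transitivity (\int[P]_w (sin (dot (v : 'rV[R]_3) a) * cos (dot (w : 'rV[R]_3) b) +
      ( cos (dot (v : 'rV[R]_3) a)) * sin (dot (w : 'rV[R]_3) b))).
    by apply: eq_Rintegral => w _; rewrite sinD; ring.
  rewrite meanD; [|exact: bZ|exact: bZ].
  by rewrite !meanZ// -/(charC P b) -/(charS P b); ring.
rewrite meanD; [|exact: bZ|exact: bZ].
by rewrite !meanZ// -/(charC P a) -/(charS P a); ring.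
Qed.

End collision.

Definition surface_cintegral (F : T2 -> R[i]) : R[i] :=
  (\int[surf]_p complex.Re (F p)) +i* (\int[surf]_p complex.Im (F p)).

Lemma Re_realM (r : R) (z : R[i]) : complex.Re (r%:C * z) = r * complex.Re z.
Proof. by case: z => a b /=; rewrite mul0r subr0. Qed.

Lemma Im_realM (r : R) (z : R[i]) : complex.Im (r%:C * z) = r * complex.Im z.
Proof. by case: z => a b /=; rewrite mul0r addr0. Qed.

Definition gain f xi : R[i] := surface_cintegral (fun p : T2 =>
  (beta (sphere_dot (direction xi) p))%:C *
  (f (xi_plus xi (sphere_point p)) * f (xi_minus xi (sphere_point p)))).

(** The characteristic function of the velocity after the collision of two
    independent particles, whose joint law factorizes under the integral. *)
Theorem gain_char_fun f : is_char_fun f ->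
  exists2 g, is_char_fun g & forall xi, xi != 0 -> gain f xi = gamma%:C * g xi.
Proof.
move=> /is_char_funP[P fE]; have [Q QE] := collision_mean P.
exists (fun xi => (charC Q xi) +i* (- charS Q xi)).
  by apply/is_char_funP; exists Q.
move=> xi xi0; rewrite /gain /surface_cintegral.
have bc : bounded_measurable (cos : R -> R).
  by apply: (bounded_measurable_cos (X := id)).
have bs : bounded_measurable (sin : R -> R).
  by apply: (bounded_measurable_sin (X := id)).
have bns : bounded_measurable (fun x : R => - 1 * sin x).
  by apply: bounded_measurableM => //; exact: bounded_measurable_cst.
have EC := QE cos xi bc xi0; have ES := QE _ xi bns xi0.
apply/eqP; rewrite eq_complex; apply/andP; split; apply/eqP.
  rewrite Re_realM /= [RHS]EC; apply: eq_Rintegral => p _.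
  by rewrite Re_realM !fE /= mean_cos_sum mulrNN.
rewrite Im_realM /= -mulN1r -meanZ; last exact: bounded_sin_dot.
rewrite [RHS]ES; apply: eq_Rintegral => p _.
rewrite Im_realM !fE /= (@meanZ _ _ _ (P \x P)%E) ?mean_sin_sum; first by congr (_ * _); ring.
apply: bounded_measurable_sin; apply: measurable_funD.
  exact: (measurableT_comp (measurable_dotl _)).
exact: (measurableT_comp (measurable_dotl _)).
Qed.

End gain.

(** * Integrability of the singular kernel *)

Section kernel_integrability.
Variable R : realType.
Local Notation leb := (@lebesgue_measure R).
Local Notation T2 := (measurableTypeR R * measurableTypeR R)%type.
Local Notation surf := (@surface R).

(** Monotone convergence on [c / (n+2), c], with the primitive [x^e / e]. *)
Lemma integral_powR_lty (e c : R) : 0 < e -> 0 < c ->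
  (\int[leb]_(x in `]0%R, c]) (x `^ (e - 1))%:E < +oo)%E.
Proof.
move=> e0 c0.
pose F n : set R := `[c / n.+2%:R, c]%classic.
have cn n : 0 < c / n.+2%:R by rewrite divr_gt0.
have FE : `]0, c]%classic = \bigcup_n F n.
  apply/seteqP; split => [x|x [n _]]; rewrite /F /= !in_itv/=; last first.
    by move=> /andP[cx ->]; rewrite (lt_le_trans _ cx).
  move=> /andP[x0 xc]; exists (Num.truncn (c / x)) => //=; rewrite in_itv/= xc andbT.
  rewrite ler_pdivrMr// mulrC -ler_pdivrMr// ltW//.
  by rewrite (lt_trans (truncnS_gt _))// ltr_nat.
have mpow A : measurable_fun A (fun x : R => (x `^ (e - 1))%:E).
  by apply/measurable_EFinP; apply: measurable_funTS; exact: measurable_powR.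
rewrite FE.
have cvg : (\int[leb]_(x in F i) (x `^ (e - 1))%:E @[i --> \oo] -->
    \int[leb]_(x in \bigcup_i F i) (x `^ (e - 1))%:E)%E.
  apply: ge0_nondecreasing_set_cvg_integral => //.
  - apply/nondecreasing_seqP => n; rewrite subsetEset => x /=; rewrite /F /= !in_itv/= => /andP[h ->].
    by rewrite andbT (le_trans _ h)// ler_pM2l// lef_pV2 ?posrE// ler_nat.
  - by move=> i; exact: measurable_itv.
  - by move=> i; exact: mpow.
  - by move=> i x _; rewrite lee_fin powR_ge0.
suff H : (\int[leb]_(x in \bigcup_i F i) (x `^ (e - 1))%:E <= (c `^ e / e)%:E)%E.
  by rewrite (le_lt_trans H)// ltry.
rewrite -(cvg_lim _ cvg)//=.
apply: lime_le; first by apply/cvg_ex; eexists; exact: cvg.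
apply: nearW => n.
have dF (x : R) : 0 < x -> is_derive x (1 : R) (fun y => e^-1 * y `^ e) (x `^ (e - 1)).
  move=> x0.
  have -> : x `^ (e - 1) = 0 * x `^ e + e^-1 * (e * x `^ (e - 1)).
    by rewrite mul0r add0r mulrA mulVf ?mul1r// gt_eqF.
  exact: (is_derive_mulfun (is_derive_cst_fun x e^-1) (is_derive1_powR e x0)).
have dp (x : R) : 0 < x -> {for x, continuous (fun y : R => y `^ (e - 1))}.
  move=> x0; apply: differentiable_continuous; apply/derivable1_diffP.
  by have [] := @is_derive1_powR R (e - 1) x x0.
have dc (x : R) : 0 < x -> {for x, continuous (fun y : R => e^-1 * y `^ e)}.
  move=> x0; apply: differentiable_continuous; apply/derivable1_diffP.
  by have [] := dF _ x0.
have lt : c / n.+2%:R < c by rewrite ltr_pdivrMr// ltr_pMr// ltr1n.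
rewrite /F (@continuous_FTC2 _ _ (fun y => e^-1 * y `^ e))//.
- rewrite -EFinB lee_fin mulrC lerBlDr lerDl mulr_ge0 ?powR_ge0// invr_ge0 ltW//.
- apply: continuous_in_subspaceT => x /set_mem/=; rewrite in_itv/= => /andP[h _].
  by apply: dp; rewrite (lt_le_trans _ h).
- split.
  + by move=> x; rewrite in_itv/= => /andP[h _]; have [] := dF x (lt_trans (cn n) h).
  + by apply: cvg_at_right_filter; exact: dc.
  + by apply: cvg_at_left_filter; exact: dc.
- move=> x; rewrite in_itv/= => /andP[h _]; rewrite derive1E.
  by have [_] := dF x (lt_trans (cn n) h).
Qed.

(** For positive [kappa] this is [ln z < z] at [z = a y / kappa]. *)
Lemma powR_le_expR (kappa a y0 : R) : 0 < a -> 0 < y0 ->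
  exists2 C, 0 <= C & forall y, y0 <= y -> y `^ kappa <= C * expR (a * y).
Proof.
move=> a0 y00; have [k0|k0] := lerP kappa 0.
  exists (y0 `^ kappa) => [|y yy0]; first exact: powR_ge0.
  have y1 : 0 < y by rewrite (lt_le_trans y00).
  rewrite -[leLHS]mulr1 ler_pM ?powR_ge0//; last first.
    by rewrite -expR0 ler_expR mulr_ge0 ?ltW.
  rewrite /powR !gt_eqF// ler_expR ler_wnM2l// ler_ln//.
exists (expR (- (kappa * ln (a / kappa)))) => [|y yy0]; first exact: expR_ge0.
have y1 : 0 < y by rewrite (lt_le_trans y00).
rewrite /powR gt_eqF// -expRD ler_expR.
have ak : 0 < a / kappa by rewrite divr_gt0.
have : kappa * ln (a / kappa * y) <= kappa * (a / kappa * y).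
  by rewrite ler_pM2l// ltW// ln_sublinear// mulr_gt0.
rewrite lnM ?posrE// mulrDr mulrA (mulrC a) mulrA mulfV ?mul1r ?gt_eqF// => h.
by rewrite addrC lerBrDl.
Qed.

(** The extension by 0 makes the kernel a nonnegative measurable function on the
    line.  At 1 the collision integrand vanishes, see [integrandE] below. *)
Definition kernel_ext (b : R -> R) (x : R) : R :=
  if (-1 <= x) && (x < 1) then b x else 0.

(** As functions of [cos theta], these are the squares of [sin (theta / 2)] and
    [cos (theta / 2)], see [half_sin2_cos] and [half_cos2_cos]. *)
Definition half_sin2 (x : R) : R := (1 - x) / 2.
Definition half_cos2 (x : R) : R := (1 + x) / 2.

Lemma measurable_kernel_ext b : collision_kernel b ->
  measurable_fun setT (kernel_ext b).
Proof.
case=> mb _ _.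
have -> : kernel_ext b = b \_ `[-1, 1[%classic.
  apply/funext => x; rewrite patchE /kernel_ext mem_setE.
  by rewrite in_itv/=.
by apply/(measurable_restrictT b) => //; exact: measurable_itv.
Qed.

Lemma kernel_ext_ge0 b x : collision_kernel b -> 0 <= kernel_ext b x.
Proof. by case=> _ b0 _; rewrite /kernel_ext; case: ifP => // /b0. Qed.

Lemma half_sin2_cos x : half_sin2 (cos x) = sin (x / 2) ^+ 2.
Proof.
rewrite /half_sin2 [in LHS](splitr x) cosD -!expr2 [in LHS]cos2sin2.
by field.
Qed.

Lemma half_cos2_cos x : half_cos2 (cos x) = cos (x / 2) ^+ 2.
Proof.
rewrite /half_cos2 [in LHS](splitr x) cosD -!expr2 [in LHS]sin2cos2.
by field.
Qed.

Lemma measurable_half_sin2_pow a : measurable_fun setT (fun x => half_sin2 x `^ a).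
Proof.
apply: (measurableT_comp (measurable_powR a)).
by apply: measurable_funM => //; exact: measurable_funB.
Qed.

Lemma measurable_half_cos2_pow a : measurable_fun setT (fun x => half_cos2 x `^ a).
Proof.
apply: (measurableT_comp (measurable_powR a)).
by apply: measurable_funM => //; exact: measurable_funD.
Qed.

Lemma cos_lt0_pihalf (x : R) : pi / 2 < x -> x <= pi -> cos x < 0.
Proof.
move=> h1 h2.
have -> : x = (x - pi) + pi by rewrite subrK.
rewrite cosDpi oppr_lt0; apply: cos_gt0_pihalf.
by have := pi_gt0 R; lra.
Qed.

Section debye_yukawa.
Variables (s : R) (b : R -> R).
Hypotheses (b_kernel : collision_kernel b) (b_singular : debye_yukawa s b).

(** With [L = ln (2 / theta)], a power of [L] is at most a constant times
    [exp (a L)], that is [theta ^ (- a)]; the weight contributes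
    [theta ^ (2 a)], the kernel [theta ^ -2] and the area element [theta]. *)
Lemma grazing_bound a : 0 < a -> exists theta0 C, [/\ 0 < theta0 < pi / 2, 0 <= C,
  (forall x, 0 < x <= theta0 ->
   kernel_ext b (cos x) * half_sin2 (cos x) `^ a * sin x <= C * x `^ (a - 1)) &
  leb.-integrable `[theta0, pi / 2]%classic (fun x => (b (cos x) * sin x)%:E)].
Proof.
move=> a0; have [theta0 [th0 [c [C [c0 C0 bC]] ib]]] := b_singular.
have [t0 tpi] := andP th0.
have t2 : theta0 < 2 := lt_trans tpi (pihalf_lt2 R).
have L0 : 0 < ln ((theta0 / 2)^-1).
  by apply: ln_gt0; rewrite invf_gt1 ?divr_gt0// ltr_pdivrMr// mul1r.
have [K K0 LK] := powR_le_expR (2 / s - 1) a0 L0.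
exists theta0, (C * K * 2 `^ a); split => //; first by rewrite !mulr_ge0 ?powR_ge0// ltW.
move=> x xt; have [x0 xth] := andP xt.
have xpi : x < pi by have := pi_gt0 R; lra.
have sx : 0 <= sin x by apply: sin_ge0_pi; rewrite !ltW.
have sxx : sin x <= x.
  by have := sin_lipschitz x 0; rewrite sin0 !subr0 (ger0_norm (ltW x0)); apply: le_trans; exact: ler_norm.
have cx1 : cos x < 1.
  by rewrite -cos0 ltr_cos ?in_itv/= ?lexx ?pi_ge0// !ltW.
have -> : kernel_ext b (cos x) = b (cos x) by rewrite /kernel_ext cos_geN1 cx1.
have Lx : ln ((theta0 / 2)^-1) <= ln ((x / 2)^-1).
  rewrite ler_ln ?posrE ?invr_gt0 ?divr_gt0// lef_pV2 ?posrE ?divr_gt0//.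
  by rewrite ler_pM2r// invr_gt0.
set Y := ln ((x / 2)^-1) in Lx *.
have Yk : 0 < Y `^ (2 / s - 1) by rewrite powR_gt0// (lt_le_trans L0).
have bx : b (cos x) <= C * (x ^- 2 * (K * (2 `^ a * x `^ (- a)))).
  have [_] := andP (bC x xt); rewrite ler_pdivrMr; last by rewrite mulr_gt0// invr_gt0 exprn_gt0.
  move=> h; rewrite (le_trans h)// ler_pM2l// ler_pM2l ?invr_gt0 ?exprn_gt0//.
  rewrite (le_trans (LK _ Lx))// ler_wpM2l// /Y lnV ?posrE ?divr_gt0//.
  rewrite mulrN -mulNr -ln_powR lnK ?posrE ?powR_gt0 ?divr_gt0//.
  by rewrite powRM ?invr_ge0// ?(ltW x0)// -(powR_inv1 (a := 2))// -powRrM mulN1r opprK mulrC.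
have s2 : half_sin2 (cos x) `^ a <= x `^ a * x `^ a.
  rewrite half_sin2_cos -powRM ?(ltW x0)// ge0_ler_powR ?(ltW a0)// ?nnegrE ?sqr_ge0 ?mulr_ge0 ?(ltW x0)//.
  have h1 : `|sin (x / 2)| <= x.
    by have := sin_lipschitz (x / 2) 0; rewrite sin0 !subr0 [X in _ <= X]ger0_norm; [move=> h; lra|lra].
  by rewrite -expr2 -(real_normK (num_real (sin _))) lerXn2r// nnegrE// ltW.
have bx0 : 0 <= b (cos x) by case: b_kernel => _ + _; apply; rewrite cos_geN1 cx1.
apply: le_trans (_ : C * (x ^- 2 * (K * (2 `^ a * x `^ (- a)))) * (x `^ a * x `^ a) * x <= _).
  by rewrite ler_pM ?mulr_ge0 ?powR_ge0// ler_pM ?powR_ge0.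
have xn : x != 0 by rewrite gt_eqF.
rewrite powRN -[a - 1]/(a + -1) powRD ?xn ?implybT// powR_inv1 ?(ltW x0)//.
rewrite le_eqVlt; apply/orP; left; apply/eqP.
have xa : x `^ a != 0 by rewrite gt_eqF// powR_gt0.
by field; rewrite xn xa.
Qed.

(** Small angles are handled by [grazing_bound], angles between [theta0] and
    [pi / 2] by the integrability assumption, and the kernel vanishes beyond. *)
Lemma kernel_weight_lty a : 0 < a ->
  (\int[surf]_p (kernel_ext b (cos p.1) * half_sin2 (cos p.1) `^ a)%:E < +oo)%E.
Proof.
move=> a0; have [t0 [C [/andP[t00 tpi] C0 gb ib]]] := grazing_bound a0.
pose F x := kernel_ext b x * half_sin2 x `^ a.
have F0 x : 0 <= F x by rewrite mulr_ge0 ?powR_ge0// kernel_ext_ge0.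
have mF : measurable_fun setT F.
  by apply: measurable_funM; [exact: measurable_kernel_ext|exact: measurable_half_sin2_pow].
rewrite (surface_cos_ge0 mF F0).
pose h1 x : \bar R := (C%:E * (x `^ (a - 1))%:E)%E.
pose h2 x : \bar R := `|(b (cos x) * sin x)%:E|%E.
have h10 x : (0 <= h1 x)%E by rewrite mule_ge0 ?lee_fin ?powR_ge0.
have h20 x : (0 <= h2 x)%E by exact: abse_ge0.
have D1 : measurable (`]0, t0]%classic : set (measurableTypeR R)) by exact: measurable_itv.
have D2 : measurable (`[t0, pi / 2]%classic : set (measurableTypeR R)) by exact: measurable_itv.
have mh1 : measurable_fun setT (h1 \_ `]0, t0]).
  apply/(measurable_restrictT h1) => //; apply: measurable_funTS.
  apply/measurable_EFinP; apply: measurable_funM => //; exact: measurable_powR.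
have mh2 : measurable_fun setT (h2 \_ `[t0, pi / 2]).
  apply/(measurable_restrictT h2) => //.
  by apply: measurableT_comp => //; case/integrableP: ib.
have i1 : (\int[leb]_(x in `]0%R, t0]) h1 x < +oo)%E.
  rewrite /h1 ge0_integralZl//.
  - by rewrite lte_mul_pinfty// integral_powR_lty.
  - apply: measurable_funTS; apply/measurable_EFinP; exact: measurable_powR.
  - by move=> x _; rewrite lee_fin powR_ge0.
have i2 : (\int[leb]_(x in `[t0, (pi / 2)%R]) h2 x < +oo)%E by case/integrableP: ib.
rewrite lte_mul_pinfty ?lee_fin ?mulr_ge0 ?pi_ge0//.
have : (\int[leb]_(x in `]0%R, t0]) h1 x + \int[leb]_(x in `[t0, (pi / 2)%R]) h2 x < +oo)%E.
  exact: lte_add_pinfty.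
apply: le_lt_trans.
rewrite [X in (_ <= X + _)%E]integral_mkcond [X in (_ <= _ + X)%E]integral_mkcond.
rewrite [X in (X <= _)%E]integral_mkcond -ge0_integralD//; last 2 first.
- by move=> x _; exact: erestrict_ge0.
- by move=> x _; exact: erestrict_ge0.
apply: ge0_le_integral => //.
- move=> x _; apply: erestrict_ge0 => y; rewrite /= in_itv/= => yI.
  by rewrite lee_fin mulr_ge0 ?F0// sin_ge0_pi.
- apply/(measurable_restrictT (fun x => (F (cos x) * sin x)%:E)); first exact: measurable_itv.
  apply: measurable_funTS; apply/measurable_EFinP; apply: measurable_funM.
    apply: measurableT_comp mF _; apply: continuous_measurable_fun; exact: continuous_cos.
  by apply: continuous_measurable_fun; exact: continuous_sin.
- exact: emeasurable_funD.
move=> x _; rewrite !patchE !mem_setE !in_itv/=.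
have [/andP[x0 xpi]|] := boolP (_ && _); last first.
  by move=> _; rewrite adde_ge0//; case: ifP.
have R10 : (0 <= (if (0 < x)%R && (x <= t0)%R then h1 x else 0%E))%E by case: ifP.
have R20 : (0 <= (if (t0 <= x)%R && (x <= pi / 2)%R then h2 x else 0%E))%E by case: ifP.
have sx : 0 <= sin x by apply: sin_ge0_pi; rewrite x0.
have [x00|xn0] := eqVneq x 0.
  have -> : F (cos x) * sin x = 0 by rewrite x00 sin0 mulr0.
  exact: adde_ge0.
have {}x0 : 0 < x by rewrite lt_def xn0.
have cx1 : cos x < 1.
  by rewrite -cos0 ltr_cos ?in_itv/= ?lexx ?pi_ge0// ?(ltW x0).
have [xt|xt] := lerP x t0.
  rewrite x0/= -[leLHS]adde0 leeD// /h1 -EFinM lee_fin /F.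
  by apply: gb; rewrite x0.
have [xp|xp] := lerP x (pi / 2).
  rewrite (ltW xt)/= -[leLHS]add0e leeD// /h2.
    by case: ifP.
  rewrite lee_fin /F.
  have bE : kernel_ext b (cos x) = b (cos x) by rewrite /kernel_ext cos_geN1 cx1.
  rewrite bE; have := kernel_ext_ge0 (cos x) b_kernel; rewrite bE => bx.
  rewrite (le_trans _ (ler_norm _))// ler_wpM2r// -[leRHS]mulr1 ler_wpM2l//.
  rewrite -[leRHS](congr1 (@^~ a) (powR1 R)) ge0_ler_powR ?nnegrE ?(ltW a0)//.
    by rewrite half_sin2_cos sqr_ge0.
  by rewrite /half_sin2 ler_pdivrMr// mul1r lerBlDl -lerBlDr; have := cos_geN1 x; lra.
have cn := cos_lt0_pihalf xp xpi.
have -> : F (cos x) * sin x = 0.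
  have [_ _ bs] := b_kernel.
  by rewrite /F /kernel_ext cos_geN1 cx1/= bs ?mul0r// cos_geN1.
by rewrite adde_ge0//; case: ifP.
Qed.

End debye_yukawa.
End kernel_integrability.

(** * Complex integrals on the sphere with zonal weights *)

Section surface_complex.
Variable R : realType.
Local Notation R3 := (borelR3 R).
Local Notation T2 := (measurableTypeR R * measurableTypeR R)%type.
Local Notation surf := (@surface R).
Implicit Types (xi eta k : 'rV[R]_3) (f g : 'rV[R]_3 -> R[i]) (w : R -> R).

Definition zonal_mass w : R := \int[surf]_p w (cos p.1).

(** Densities in [k.sigma] of finite mass; by symmetry the mass is the same for
    all axes [k], and it is written with the polar axis. *)
Record zonal_weight w : Prop := ZonalWeight {
  zonal_weight_measurable : measurable_fun setT w;
  zonal_weight_ge0 : forall x, 0 <= w x;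
  zonal_weight_lty : (\int[surf]_p (w (cos p.1))%:E < +oo)%E }.

Lemma zonal_mass_ge0 w : zonal_weight w -> 0 <= zonal_mass w.
Proof. by case=> _ w0 _; apply: Rintegral_ge0. Qed.

Lemma zonal_weight_bounded w : bounded_measurable w -> (forall x, 0 <= w x) ->
  zonal_weight w.
Proof.
move=> bw w0; split => //; first by case: bw.
have bwc : bounded_measurable (fun p : T2 => w (cos p.1)).
  by apply: (bounded_measurable_comp (X := fun p : T2 => cos p.1)) bw; case: (bounded_measurable_cos1 R).
by have := integrable_lty measurableT (integrable_bounded (surface_lty R) bwc).
Qed.

Lemma zonal_weight_integrable k w : dot k k = 1 -> zonal_weight w ->
  surf.-integrable setT (EFin \o (fun p : T2 => w (sphere_dot k p))).
Proof.
move=> k1 [mw w0 woo]; have mk := proj1 (bounded_measurable_sphere_dot k).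
apply/integrableP; split.
  by apply/measurable_EFinP; exact: (measurableT_comp mw mk).
under eq_integral do rewrite /= ger0_norm//.
by rewrite (zonal_ge0 k1 (F := fun x => (w x)%:E))//; exact/measurable_EFinP.
Qed.

Lemma zonal_mass_sphere_dot k w : dot k k = 1 -> zonal_weight w ->
  \int[surf]_p w (sphere_dot k p) = zonal_mass w.
Proof.
move=> k1 [mw w0 woo]; rewrite /zonal_mass /Rintegral.
by rewrite (zonal_ge0 k1 (F := fun x => (w x)%:E))//; exact/measurable_EFinP.
Qed.

Lemma zonal_weightD w1 w2 : zonal_weight w1 -> zonal_weight w2 ->
  zonal_weight (fun x => w1 x + w2 x).
Proof.
move=> [m1 p1 i1] [m2 p2 i2]; have mc := proj1 (bounded_measurable_cos1 R); split.
- exact: measurable_funD.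
- by move=> x; rewrite addr_ge0.
under eq_integral do rewrite EFinD.
rewrite ge0_integralD//; first exact: lte_add_pinfty.
- by move=> p _; rewrite lee_fin.
- by apply/measurable_EFinP; exact: (measurableT_comp m1 mc).
- by move=> p _; rewrite lee_fin.
- by apply/measurable_EFinP; exact: (measurableT_comp m2 mc).
Qed.

Lemma zonal_weight_le w1 w2 : measurable_fun setT w1 -> (forall x, 0 <= w1 x) ->
  zonal_weight w2 -> (forall x, `|x| <= 1 -> w1 x <= w2 x) -> zonal_weight w1.
Proof.
move=> m1 p1 [m2 p2 i2] w12; have mc := proj1 (bounded_measurable_cos1 R); split=> //.
apply: le_lt_trans i2; apply: ge0_le_integral => //; first
  [ by apply/measurable_EFinP; exact: (measurableT_comp m1 mc)
  | by apply/measurable_EFinP; exact: (measurableT_comp m2 mc)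
  | by move=> p _; rewrite lee_fin w12// ler_norml cos_geN1 cos_le1
  | by move=> p _; rewrite lee_fin].
Qed.

Lemma zonal_cos_integrable w : zonal_weight w ->
  surf.-integrable setT (EFin \o (fun p : T2 => w (cos p.1))).
Proof.
move=> ww; have := zonal_weight_integrable (dot_e3 R) ww.
apply: eq_integrable => // p _ /=.
by rewrite sphere_dot_e3.
Qed.

Lemma le_zonal_mass w1 w2 : zonal_weight w1 -> zonal_weight w2 ->
  (forall x, `|x| <= 1 -> w1 x <= w2 x) -> zonal_mass w1 <= zonal_mass w2.
Proof.
move=> z1 z2 w12; apply: le_Rintegral => //; try exact: zonal_cos_integrable.
by move=> p _; rewrite w12// ler_norml cos_geN1 cos_le1.
Qed.

Definition surface_integrable (F : T2 -> R[i]) :=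
  surf.-integrable setT (fun p => (complex.Re (F p))%:E) /\
  surf.-integrable setT (fun p => (complex.Im (F p))%:E).

Definition bounded_complex (F : T2 -> R[i]) :=
  bounded_measurable (fun p => complex.Re (F p)) /\
  bounded_measurable (fun p => complex.Im (F p)).

Lemma bounded_complexM F G : bounded_complex F -> bounded_complex G ->
  bounded_complex (fun p => F p * G p).
Proof.
move=> [rF iF] [rG iG].
have E p : complex.Re (F p * G p) =
    complex.Re (F p) * complex.Re (G p) - complex.Im (F p) * complex.Im (G p).
  by case: (F p) (G p) => [a b] [c d].
have E' p : complex.Im (F p * G p) =
    complex.Re (F p) * complex.Im (G p) + complex.Im (F p) * complex.Re (G p).
  by case: (F p) (G p) => [a b] [c d].
split.
  under eq_fun do rewrite E.
  by apply: bounded_measurableB; exact: bounded_measurableM.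
under eq_fun do rewrite E'.
by apply: bounded_measurableD; exact: bounded_measurableM.
Qed.

Lemma ReB (z1 z2 : R[i]) : complex.Re (z1 - z2) = complex.Re z1 - complex.Re z2.
Proof. by case: z1 z2 => [a b] [c d]. Qed.
Lemma ImB (z1 z2 : R[i]) : complex.Im (z1 - z2) = complex.Im z1 - complex.Im z2.
Proof. by case: z1 z2 => [a b] [c d]. Qed.

Lemma bounded_complexB F G : bounded_complex F -> bounded_complex G ->
  bounded_complex (fun p => F p - G p).
Proof.
move=> [rF iF] [rG iG]; split.
  by under eq_fun do rewrite ReB; exact: bounded_measurableB.
by under eq_fun do rewrite ImB; exact: bounded_measurableB.
Qed.

Lemma bounded_complex_cst (c : R[i]) : bounded_complex (fun=> c).
Proof. by split; exact: bounded_measurable_cst. Qed.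

Lemma surface_cintegralB F G : surface_integrable F -> surface_integrable G ->
  surface_cintegral (fun p => F p - G p) = surface_cintegral F - surface_cintegral G.
Proof.
move=> [rF iF] [rG iG]; rewrite /surface_cintegral.
under eq_Rintegral do rewrite ReB.
under [X in _ +i* X = _]eq_Rintegral do rewrite ImB.
by rewrite !RintegralB.
Qed.

(** Bounding the real part of the integral in every direction of the complex
    plane avoids the measurability of the modulus and loses no factor. *)
Lemma surface_cintegral_bound k w (F : T2 -> R[i]) (C : R) : dot k k = 1 -> zonal_weight w -> 0 <= C ->
  measurable_fun setT (fun p => complex.Re (F p)) ->
  measurable_fun setT (fun p => complex.Im (F p)) ->
  (forall p, normc (F p) <= C * w (sphere_dot k p)) ->
  surface_integrable F /\ normc (surface_cintegral F) <= C * zonal_mass w.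
Proof.
move=> k1 ww C0 mR mI FC.
have iw : surf.-integrable setT (EFin \o (fun p : T2 => C * w (sphere_dot k p))).
  have := @integrableZl _ _ _ surf setT measurableT C _ (zonal_weight_integrable k1 ww).
  by apply: eq_integrable => // p _ /=; rewrite EFinM.
have w0 p : 0 <= w (sphere_dot k p) by case: ww => _ + _.
have iR : surf.-integrable setT (fun p => (complex.Re (F p))%:E).
  apply: le_integrable iw => //; first exact/measurable_EFinP.
  by move=> p _ /=; rewrite lee_fin [X in _ <= X]ger0_norm ?mulr_ge0// (le_trans (Re_le_normc _)).
have iI : surf.-integrable setT (fun p => (complex.Im (F p))%:E).
  apply: le_integrable iw => //; first exact/measurable_EFinP.
  by move=> p _ /=; rewrite lee_fin [X in _ <= X]ger0_norm ?mulr_ge0// (le_trans (Im_le_normc _)).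
split => //; apply: normc_le_directions => [|a b ab].
  by rewrite mulr_ge0// zonal_mass_ge0.
have iaR : surf.-integrable setT (EFin \o (fun p => a * complex.Re (F p))).
  have := @integrableZl _ _ _ surf setT measurableT a _ iR.
  by apply: eq_integrable => // p _ /=; rewrite EFinM.
have ibI : surf.-integrable setT (EFin \o (fun p => b * complex.Im (F p))).
  have := @integrableZl _ _ _ surf setT measurableT b _ iI.
  by apply: eq_integrable => // p _ /=; rewrite EFinM.
have iS : surf.-integrable setT
    (EFin \o (fun p => a * complex.Re (F p) + b * complex.Im (F p))).
  have := @integrableD _ _ _ surf setT measurableT _ _ iaR ibI.
  by apply: eq_integrable.
have -> : a * complex.Re (surface_cintegral F) + b * complex.Im (surface_cintegral F) =
    \int[surf]_p (a * complex.Re (F p) + b * complex.Im (F p)).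
  by rewrite RintegralD// !RintegralZl.
rewrite -(zonal_mass_sphere_dot k1 ww) -RintegralZl//; last exact: zonal_weight_integrable.
apply: le_Rintegral => //.
by move=> p _; rewrite (le_trans (normc_direction _ ab)).
Qed.

Section char_fun_on_sphere.
Variable f : 'rV[R]_3 -> R[i].
Hypothesis fK : is_char_fun f.

(** Measurability in the parameter comes from the Fubini theorem. *)
Lemma bounded_complex_char (Y : T2 -> 'rV[R]_3) :
  (forall i, measurable_fun setT (fun p => Y p 0 i)) ->
  bounded_complex (fun p => f (Y p)).
Proof.
move=> mY; have [P fE] := proj1 (is_char_funP f) fK.
have mK : measurable_fun setT (fun z : R3 * T2 => dot (z.1 : 'rV[R]_3) (Y z.2)).
  under eq_fun do rewrite dotE.
  by repeat apply: measurable_funD; apply: measurable_funM;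
   (exact: (measurableT_comp (measurable_coord _)) || exact: (measurableT_comp (mY _))).
have bmean (h : R -> R) : bounded_measurable h ->
    bounded_measurable (fun p => \int[P]_v h (dot (v : 'rV[R]_3) (Y p))).
  move=> bh; have bK := bounded_measurable_comp mK bh.
  have iK : (P \x surf)%E.-integrable setT
      (EFin \o (fun z : R3 * T2 => h (dot (z.1 : 'rV[R]_3) (Y z.2)))).
    apply: integrable_bounded bK.
    rewrite -setXTT [ltLHS](@product_measure1E _ _ _ _ R P surf)//.
    by rewrite lte_mul_pinfty// ?fin_num_measure//; exact: surface_lty.
  have bhp p : bounded_measurable (fun v : R3 => h (dot (v : 'rV[R]_3) (Y p))).
    exact: (bounded_measurable_comp (measurable_dotl (Y p)) bh).
  split.
    apply/measurable_EFinP.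
    have := measurable_fubini_G iK.
    apply: eq_measurable_fun => p _; rewrite /fubini_G /Rintegral /= fineK//.
    by apply: integrable_fin_num => //; exact: integrable_mean.
  have [_ [M hM]] := bh; exists M => p.
  rewrite (le_trans (le_normr_Rintegral _ _))//; first exact: integrable_mean.
  rewrite -[leRHS](mean_cst P M); apply: le_Rintegral => //.
  - apply: integrable_mean; have [m' _] := bhp p; split; last by exists M => v; rewrite normr_id.
    exact: measurableT_comp.
  - by apply: integrable_mean; exact: bounded_measurable_cst.
have bc : bounded_measurable (cos : R -> R) by exact: (bounded_measurable_cos (X := id)).
have bs : bounded_measurable (sin : R -> R) by exact: (bounded_measurable_sin (X := id)).
split; under eq_fun do rewrite fE /=; first exact: (bmean cos).
by apply: bounded_measurableN; exact: (bmean sin).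
Qed.

End char_fun_on_sphere.

Lemma xi_plus_coord xi (p : T2) i : xi_plus xi (sphere_point p) 0 i =
    2^-1 * xi 0 i + enorm xi / 2 * (sphere_point p : 'rV[R]_3) 0 i.
Proof. by rewrite /xi_plus mxE [X in X + _]mxE [X in _ + X]mxE. Qed.

Lemma xi_minus_coord xi (p : T2) i : xi_minus xi (sphere_point p) 0 i =
    2^-1 * xi 0 i - enorm xi / 2 * (sphere_point p : 'rV[R]_3) 0 i.
Proof. by rewrite /xi_minus mxE [X in X + _]mxE [X in _ + X]mxE [X in - X]mxE. Qed.

Lemma bounded_complex_plus f xi : is_char_fun f ->
  bounded_complex (fun p => f (xi_plus xi (sphere_point p))).
Proof.
move=> fK; apply: bounded_complex_char => // i.
under eq_fun do rewrite xi_plus_coord.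
apply: measurable_funD => //; apply: measurable_funM => //; exact: measurable_sphere_point.
Qed.

Lemma bounded_complex_minus f xi : is_char_fun f ->
  bounded_complex (fun p => f (xi_minus xi (sphere_point p))).
Proof.
move=> fK; apply: bounded_complex_char => // i.
under eq_fun do rewrite xi_minus_coord.
apply: measurable_funB => //; apply: measurable_funM => //; exact: measurable_sphere_point.
Qed.

Lemma dot_sphere_point (p : T2) : dot (sphere_point p) (sphere_point p) = 1 :> R.
Proof.
rewrite dotE !mxE/=.
transitivity (sin p.1 ^+ 2 * (cos p.2 ^+ 2 + sin p.2 ^+ 2) + cos p.1 ^+ 2); first by ring.
by rewrite cos2Dsin2 mulr1 addrC cos2Dsin2.
Qed.

Lemma half_cos2_itv k p : dot k k = 1 -> 0 <= half_cos2 (sphere_dot k p) <= 1.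
Proof. by move=> k1; have := sphere_dot_le1 p k1; rewrite ler_norml /half_cos2 => ?; lra. Qed.

Lemma half_sin2_itv k p : dot k k = 1 -> 0 <= half_sin2 (sphere_dot k p) <= 1.
Proof. by move=> k1; have := sphere_dot_le1 p k1; rewrite ler_norml /half_sin2 => ?; lra. Qed.

Lemma enormE_pow (u : 'rV[R]_3) (alpha : R) : enorm u `^ alpha = dot u u `^ (alpha / 2).
Proof. by rewrite /enorm -powR12_sqrt ?dot_ge0// -powRrM mulrC. Qed.

Lemma enorm_xi_plus xi (p : T2) alpha : enorm (xi_plus xi (sphere_point p)) `^ alpha =
  enorm xi `^ alpha * half_cos2 (sphere_dot (direction xi) p) `^ (alpha / 2).
Proof.
have [h0 _] := andP (half_cos2_itv p (dot_direction xi)).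
rewrite !enormE_pow -powRM ?dot_ge0//; congr (_ `^ _).
have d1 := dot_sphere_point p; have d2 := dot_enorm_direction xi (sphere_point p).
have n2 := sqr_enorm xi; rewrite !dot_sphere in d2.
transitivity (4^-1 * dot xi xi + 2^-1 * enorm xi * dot xi (sphere_point p) +
  4^-1 * (enorm xi ^+ 2 * dot (sphere_point p) (sphere_point p))).
  by rewrite [LHS]dotE !xi_plus_coord !dotE; field.
by rewrite d1 dot_sphere d2 -n2 /half_cos2; field.
Qed.

Lemma enorm_xi_minus xi (p : T2) alpha : enorm (xi_minus xi (sphere_point p)) `^ alpha =
  enorm xi `^ alpha * half_sin2 (sphere_dot (direction xi) p) `^ (alpha / 2).
Proof.
have [h0 _] := andP (half_sin2_itv p (dot_direction xi)).
rewrite !enormE_pow -powRM ?dot_ge0//; congr (_ `^ _).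
have d1 := dot_sphere_point p; have d2 := dot_enorm_direction xi (sphere_point p).
have n2 := sqr_enorm xi; rewrite !dot_sphere in d2.
transitivity (4^-1 * dot xi xi - 2^-1 * enorm xi * dot xi (sphere_point p) +
  4^-1 * (enorm xi ^+ 2 * dot (sphere_point p) (sphere_point p))).
  by rewrite [LHS]dotE !xi_minus_coord !dotE; field.
by rewrite d1 dot_sphere d2 -n2 /half_sin2; field.
Qed.

Lemma xi_plusDminus xi (sigma : 'rV[R]_3) : xi_plus xi sigma + xi_minus xi sigma = xi.
Proof.
rewrite /xi_plus /xi_minus addrACA subrr addr0 -scalerDl.
by rewrite -{1}[2^-1 : R]mulr1 -{2}[2^-1 : R]mulr1 -mulrDr mulVf// scale1r.
Qed.

End surface_complex.

(** * The collision operator *)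

Section collision_operator.
Variable R : realType.
Local Notation R3 := (borelR3 R).
Local Notation T2 := (measurableTypeR R * measurableTypeR R)%type.
Local Notation surf := (@surface R).
Implicit Types (xi eta k : 'rV[R]_3) (f g : 'rV[R]_3 -> R[i]) (beta : R -> R).

Definition collision_defect f xi (p : T2) : R[i] :=
  f (xi_plus xi (sphere_point p)) * f (xi_minus xi (sphere_point p)) - f xi * f 0.

(** The axis is the direction of [xi], so that the kernel is evaluated at
    [cos theta]. *)
Definition collision_op beta f xi : R[i] :=
  if xi == 0 then 0 else surface_cintegral (fun p : T2 =>
    (beta (sphere_dot (direction xi) p))%:C * collision_defect f xi p).

Lemma bounded_complex_defect f xi : is_char_fun f -> bounded_complex (collision_defect f xi).
Proof.
move=> fK; apply: bounded_complexB; last exact: bounded_complex_cst.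
by apply: bounded_complexM; [exact: bounded_complex_plus|exact: bounded_complex_minus].
Qed.

Lemma normcM (z1 z2 : R[i]) : normc (z1 * z2) = normc z1 * normc z2.
Proof. exact: ComplexField.Normc.normcM. Qed.

Lemma normc_realM (r : R) (z : R[i]) : 0 <= r -> normc (r%:C * z) = r * normc z.
Proof. by move=> r0; rewrite normcM normc_real ger0_norm. Qed.

Lemma measurable_weight beta k (D : T2 -> R[i]) : measurable_fun setT beta ->
  bounded_complex D ->
  measurable_fun setT (fun p => complex.Re ((beta (sphere_dot k p))%:C * D p)) /\
  measurable_fun setT (fun p => complex.Im ((beta (sphere_dot k p))%:C * D p)).
Proof.
move=> mb [[mR _] [mI _]].
have mk := measurableT_comp mb (proj1 (bounded_measurable_sphere_dot k)).
split; first by under eq_fun do rewrite Re_realM; exact: measurable_funM.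
by under eq_fun do rewrite Im_realM; exact: measurable_funM.
Qed.

Lemma weighted_cintegral_bound beta w k (D : T2 -> R[i]) (C : R) : dot k k = 1 ->
  measurable_fun setT beta -> (forall x, 0 <= beta x) ->
  zonal_weight (fun x => beta x * w x) -> bounded_complex D -> 0 <= C ->
  (forall p, normc (D p) <= C * w (sphere_dot k p)) ->
  surface_integrable (fun p => (beta (sphere_dot k p))%:C * D p) /\
  normc (surface_cintegral (fun p => (beta (sphere_dot k p))%:C * D p)) <=
    C * zonal_mass (fun x => beta x * w x).
Proof.
move=> k1 mb b0 zw bD C0 DC; have [mR mI] := measurable_weight k mb bD.
apply: (surface_cintegral_bound k1 zw C0 mR mI) => p.
by rewrite normc_realM// mulrCA ler_wpM2l.
Qed.

Section alpha.
Variable alpha : R.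
Hypothesis alpha_gt0 : 0 < alpha.

Definition alpha_close (M : R) f g := forall xi, normc (f xi - g xi) <= M * enorm xi `^ alpha.

(** [char_fun_product_defect] with [1 - |f|^2 <= 2 |f - 1|] and the weight
    [c = |b|^(alpha/2) / |a|^(alpha/2)], which makes both terms equal. *)
Lemma char_fun_defect f (M : R) a b : is_char_fun f -> 0 <= M -> alpha_close M f (fun=> 1) ->
  normc (f a * f b - f (a + b)) <= 2 * M * (enorm a `^ (alpha / 2) * enorm b `^ (alpha / 2)).
Proof.
move=> fK M0 f1.
have rhs0 : 0 <= 2 * M * (enorm a `^ (alpha / 2) * enorm b `^ (alpha / 2)).
  by rewrite !mulr_ge0 ?powR_ge0.
have [a0|a0] := eqVneq a 0.
  by move: rhs0; rewrite a0 (char_fun0 fK) mul1r add0r subrr ComplexField.Normc.normc0.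
have [b0|b0] := eqVneq b 0.
  by move: rhs0; rewrite b0 (char_fun0 fK) mulr1 addr0 subrr ComplexField.Normc.normc0.
set A := enorm a `^ (alpha / 2); set B := enorm b `^ (alpha / 2).
have A0 : 0 < A by rewrite powR_gt0// enorm_gt0.
have B0 : 0 < B by rewrite powR_gt0// enorm_gt0.
have AA u : enorm u `^ alpha = enorm u `^ (alpha / 2) ^+ 2.
  by rewrite -powR_mulrn ?powR_ge0// -powRrM mulfVK.
have H u : 1 - normc (f u) ^+ 2 <= 2 * (M * enorm u `^ (alpha / 2) ^+ 2).
  have n1 := normc_char_le1 u fK; have := f1 u; rewrite AA => h.
  have := normc_ge0 (f u).
  have : 1 - normc (f u) <= normc (f u - 1).
    have := normc_dist_trans (f u) 1 0; rewrite !subr0 normc_distC.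
    have -> : normc (1 : R[i]) = 1 by rewrite (normc_real 1) normr1.
    by rewrite lerBlDr.
  move: h; set m := normc (f u - 1); set q := M * _; set n := normc (f u) in n1 *.
  rewrite expr2; nra.
have BA : 0 < B / A by rewrite divr_gt0.
rewrite (le_trans (char_fun_product_defect a b fK BA))//.
have -> : 2 * M * (A * B) = (B / A * (2 * (M * A ^+ 2)) + (B / A)^-1 * (2 * (M * B ^+ 2))) / 2.
  by field; rewrite !gt_eqF.
rewrite ler_pM2r ?invr_gt0//; apply: lerD; rewrite ler_pM2l ?invr_gt0//; exact: H.
Qed.

(** The cancellation at small angles: [xi-] has length [|xi| sin (theta/2)]. *)
Lemma collision_defect_bound f (M : R) xi p : is_char_fun f -> 0 <= M ->
  alpha_close M f (fun=> 1) ->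
  normc (collision_defect f xi p) <=
    2 * M * enorm xi `^ alpha * half_sin2 (sphere_dot (direction xi) p) `^ (alpha / 4).
Proof.
move=> fK M0 f1; rewrite /collision_defect (char_fun0 fK) mulr1.
have := char_fun_defect (xi_plus xi (sphere_point p)) (xi_minus xi (sphere_point p)) fK M0 f1.
rewrite xi_plusDminus => /le_trans; apply.
rewrite enorm_xi_plus enorm_xi_minus.
have -> : alpha / 2 / 2 = alpha / 4 by field.
have [c0 c1] := andP (half_cos2_itv p (dot_direction xi)).
set c := half_cos2 _ `^ _; set d := half_sin2 _ `^ _; set E := _ `^ (alpha / 2).
have -> : enorm xi `^ alpha = E * E.
  by rewrite -expr2 -powR_mulrn ?powR_ge0// -powRrM mulfVK.
have cc1 : c <= 1.
  rewrite -(congr1 (@^~ (alpha / 4)) (powR1 R)) ge0_ler_powR ?nnegrE//.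
  by rewrite divr_ge0// ltW.
have E0 : 0 <= E by rewrite powR_ge0.
have d0 : 0 <= d by rewrite powR_ge0.
have -> : 2 * M * (E * c * (E * d)) = 2 * M * (E * E) * d * c by ring.
by rewrite -[leRHS]mulr1 ler_wpM2l// !mulr_ge0.
Qed.

Section singular_kernel.
Variable beta : R -> R.
Hypotheses (mbeta : measurable_fun setT beta) (beta_ge0 : forall x, 0 <= beta x).
Hypothesis zbeta : zonal_weight (fun x => beta x * half_sin2 x `^ (alpha / 4)).

Lemma collision_integrand_integrable f (M : R) xi : is_char_fun f -> 0 <= M ->
  alpha_close M f (fun=> 1) ->
  surface_integrable (fun p : T2 =>
    (beta (sphere_dot (direction xi) p))%:C * collision_defect f xi p) /\
  normc (surface_cintegral (fun p : T2 =>
    (beta (sphere_dot (direction xi) p))%:C * collision_defect f xi p)) <=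
   2 * M * enorm xi `^ alpha *
     zonal_mass (fun x => beta x * half_sin2 x `^ (alpha / 4)).
Proof.
move=> fK M0 f1.
apply: (weighted_cintegral_bound (w := fun x => half_sin2 x `^ (alpha / 4))) => //.
- exact: dot_direction.
- exact: bounded_complex_defect.
- by rewrite !mulr_ge0// powR_ge0.
- by move=> p; exact: collision_defect_bound.
Qed.

End singular_kernel.

(** Replacing the kernel by a smaller one costs the integral of the difference
    against the weight of [collision_defect_bound]. *)
Lemma collision_op_kernel beta1 beta2 f (M : R) xi :
  measurable_fun setT beta1 -> measurable_fun setT beta2 ->
  (forall x, 0 <= beta2 x <= beta1 x) ->
  zonal_weight (fun x => beta1 x * half_sin2 x `^ (alpha / 4)) ->
  is_char_fun f -> 0 <= M -> alpha_close M f (fun=> 1) ->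
  normc (collision_op beta1 f xi - collision_op beta2 f xi) <=
  2 * zonal_mass (fun x => (beta1 x - beta2 x) * half_sin2 x `^ (alpha / 4)) * M * enorm xi `^ alpha.
Proof.
move=> m1 m2 b12 z1 fK M0 f1.
have b20 x : 0 <= beta2 x by have /andP[] := b12 x.
have b10 x : 0 <= beta1 x by have /andP[h /(le_trans h)] := b12 x.
have mp := measurable_half_sin2_pow (R := R) (alpha / 4).
have z2 : zonal_weight (fun x => beta2 x * half_sin2 x `^ (alpha / 4)).
  apply: zonal_weight_le z1 _ => [||x _].
  - exact: measurable_funM.
  - by move=> x; rewrite mulr_ge0// powR_ge0.
  - by rewrite ler_wpM2r ?powR_ge0//; have /andP[] := b12 x.
have md : measurable_fun setT (fun x => beta1 x - beta2 x) by exact: measurable_funB.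
have bd x : 0 <= beta1 x - beta2 x by rewrite subr_ge0; have /andP[] := b12 x.
have zd : zonal_weight (fun x => (beta1 x - beta2 x) * half_sin2 x `^ (alpha / 4)).
  apply: zonal_weight_le z1 _ => [||x _].
  - exact: measurable_funM.
  - by move=> x; rewrite mulr_ge0// powR_ge0.
  - by rewrite ler_wpM2r ?powR_ge0// gerBl.
rewrite /collision_op; case: eqVneq => [_|xi0].
  by rewrite subrr ComplexField.Normc.normc0 !mulr_ge0 ?powR_ge0 ?zonal_mass_ge0.
have [i1 _] := collision_integrand_integrable m1 b10 z1 xi fK M0 f1.
have [i2 _] := collision_integrand_integrable m2 b20 z2 xi fK M0 f1.
have [_ h] := collision_integrand_integrable md bd zd xi fK M0 f1.
rewrite -surface_cintegralB//.
have -> : (fun p => (beta1 (sphere_dot (direction xi) p))%:C * collision_defect f xi p -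
     (beta2 (sphere_dot (direction xi) p))%:C * collision_defect f xi p) =
  (fun p => (beta1 (sphere_dot (direction xi) p) - beta2 (sphere_dot (direction xi) p))%:C * collision_defect f xi p).
  by apply/funext => p; rewrite -mulrBl rmorphB.
by apply: le_trans h _; rewrite le_eqVlt; apply/orP; left; apply/eqP; ring.
Qed.

Section bounded_kernel.
Variable beta : R -> R.
Hypotheses (bbeta : bounded_measurable beta) (beta_ge0 : forall x, 0 <= beta x).

(** The sum of the powers of order [alpha] of the lengths of [xi+] and [xi-],
    for a unit vector [xi]. *)
Definition spread (x : R) := half_cos2 x `^ (alpha / 2) + half_sin2 x `^ (alpha / 2).

Lemma measurable_spread : measurable_fun setT spread.
Proof.
by apply: measurable_funD; [exact: measurable_half_cos2_pow|exact: measurable_half_sin2_pow].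
Qed.

Lemma spread_ge0 x : 0 <= spread x.
Proof. by rewrite addr_ge0 ?powR_ge0. Qed.

Lemma spread_le2 x : `|x| <= 1 -> spread x <= 2.
Proof.
rewrite ler_norml => /andP[h1 h2]; rewrite /spread (_ : 2 = 1 + 1)//.
by apply: lerD; rewrite -[leRHS](congr1 (@^~ (alpha / 2)) (powR1 R)) ge0_ler_powR ?nnegrE ?divr_ge0 ?(ltW alpha_gt0)// /half_cos2 /half_sin2; lra.
Qed.

Let mbeta := proj1 bbeta.

Lemma zonal_beta : zonal_weight beta. Proof. exact: zonal_weight_bounded. Qed.

Lemma zonal_betaM (w : R -> R) (C : R) : measurable_fun setT w -> (forall x, 0 <= w x) ->
  (forall x, `|x| <= 1 -> w x <= C) -> zonal_weight (fun x => beta x * w x).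
Proof.
move=> mw w0 wC.
have zC : zonal_weight (fun x => beta x * Num.max C 0).
  have b2 : bounded_measurable (fun x => beta x * Num.max C 0).
    by apply: bounded_measurableM => //; exact: bounded_measurable_cst.
  apply: (zonal_weight_bounded b2) => x.
  by rewrite mulr_ge0// le_max lexx orbT.
apply: zonal_weight_le zC _ => [||x x1].
- exact: measurable_funM.
- by move=> x; rewrite mulr_ge0.
- by rewrite ler_wpM2l// le_max wC.
Qed.

Lemma zonal_spread : zonal_weight (fun x => beta x * spread x).
Proof. exact: zonal_betaM measurable_spread spread_ge0 spread_le2. Qed.

Let gamma := zonal_mass beta.

(** [f f' - g g' = f (f' - g') + (f - g) g'], and all moduli are at most 1. *)
Lemma gain_difference f g (D : R) xi p : is_char_fun f -> is_char_fun g ->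
  alpha_close D f g ->
  normc (f (xi_plus xi (sphere_point p)) * f (xi_minus xi (sphere_point p)) -
    g (xi_plus xi (sphere_point p)) * g (xi_minus xi (sphere_point p))) <=
  D * enorm xi `^ alpha * spread (sphere_dot (direction xi) p).
Proof.
move=> fK gK fg; set a := xi_plus _ _; set b := xi_minus _ _.
have -> : f a * f b - g a * g b = f a * (f b - g b) + (f a - g a) * g b by ring.
rewrite (le_trans (le_normcD _ _))// !normcM /spread mulrDr addrC lerD//.
  apply: (@le_trans _ _ (normc (f a - g a) * 1)).
    by rewrite ler_wpM2l ?normc_ge0// normc_char_le1.
  by rewrite mulr1 (le_trans (fg a))// enorm_xi_plus mulrA.
apply: (@le_trans _ _ (1 * normc (f b - g b))).
  by rewrite ler_wpM2r ?normc_ge0// normc_char_le1.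
by rewrite mul1r (le_trans (fg b))// enorm_xi_minus mulrA.
Qed.

Lemma surface_cintegral_cst (c : R[i]) xi :
  surface_integrable (fun p => (beta (sphere_dot (direction xi) p))%:C * c) /\
  surface_cintegral (fun p => (beta (sphere_dot (direction xi) p))%:C * c) = gamma%:C * c.
Proof.
have iw := zonal_weight_integrable (dot_direction xi) zonal_beta.
have gE : \int[surf]_p beta (sphere_dot (direction xi) p) = gamma.
  exact: zonal_mass_sphere_dot (dot_direction xi) zonal_beta.
have i1 : surface_integrable (fun p => (beta (sphere_dot (direction xi) p))%:C * c).
  have zb1 : zonal_weight (fun x => beta x * 1).
    by under eq_fun do rewrite mulr1; exact: zonal_beta.
  have DC (p : T2) : normc c <= normc c * 1 by rewrite mulr1.
  by have [] := weighted_cintegral_bound (w := fun=> 1)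
    (dot_direction xi) mbeta beta_ge0 zb1 (bounded_complex_cst c) (normc_ge0 c) DC.
split => //; apply/eqP; rewrite eq_complex Re_realM Im_realM /surface_cintegral /=.
apply/andP; split; apply/eqP.
  transitivity (\int[surf]_p (complex.Re c * beta (sphere_dot (direction xi) p))).
    by apply: eq_Rintegral => p _; rewrite Re_realM mulrC.
  by rewrite RintegralZl// gE mulrC.
transitivity (\int[surf]_p (complex.Im c * beta (sphere_dot (direction xi) p))).
  by apply: eq_Rintegral => p _; rewrite Im_realM mulrC.
by rewrite RintegralZl// gE mulrC.
Qed.

Lemma gain_integrable f xi : is_char_fun f ->
  surface_integrable (fun p => (beta (sphere_dot (direction xi) p))%:C *
  (f (xi_plus xi (sphere_point p)) * f (xi_minus xi (sphere_point p)))).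
Proof.
move=> fK.
have zb1 : zonal_weight (fun x => beta x * 1).
  by under eq_fun do rewrite mulr1; exact: zonal_beta.
have bD := bounded_complexM (bounded_complex_plus xi fK) (bounded_complex_minus xi fK).
have DC (p : T2) : normc (f (xi_plus xi (sphere_point p)) *
    f (xi_minus xi (sphere_point p))) <= 1 * 1.
  by rewrite normcM ler_pM ?normc_ge0 ?normc_char_le1.
by have [] := weighted_cintegral_bound (w := fun=> 1)
    (dot_direction xi) mbeta beta_ge0 zb1 bD ler01 DC.
Qed.

Lemma collision_op_gain f xi : is_char_fun f -> xi != 0 ->
  collision_op beta f xi = gain beta f xi - gamma%:C * f xi.
Proof.
move=> fK xi0; rewrite /collision_op (negbTE xi0) /gain.
have [i1 E1] := surface_cintegral_cst (f xi) xi.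
rewrite -E1 -surface_cintegralB//; last exact: gain_integrable.
congr surface_cintegral; apply/funext => p.
by rewrite /collision_defect (char_fun0 fK) mulr1 mulrBr.
Qed.

Lemma gain_contraction f g (D : R) xi : is_char_fun f -> is_char_fun g ->
  0 <= D -> alpha_close D f g ->
  normc (gain beta f xi - gain beta g xi) <=
  zonal_mass (fun x => beta x * spread x) * D * enorm xi `^ alpha.
Proof.
move=> fK gK D0 fg; rewrite /gain -surface_cintegralB; [|exact: gain_integrable..].
have bD f' : is_char_fun f' -> bounded_complex (fun p : T2 =>
    f' (xi_plus xi (sphere_point p)) * f' (xi_minus xi (sphere_point p))).
  by move=> K'; apply: bounded_complexM; [exact: bounded_complex_plus|exact: bounded_complex_minus].
have C0 : 0 <= D * enorm xi `^ alpha by rewrite mulr_ge0 ?powR_ge0.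
have DC p := gain_difference xi p fK gK fg.
have [_ h] := weighted_cintegral_bound (w := spread) (dot_direction xi) mbeta beta_ge0
  zonal_spread (bounded_complexB (bD f fK) (bD g gK)) C0 DC.
have -> : (fun p : T2 => (beta (sphere_dot (direction xi) p))%:C *
    (f (xi_plus xi (sphere_point p)) * f (xi_minus xi (sphere_point p))) -
    (beta (sphere_dot (direction xi) p))%:C *
    (g (xi_plus xi (sphere_point p)) * g (xi_minus xi (sphere_point p)))) =
  (fun p => (beta (sphere_dot (direction xi) p))%:C *
    (f (xi_plus xi (sphere_point p)) * f (xi_minus xi (sphere_point p)) -
     g (xi_plus xi (sphere_point p)) * g (xi_minus xi (sphere_point p)))).
  by apply/funext => p; rewrite mulrBr.
by rewrite (le_trans h)// mulrC mulrA.
Qed.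

Definition growth_rate := zonal_mass (fun x => beta x * spread x) - gamma.

(** The step is [(1 - h gamma) f + h (gain f)]; the two terms expand the
    distance by [1 - h gamma] and by [h] times the mass of the kernel weighted
    by [spread], and [1 + y <= exp y]. *)
Lemma euler_step_contraction f g (D h : R) : is_char_fun f -> is_char_fun g ->
  0 <= D -> alpha_close D f g -> 0 <= h -> h * gamma <= 1 ->
  alpha_close (expR (h * growth_rate) * D)
    (fun xi => f xi + h%:C * collision_op beta f xi)
    (fun xi => g xi + h%:C * collision_op beta g xi).
Proof.
move=> fK gK D0 fg h0 hg xi.
have [xi0|xi0] := eqVneq xi 0.
  rewrite xi0 /collision_op eqxx !mulr0 !addr0 !char_fun0// subrr ComplexField.Normc.normc0.
  by rewrite !mulr_ge0 ?powR_ge0 ?expR_ge0.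
rewrite !collision_op_gain//.
have -> : f xi + h%:C * (gain beta f xi - gamma%:C * f xi) -
   (g xi + h%:C * (gain beta g xi - gamma%:C * g xi)) =
   (1 - h * gamma)%:C * (f xi - g xi) + h%:C * (gain beta f xi - gain beta g xi).
  by rewrite !rmorphB !rmorphM rmorph1/=; ring.
rewrite (le_trans (le_normcD _ _))// !normc_realM ?subr_ge0//.
have H1 : (1 - h * gamma) * normc (f xi - g xi) <= (1 - h * gamma) * (D * enorm xi `^ alpha).
  by rewrite ler_wpM2l ?subr_ge0.
have H2 := ler_wpM2l h0 (gain_contraction xi fK gK D0 fg).
rewrite (le_trans (lerD H1 H2))//.
apply: (@le_trans _ _ ((1 + h * growth_rate) * (D * enorm xi `^ alpha))).
  by rewrite le_eqVlt; apply/orP; left; apply/eqP; rewrite /growth_rate; ring.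
by rewrite -mulrA ler_wpM2r ?expR_ge1Dx// mulr_ge0// powR_ge0.
Qed.

Lemma collision_op_lipschitz f g (D : R) : is_char_fun f -> is_char_fun g ->
  0 <= D -> alpha_close D f g ->
  alpha_close ((zonal_mass (fun x => beta x * spread x) + gamma) * D)
    (collision_op beta f) (collision_op beta g).
Proof.
move=> fK gK D0 fg xi; have g0 : 0 <= gamma by exact: zonal_mass_ge0 zonal_beta.
have [xi0|xi0] := eqVneq xi 0.
  rewrite xi0 /collision_op eqxx subrr ComplexField.Normc.normc0.
  by rewrite !mulr_ge0 ?addr_ge0 ?powR_ge0// zonal_mass_ge0//; exact: zonal_spread.
rewrite !collision_op_gain//.
have -> : gain beta f xi - gamma%:C * f xi - (gain beta g xi - gamma%:C * g xi) =
   (gain beta f xi - gain beta g xi) - gamma%:C * (f xi - g xi) by ring.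
rewrite (le_trans (normcB _ _))// normc_realM//.
rewrite (le_trans (lerD (gain_contraction xi fK gK D0 fg) (ler_wpM2l g0 (fg xi))))//.
by rewrite le_eqVlt; apply/orP; left; apply/eqP; ring.
Qed.

Lemma char_fun_mixture f g (a : R) : is_char_fun f -> is_char_fun g -> 0 <= a <= 1 ->
  is_char_fun (fun xi => a%:C * f xi + (1 - a)%:C * g xi).
Proof.
move=> /is_char_funP[P fE] /is_char_funP[Q gE] a01.
have [P' PE] := mixture_law P Q a01.
apply/is_char_funP; exists P' => xi; rewrite fE gE.
rewrite /charC /charS !PE; [|exact: bounded_sin_dot|exact: bounded_cos_dot].
apply/eqP; rewrite eq_complex /=; apply/andP; split; apply/eqP; ring.
Qed.

(** A mixture of [f] and of the characteristic function given by
    [gain_char_fun].  A kernel of mass 0 is treated apart, as it cannot be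
    normalized. *)
Lemma euler_step_char f (h : R) : is_char_fun f -> 0 <= h -> h * gamma <= 1 ->
  is_char_fun (fun xi => f xi + h%:C * collision_op beta f xi).
Proof.
move=> fK h0 hg; have := zonal_mass_ge0 zonal_beta; rewrite -/gamma le_eqVlt => /orP[/eqP g0|g0].
  have -> : (fun xi => f xi + h%:C * collision_op beta f xi) = f; last by [].
  apply/funext => xi.
  suff -> : collision_op beta f xi = 0 by rewrite mulr0 addr0.
  rewrite /collision_op; case: eqVneq => // xi0.
  have zb2 : zonal_weight (fun x => beta x * 1).
    by under eq_fun do rewrite mulr1; exact: zonal_beta.
  have DC p : normc (collision_defect f xi p) <= 2 * 1.
    rewrite mulr1 (le_trans (normcB _ _))// (_ : 2 = 1 + 1)//.
    by rewrite !normcM lerD// -[leRHS]mulr1 ler_pM ?normc_ge0 ?normc_char_le1.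
  have [_] := weighted_cintegral_bound (w := fun=> 1)
    (dot_direction xi) mbeta beta_ge0 zb2 (bounded_complex_defect xi fK) (ler0n R 2) DC.
  have -> : zonal_mass (fun x => beta x * 1) = gamma.
    by congr zonal_mass; apply/funext => x; rewrite mulr1.
  rewrite -g0 mulr0 => n0; apply: ComplexField.Normc.eq0_normc.
  by apply/eqP; rewrite eq_le n0 normc_ge0.
have [g gK gE] := gain_char_fun bbeta beta_ge0 g0 fK.
have := char_fun_mixture gK fK (a := h * gamma).
rewrite hg mulr_ge0// ?ltW// => /(_ isT); congr is_char_fun; apply/funext => xi.
have [->|xi0] := eqVneq xi 0.
  rewrite /collision_op eqxx mulr0 addr0 !char_fun0// !mulr1 -rmorphD/= addrC subrK.
  by [].
rewrite collision_op_gain// gE//.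
by rewrite rmorphB rmorphM rmorph1 /gamma /zonal_mass/=; ring.
Qed.

End bounded_kernel.
End alpha.
End collision_operator.

(** * Truncated kernels *)

Section truncated_kernels.
Variables (R : realType) (s : R) (b : R -> R) (alpha : R).
Hypotheses (b_kernel : collision_kernel b) (b_singular : debye_yukawa s b).
Hypothesis alpha_gt0 : 0 < alpha.
Local Notation T2 := (measurableTypeR R * measurableTypeR R)%type.
Local Notation surf := (@surface R).
Local Notation kb := (kernel_ext b).
Local Notation s2 := (@half_sin2 R).

Definition kernel_trunc (n : nat) (x : R) : R := Num.min (kb x) n%:R.

Let mkb : measurable_fun setT kb. Proof. exact: measurable_kernel_ext. Qed.
Let kb0 x : 0 <= kb x. Proof. exact: kernel_ext_ge0. Qed.

Lemma kernel_trunc_ge0 n x : 0 <= kernel_trunc n x.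
Proof. by rewrite le_min kb0/=. Qed.

Lemma kernel_trunc_le n x : kernel_trunc n x <= kb x.
Proof. by rewrite ge_min lexx. Qed.

Lemma bounded_kernel_trunc n : bounded_measurable (kernel_trunc n).
Proof.
split; first by apply: measurable_minr.
by exists n%:R => x; rewrite ger0_norm ?kernel_trunc_ge0// ge_min lexx orbT.
Qed.

Let mtrunc n := proj1 (bounded_kernel_trunc n).

Lemma kernel_trunc_cvg x : kernel_trunc n x @[n --> \oo] --> kb x.
Proof.
apply: cvg_near_cst; near=> n; rewrite /kernel_trunc min_l//.
rewrite ltW// (lt_le_trans (truncnS_gt _))// ler_nat.
by near: n; exact: nbhs_infty_ge.
Unshelve. all: by end_near. Qed.

Lemma zonal_kernel a : 0 < a -> zonal_weight (fun x => kb x * s2 x `^ a).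
Proof.
move=> a0; split.
- by apply: measurable_funM => //; exact: measurable_half_sin2_pow.
- by move=> x; rewrite mulr_ge0// powR_ge0.
- exact: (kernel_weight_lty b_kernel b_singular).
Qed.

Let zonal_kernel_trunc n a : 0 < a -> zonal_weight (fun x => (kb x - kernel_trunc n x) * s2 x `^ a).
Proof.
move=> a0; apply: zonal_weight_le (zonal_kernel a0) _ => [||x x1].
- by apply: measurable_funM; [exact: measurable_funB|exact: measurable_half_sin2_pow].
- by move=> x; rewrite mulr_ge0 ?powR_ge0// subr_ge0 kernel_trunc_le.
- by rewrite ler_wpM2r ?powR_ge0// gerBl kernel_trunc_ge0.
Qed.

(** The factor 2 and the exponent [alpha / 4] of [half_sin2] are those of
    [collision_defect_bound]. *)
Definition trunc_error (n : nat) : R :=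
  2 * zonal_mass (fun x => (kb x - kernel_trunc n x) * s2 x `^ (alpha / 4)).

Let a4 : 0 < alpha / 4. Proof. by rewrite divr_gt0. Qed.

Lemma trunc_error_ge0 n : 0 <= trunc_error n.
Proof. by rewrite mulr_ge0// zonal_mass_ge0//; exact: zonal_kernel_trunc. Qed.

Lemma trunc_error_noninc n m : (n <= m)%N -> trunc_error m <= trunc_error n.
Proof.
move=> nm; rewrite ler_wpM2l// le_zonal_mass//; try exact: zonal_kernel_trunc.
move=> x _; rewrite ler_wpM2r ?powR_ge0// lerB// /kernel_trunc le_min !ge_min lexx/=.
by rewrite ler_nat nm orbT.
Qed.

Lemma trunc_error_cvg : trunc_error n @[n --> \oo] --> (0 : R).
Proof.
have zi := zonal_cos_integrable (zonal_kernel a4).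
have mc := proj1 (bounded_measurable_cos1 R).
have ms := measurableT_comp (measurable_half_sin2_pow (R := R) (alpha / 4)) mc.
have H1 n (p : T2) : `|(kb (cos p.1) - kernel_trunc n (cos p.1)) * s2 (cos p.1) `^ (alpha / 4)| <=
    kb (cos p.1) * s2 (cos p.1) `^ (alpha / 4).
  rewrite ger0_norm; last by rewrite mulr_ge0 ?powR_ge0// subr_ge0 kernel_trunc_le.
  by rewrite ler_wpM2r ?powR_ge0// gerBl kernel_trunc_ge0.
have H2 (p : T2) : (kb (cos p.1) - kernel_trunc n (cos p.1)) * s2 (cos p.1) `^ (alpha / 4)
    @[n --> \oo] --> (0 : R).
  rewrite -[X in _ --> X](mul0r (s2 (cos p.1) `^ (alpha / 4))).
  apply: cvgM; last exact: cvg_cst.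
  rewrite -[X in _ --> X](subrr (kb (cos p.1))).
  by apply: cvgB; [exact: cvg_cst|exact: kernel_trunc_cvg].
have mm n : measurable_fun setT (fun p : T2 =>
    (kb (cos p.1) - kernel_trunc n (cos p.1)) * s2 (cos p.1) `^ (alpha / 4)).
  apply: measurable_funM ms; apply: measurable_funB; first exact: (measurableT_comp mkb mc).
  exact: (measurableT_comp (mtrunc n) mc).
have [_ _ h] := @dominated_cvg_Rintegral _ T2 R surf _ _ _ mm zi H1 H2.
rewrite -[X in _ --> X](mulr0 2); apply: cvgM; first exact: cvg_cst.
have z0 : \int[surf]_p (0 : R) = 0 by rewrite Rintegral_cst// mul0r.
by move: h; rewrite z0.
Qed.

(** Bernoulli's inequality for the integer [m], which is enough since
    [0 <= 1 - t <= 1]. *)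
Lemma powR_ge_linear (a t : R) (m : nat) : 0 < a -> a <= m%:R -> 0 <= t <= 1 ->
  1 - m%:R * t <= (1 - t) `^ a.
Proof.
move=> a0 am /andP[t0 t1]; have [t1'|t1'] := eqVneq t 1.
  rewrite t1' mulr1 subrr (le_trans _ (powR_ge0 _ _))// subr_le0 (_ : 1 = 1%:R)// ler_nat.
  by rewrite -(ltr_nat R) (lt_le_trans a0).
have lt1 : 0 < 1 - t by rewrite subr_gt0 lt_def eq_sym t1'.
apply: (@le_trans _ _ ((1 - t) `^ m%:R)); last first.
  by rewrite ger_powR// lt1/= gerBl.
rewrite powR_mulrn ?(ltW lt1)//; elim: m {am} => [|m ih]; first by rewrite expr0 gerBl mulr_ge0.
rewrite exprS (le_trans _ (ler_wpM2l (ltW lt1) ih))// -natr1.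
have : 0 <= m%:R * t * t by rewrite !mulr_ge0.
by nra.
Qed.

Let m2 := (Num.truncn (alpha / 2)).+1.

Lemma spread_sub1_bound x : `|x| <= 1 ->
  `|spread alpha x - 1| <= s2 x `^ (alpha / 2) + m2%:R * s2 x.
Proof.
move=> x1; have /andP[h1 h2] : -1 <= x <= 1 by rewrite -ler_norml.
have a0 : 0 < alpha / 2 by rewrite divr_gt0.
have s01 : 0 <= s2 x <= 1 by rewrite /half_sin2; lra.
have cE : half_cos2 x = 1 - s2 x by rewrite /half_cos2 /half_sin2; field.
have := powR_ge_linear a0 (ltW (truncnS_gt (alpha / 2))) s01; rewrite -cE -/m2 => h.
have c1 : half_cos2 x `^ (alpha / 2) <= 1.
  by rewrite -[leRHS](congr1 (@^~ (alpha / 2)) (powR1 R)) ge0_ler_powR ?nnegrE ?(ltW a0)// /half_cos2; lra.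
have p0 := powR_ge0 (s2 x) (alpha / 2).
have q0 : 0 <= m2%:R * s2 x by rewrite mulr_ge0//; case/andP: s01.
by rewrite ler_norml /spread; apply/andP; split; lra.
Qed.

(** Dominated convergence: [spread - 1] vanishes at small angles like a power of
    [sin (theta / 2)], so that it is integrable against the full kernel; in
    polar coordinates the limit is [lambda_alpha]. *)
Lemma growth_rate_cvg :
  growth_rate alpha (kernel_trunc n) @[n --> \oo] --> lambda_alpha b alpha.
Proof.
have a2 : 0 < alpha / 2 by rewrite divr_gt0.
have mc := proj1 (bounded_measurable_cos1 R).
have mphi : measurable_fun setT (fun x => spread alpha x - 1).
  by apply: measurable_funB => //; exact: measurable_spread.
pose G x := kb x * (s2 x `^ (alpha / 2)) + m2%:R * (kb x * s2 x `^ 1).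
have zG : zonal_weight G.
  apply: zonal_weightD; first exact: zonal_kernel.
  have z1 := zonal_kernel ltr01.
  split.
  - by apply: measurable_funM => //; case: z1.
  - by move=> x; rewrite !mulr_ge0// powR_ge0.
  under eq_integral do rewrite EFinM.
  rewrite ge0_integralZl//.
  - by rewrite lte_mul_pinfty//; case: z1.
  - by apply/measurable_EFinP; have [mz _ _] := z1; exact: (measurableT_comp mz mc).
  - by move=> p _; rewrite lee_fin mulr_ge0 ?powR_ge0.
have dom x : `|x| <= 1 -> kb x * `|spread alpha x - 1| <= G x.
  move=> x1; have s0 : 0 <= s2 x by move: x1; rewrite ler_norml /half_sin2 => ?; lra.
  rewrite /G powRr1// mulrCA -mulrDr ler_wpM2l//; exact: spread_sub1_bound.
have iG := zonal_cos_integrable zG.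
have cos1 (p : T2) : `|cos p.1| <= 1 by rewrite ler_norml cos_geN1 cos_le1.
have H1 n (p : T2) : `|kernel_trunc n (cos p.1) * (spread alpha (cos p.1) - 1)| <= G (cos p.1).
  rewrite normrM ger0_norm ?kernel_trunc_ge0// (le_trans _ (dom _ (cos1 p)))//.
  by rewrite ler_wpM2r// kernel_trunc_le.
have H2 (p : T2) : kernel_trunc n (cos p.1) * (spread alpha (cos p.1) - 1)
    @[n --> \oo] --> kb (cos p.1) * (spread alpha (cos p.1) - 1).
  by apply: cvgM; [exact: kernel_trunc_cvg|exact: cvg_cst].
have mm n : measurable_fun setT (fun p : T2 => kernel_trunc n (cos p.1) * (spread alpha (cos p.1) - 1)).
  exact: measurable_funM (measurableT_comp (mtrunc n) mc) (measurableT_comp mphi mc).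
have [mlim ilim cv] := @dominated_cvg_Rintegral _ T2 R surf _ _ _ mm iG H1 H2.
have -> : lambda_alpha b alpha = \int[surf]_p (kb (cos p.1) * (spread alpha (cos p.1) - 1)).
  rewrite (surface_cos (F := fun x => kb x * (spread alpha x - 1)))//; last first.
    exact: measurable_funM.
  rewrite /lambda_alpha; congr (_ * _).
  rewrite [LHS]Rintegral_mkcond [RHS]Rintegral_mkcond; apply: eq_Rintegral => x _.
  rewrite !patchE !mem_setE !in_itv/=.
  have pi0 := pi_gt0 R.
  case: ifPn => [/andP[x0 xp]|].
    have xpi : x <= pi by lra.
    rewrite x0 xpi/=; have [->|xn0] := eqVneq x 0; first by rewrite sin0 !(mulr0, mul0r).
    have x00 : 0 < x by rewrite lt_def xn0.
    have cx1 : cos x < 1 by rewrite -cos0 ltr_cos ?in_itv/= ?lexx ?pi_ge0 ?xpi ?(ltW x00).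
    have pw y : 0 <= y -> y `^ alpha = (y ^+ 2) `^ (alpha / 2).
      by move=> y0; rewrite -powR_mulrn// -powRrM mulrC mulfVK.
    rewrite /kernel_ext cos_geN1 cx1/= /spread half_cos2_cos half_sin2_cos -!pw; first by ring.
      by apply: sin_ge0_pi; lra.
    by apply: cos_ge0_pihalf; lra.
  move=> xn; case: ifPn => // /andP[x0 xpi].
  have xp : pi / 2 < x by move: xn; rewrite x0/= -ltNge.
  have cn := cos_lt0_pihalf xp xpi; have [_ _ bs] := b_kernel.
  rewrite /kernel_ext cos_geN1/=; case: ifP => _; last by rewrite !mul0r.
  by rewrite bs ?mul0r// cos_geN1.
apply: cvg_trans cv; apply: near_eq_cvg; near=> n.
have zb := zonal_cos_integrable (zonal_beta (bounded_kernel_trunc n) (kernel_trunc_ge0 n)).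
have zs := zonal_cos_integrable (zonal_spread alpha_gt0 (bounded_kernel_trunc n) (kernel_trunc_ge0 n)).
rewrite /growth_rate /zonal_mass -RintegralB//; apply: eq_Rintegral => p _.
by rewrite mulrBr mulr1.
Unshelve. all: by end_near. Qed.

Section rhs.
Variables (f : 'rV[R]_3 -> R[i]) (M : R) (xi : 'rV[R]_3).
Hypotheses (fK : is_char_fun f) (M0 : 0 <= M) (f1 : alpha_close alpha M f (fun=> 1)).
Hypothesis xi0 : xi != 0.

(** The kernel and its extension differ only where [sphere_dot] is 1; there
    [xi+ = xi] and [xi- = 0], and the second factor vanishes. *)
Let integrandE (p : T2) : collision_integrand b f xi (sphere_point p) =
  (kb (sphere_dot (direction xi) p))%:C * collision_defect f xi p.
Proof.
rewrite /collision_integrand dot_enorm_direction dot_sphere mulrAC divff ?enorm_eq0// mul1r.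
set c := sphere_dot _ p.
have := sphere_dot_le1 p (dot_direction xi); rewrite -/c ler_norml => /andP[c1 c2].
rewrite /kernel_ext c1/=; have [//|c1'] := ltrP c 1.
have {}c1' : c = 1 by apply/eqP; rewrite eq_le c2.
have xm : xi_minus xi (sphere_point p) = 0.
  apply/eqP; rewrite -enorm_eq0 -[enorm _]powRr1 ?enorm_ge0// enorm_xi_minus -/c c1'.
  by rewrite /half_sin2 subrr mul0r powR0 ?mulr0// div1r invr_eq0.
have xp : xi_plus xi (sphere_point p) = xi.
  by rewrite -[RHS](xi_plusDminus xi (sphere_point p)) xm addr0.
by rewrite /collision_defect xm xp subrr !mulr0.
Qed.

Let surf_int : surface_integrable (fun p : T2 =>
  (kb (sphere_dot (direction xi) p))%:C * collision_defect f xi p).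
Proof.
by have [] := collision_integrand_integrable alpha_gt0 mkb kb0 (zonal_kernel a4) xi fK M0 f1.
Qed.

Let Re_sin (z : R[i]) (r : R) : complex.Re (z * r%:C) = complex.Re z * r.
Proof. by rewrite mulrC Re_realM mulrC. Qed.
Let Im_sin (z : R[i]) (r : R) : complex.Im (z * r%:C) = complex.Im z * r.
Proof. by rewrite mulrC Im_realM mulrC. Qed.

Lemma collision_rhsE : collision_rhs b f xi = collision_op kb f xi.
Proof.
rewrite /collision_rhs /collision_op (negbTE xi0).
have [mR mI] := measurable_weight (direction xi) mkb (bounded_complex_defect xi fK).
rewrite /sphere_integral /cintegral /surface_cintegral.
congr (_ +i* _); rewrite Rintegral_surface//; apply: eq_Rintegral => p _.
  by rewrite integrandE Re_sin.
by rewrite integrandE Im_sin.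
Qed.

Lemma collision_sphere_integrable : sphere_integrable (collision_integrand b f xi).
Proof.
have [mR mI] := measurable_weight (direction xi) mkb (bounded_complex_defect xi fK).
have ms := proj1 (bounded_measurable_sin1 R).
have main (F : T2 -> R) : measurable_fun setT F -> surf.-integrable setT (EFin \o F) ->
    (@lebesgue2 R).-integrable (@sphere_chart R) (fun p => (F p * sin p.1)%:E).
  move=> mF /integrableP[_ iF]; apply/integrableP; split.
    by apply: measurable_funTS; apply/measurable_EFinP; exact: measurable_funM.
  apply: le_lt_trans iF; rewrite le_eqVlt; apply/orP; left; apply/eqP.
  have -> : (\int[surf]_x `|(EFin \o F) x| = \int[surf]_x (`|F x|)%:E)%E by [].
  rewrite integral_surface; last exact: measurableT_comp.
  apply: eq_integral => p /set_mem[/=]; rewrite in_itv/= => h _.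
  by rewrite normrM (ger0_norm (sin_ge0_pi h)).
split.
  have := main _ mR (proj1 surf_int); congr (_.-integrable _ _).
  by apply/funext => p; rewrite integrandE Re_sin.
have := main _ mI (proj2 surf_int); congr (_.-integrable _ _).
by apply/funext => p; rewrite integrandE Im_sin.
Qed.

End rhs.

End truncated_kernels.

(** * One-sided derivatives of complex curves *)

Section one_sided_calculus.
Variable R : realType.

Lemma near_dist (t d : R) : 0 < d -> \forall u \near t, `|t - u| < d.
Proof. by move=> d0; apply/nbhs_ballP; exists d => //= u; rewrite -ball_normE. Qed.

Lemma ccvg_within_intro (A : set R) (t : R) (f : R -> R[i]) l :
  (forall e : R, 0 < e -> exists2 d : R, 0 < d &
    forall u, `|u - t| < d -> A u -> normc (f u - l) <= e) ->
  ccvg (within A (nbhs t)) f l.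
Proof.
move=> H; rewrite /ccvg; apply/cvgrPdist_le => e e0.
have [d d0 dP] := H e e0; rewrite near_withinE; near=> u => Au.
rewrite sub0r normrN ger0_norm ?normc_ge0//; apply: dP => //.
Unshelve. all: by end_near. Qed.

Lemma ccvg_within_elim (A : set R) (t : R) (f : R -> R[i]) l :
  ccvg (within A (nbhs t)) f l ->
  forall e : R, 0 < e -> exists2 d : R, 0 < d &
    forall u, `|u - t| < d -> A u -> normc (f u - l) <= e.
Proof.
move=> /cvgrPdist_le H e e0; have := H e e0.
rewrite near_withinE => /nbhs_ballP[d /= d0 dP]; exists d => // u ut Au.
have := dP u; rewrite -ball_normE /= distrC => /(_ ut Au).
by rewrite sub0r normrN ger0_norm ?normc_ge0.
Qed.

Lemma is_derive1_intro (g : R -> R) (r l : R) :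
  (forall e : R, 0 < e -> exists2 d : R, 0 < d &
    forall u, `|u - r| < d -> u <> r -> `|(g u - g r) / (u - r) - l| <= e) ->
  is_derive r (1 : R) g l.
Proof.
move=> H.
have cv : h^-1 *: ((g \o shift r) (h *: (1 : R)) - g r) @[h --> (0 : R)^'] --> l.
  apply/cvgrPdist_le => e e0; have [d d0 dP] := H e e0.
  rewrite /dnbhs near_withinE; near=> h => h0.
  have := dP (h + r); rewrite addrK => hP.
  rewrite distrC /= [h *: 1]mulr1 [_^-1 *: _]mulrC; apply: hP.
    rewrite -[h]subr0 distrC; near: h; exact: near_dist.
  by move=> hr; move/eqP: h0; apply; apply: (addIr r); rewrite hr add0r.
split; first by apply/cvg_ex; exists l.
exact: cvg_lim cv.
Unshelve. all: by end_near. Qed.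

Definition quotient (f : R -> R[i]) t u : R[i] := (f u - f t) / (u - t)%:C.

Lemma quotientE f t u (k : R[i]) : u <> t ->
  normc (quotient f t u - k) * `|u - t| = normc (f u - f t - (u - t)%:C * k).
Proof.
move=> ut; have ut0 : u - t != 0 by rewrite subr_eq0; apply/eqP.
have utC : (u - t)%:C != 0 :> R[i] by rewrite (_ : 0 = 0%:C)// (inj_eq (@complexI R)).
rewrite -[X in _ * X](normc_real) -ComplexField.Normc.normcM; congr normc.
by rewrite /quotient mulrBl mulfVK// (mulrC k).
Qed.

(** The real mean value theorem is applied to the component of [f] in each
    direction of the complex plane; it asks for derivatives at interior points
    and for continuity at the ends, where the derivative may be one-sided. *)
Lemma curve_mean_value (f df : R -> R[i]) (s t Bd : R) (k : R[i]) :
  0 <= s -> s <= t -> 0 <= Bd ->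
  (forall c, s <= c <= t ->
     ccvg (within [set u : R | 0 <= u /\ u <> c] (nbhs c))
       (fun u => (f u - f c) / (u - c)%:C) (df c)) ->
  (forall c, s <= c <= t -> normc (df c - k) <= Bd) ->
  normc (f t - f s - (t - s)%:C * k) <= (t - s) * Bd.
Proof.
move=> s0 st Bd0 H dfB; have ts : 0 <= t - s by rewrite subr_ge0.
apply: normc_le_directions => [|a b ab]; first exact: mulr_ge0.
pose lin (z : R[i]) := a * complex.Re z + b * complex.Im z.
have linB z1 z2 : lin (z1 - z2) = lin z1 - lin z2.
  by rewrite /lin ReB ImB; ring.
have linZ (r : R) z : lin (r%:C * z) = r * lin z.
  by case: z => x y; rewrite /lin /=; ring.
have lin_le z : `|lin z| <= normc z.
  rewrite ler_norml; apply/andP; split; last exact: normc_direction.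
  have ab' : (- a) ^+ 2 + (- b) ^+ 2 = 1 by rewrite !sqrrN.
  have := normc_direction z ab'; rewrite /lin => h; lra.
pose g r := lin (f r).
have gq c u : u <> c -> (g u - g c) / (u - c) = lin ((f u - f c) / (u - c)%:C).
  move=> uc; have uc0 : u - c != 0 by rewrite subr_eq0; apply/eqP.
  by rewrite /g -linB mulrC -fmorphV [in RHS]mulrC linZ.
have dg c : s < c -> c < t -> is_derive c (1 : R) g (lin (df c)).
  move=> sc ct; apply: is_derive1_intro => e e0.
  have [|d d0 dP] := ccvg_within_elim (H c _) e0; first by rewrite !ltW.
  exists (Num.min d c); first by rewrite lt_min d0 (le_lt_trans s0).
  move=> u; rewrite lt_min => /andP[ud uc] un.
  rewrite gq// -linB (le_trans (lin_le _))// dP//; split => //.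
  by move: uc; rewrite ltr_norml => /andP[]; lra.
have cg : {within `[s, t], continuous g}.
  apply/subspace_continuousP => c /=; rewrite in_itv/= => cst.
  have c0 : 0 <= c by case/andP: cst => /(le_trans s0).
  have [d d0 dP] := ccvg_within_elim (H c cst) ltr01.
  apply/cvgrPdist_le => e e0; rewrite near_withinE; near=> u => /=; rewrite in_itv/= => ust.
  have u0 : 0 <= u by case/andP: ust => /(le_trans s0).
  have [->|/eqP uc] := eqVneq u c; first by rewrite subrr normr0 ltW.
  rewrite distrC /g -linB (le_trans (lin_le _))//.
  have ud : `|u - c| < d.
    by rewrite distrC; near: u; exact: near_dist.
  have := dP u ud (conj u0 uc); rewrite -/(quotient f c u) => q1.
  have := quotientE f (df c) uc.
  have q0 := quotientE f 0 uc; rewrite mulr0 !subr0 in q0.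
  move=> _; rewrite -q0.
  have qn : normc (quotient f c u) <= 1 + normc (df c).
    have := normc_dist_trans (df c) (quotient f c u) 0; rewrite !subr0 => h.
    by rewrite (le_trans h)// lerD2r.
  have ue : `|u - c| <= e / (1 + normc (df c)).
    rewrite ltW// distrC; near: u; apply: near_dist.
    by rewrite divr_gt0// ltr_pwDl// normc_ge0.
  rewrite (le_trans (ler_pM (normc_ge0 _) (normr_ge0 _) qn ue))//.
  by rewrite mulrC mulfVK// gt_eqF// ltr_pwDl// normc_ge0.
have [c /[!in_itv]/= cst gE] : exists2 c, c \in `[s, t] & g t - g s = lin (df c) * (t - s).
  by apply: MVT_segment => // c; rewrite in_itv/= => /andP[sc ct]; exact: dg.
rewrite -/(lin _) 2!linB linZ -/(g t) -/(g s) gE mulrC -mulrBr -linB ler_wpM2l//.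
by rewrite (le_trans (ler_norm _))// (le_trans (lin_le _))// dfB.
Unshelve. all: by end_near. Qed.

End one_sided_calculus.

(** * Evolution equations approximated by Euler schemes *)

Section complex_sequences.
Variable R : realType.
Implicit Types (z : nat -> R[i]) (c l : R[i]) (a : R).

Lemma normc_limit_le z l c a (N0 : nat) :
  (forall n, (N0 <= n)%N -> normc (z n - c) <= a) ->
  normc (z n - l) @[n --> \oo] --> (0 : R) -> normc (l - c) <= a.
Proof.
move=> za zl; apply/ler_addgt0Pr => e e0.
move/cvgrPdist_lt : zl => /(_ _ e0)[N _ NP].
have := NP (maxn N N0) (leq_maxl _ _); rewrite sub0r normrN ger0_norm ?normc_ge0// => h.
rewrite (le_trans (normc_dist_trans (z (maxn N N0)) l c))// (normc_distC l) addrC.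
by rewrite lerD ?za ?leq_maxr// ltW.
Qed.

Lemma cvg_of_rate (x : nat -> R) (y : R) (r : nat -> R) : (forall n, `|x n - y| <= r n) ->
  r n @[n --> \oo] --> (0 : R) -> x n @[n --> \oo] --> y.
Proof.
move=> xr r0; apply/cvgrPdist_le => e e0.
move/cvgrPdist_lt : r0 => /(_ _ e0)[N _ NP]; exists N => // n Nn.
rewrite distrC (le_trans (xr n))// (le_trans (ler_norm _))//.
by have := NP n Nn; rewrite sub0r normrN => /ltW.
Qed.

Lemma complex_cauchy_limit z (r : nat -> R) : r n @[n --> \oo] --> (0 : R) ->
  (forall n m, (n <= m)%N -> normc (z m - z n) <= r n) ->
  exists l, normc (z n - l) @[n --> \oo] --> (0 : R).
Proof.
move=> r0 zr.
have real_limit (x : nat -> R) : (forall n m, (n <= m)%N -> `|x m - x n| <= r n) ->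
    exists y : R, x n @[n --> \oo] --> y.
  move=> xr; suff : cvgn x by move=> h; exists (limn x).
  apply: cauchy_cvg; apply: cauchy_exP => e e0.
  move/cvgrPdist_lt : r0 => /(_ _ e0)[N _ NP]; exists (x N); exists N => // n Nn.
  rewrite /= -ball_normE /= distrC (le_lt_trans (xr _ _ Nn))//.
  have := NP N (leqnn N); rewrite sub0r normrN => h.
  by rewrite (le_lt_trans (ler_norm _))//.
have [|a za] := real_limit (fun n => complex.Re (z n)).
  by move=> n m nm; rewrite -ReB (le_trans (Re_le_normc _))// zr.
have [|c zc] := real_limit (fun n => complex.Im (z n)).
  by move=> n m nm; rewrite -ImB (le_trans (Im_le_normc _))// zr.
exists (a +i* c).
apply: (cvg_of_rate (r := fun n => `|complex.Re (z n) - a| + `|complex.Im (z n) - c|)).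
  move=> n; rewrite subr0 ger0_norm ?normc_ge0// (le_trans (normc_le_ReIm _))//.
  by rewrite ReB ImB.
have n0 (x : nat -> R) (y : R) : x n @[n --> \oo] --> y -> `|x n - y| @[n --> \oo] --> (0 : R).
  move=> xy; have -> : (0 : R) = `|y - y| by rewrite subrr normr0.
  by apply: cvg_norm; apply: cvgB => //; exact: cvg_cst.
by rewrite -[X in _ --> X](addr0 0); apply: cvgD; exact: n0.
Qed.

Lemma le_of_cvg (x : R) (r : nat -> R) (l : R) : (forall n, x <= r n) ->
  r n @[n --> \oo] --> l -> x <= l.
Proof.
move=> xr rl; rewrite -(cvg_lim _ rl)//; apply: limr_ge; first by apply/cvg_ex; exists l.
exact: nearW.
Qed.

End complex_sequences.

Section truncated_evolution.
Variables (R : realType) (T : Type) (w : T -> R).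
Hypothesis w_ge0 : forall x, 0 <= w x.
Local Notation state := (T -> R[i]).
Implicit Types (f g : state) (D M h t : R).

Definition wclose D f g := forall x, normc (f x - g x) <= D * w x.

Lemma wclose_le D1 D2 f g : D1 <= D2 -> wclose D1 f g -> wclose D2 f g.
Proof. by move=> D12 fg x; rewrite (le_trans (fg x))// ler_wpM2r. Qed.

Lemma wclose_sym D f g : wclose D f g -> wclose D g f.
Proof. by move=> fg x; rewrite normc_distC. Qed.

Lemma wclose_trans g D1 D2 f g' : wclose D1 f g -> wclose D2 g g' ->
  wclose (D1 + D2) f g'.
Proof.
by move=> fg gh x; rewrite (le_trans (normc_dist_trans (g x) _ _))// mulrDl lerD.
Qed.

Lemma wclose_refl f : wclose 0 f f.
Proof. by move=> x; rewrite subrr ComplexField.Normc.normc0 mul0r. Qed.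

Variables (K : set state) (B : state -> state) (Bn : nat -> state -> state).
Variables (eps L gam lam : nat -> R) (lambda : R).
Local Notation one := (fun=> 1 : R[i]).
Definition euler n h f : state := fun x => f x + h%:C * Bn n f x.

(** [K] is the class preserved by Euler steps, [w] the weight that defines the
    distance, and [eps], [L], [gam], [lam] are the truncation error, the
    Lipschitz constant, the mass and the growth rate of the n-th operator. *)
Hypothesis K1 : K one.
Hypothesis eps_ge0 : forall n, 0 <= eps n.
Hypothesis eps_noninc : forall n m, (n <= m)%N -> eps m <= eps n.
Hypothesis eps_cvg : eps n @[n --> \oo] --> (0 : R).
Hypothesis L_ge0 : forall n, 0 <= L n.
Hypothesis lam_cvg : lam n @[n --> \oo] --> lambda.
Hypothesis trunc : forall n M f, K f -> 0 <= M -> wclose M f one ->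
  wclose (eps n * M) (B f) (Bn n f).
Hypothesis lip : forall n D f g, K f -> K g -> 0 <= D -> wclose D f g ->
  wclose (L n * D) (Bn n f) (Bn n g).
Hypothesis Bn1 : forall n x, Bn n one x = 0.
Hypothesis contr : forall n h D f g, K f -> K g -> 0 <= D -> wclose D f g ->
  0 <= h -> h * gam n <= 1 ->
  wclose (expR (h * lam n) * D) (euler n h f) (euler n h g).
Hypothesis eulerK : forall n h f, K f -> 0 <= h -> h * gam n <= 1 -> K (euler n h f).
Hypothesis closed : forall M (f_ : nat -> state) f, 0 <= M ->
  (forall n, K (f_ n)) -> (forall n, wclose M (f_ n) one) ->
  (forall x, normc (f_ n x - f x) @[n --> \oo] --> (0 : R)) -> K f.

Lemma lam_bounded : exists2 Lam, 0 <= Lam & forall n, lam n <= Lam.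
Proof.
have [M [_ hM]] := cvg_seq_bounded (cvgP _ lam_cvg).
exists (`|M| + 1) => [|n]; first by rewrite addr_ge0.
rewrite (le_trans (ler_norm _))//; apply: (hM (`|M| + 1)) => //.
by rewrite (le_lt_trans (ler_norm _))// ltrDl.
Qed.

Definition op_bound := 2 * eps 0 + L 0.

Lemma op_bound_ge0 : 0 <= op_bound. Proof. by rewrite addr_ge0// mulr_ge0. Qed.

Lemma Bn0_bound n f M : K f -> 0 <= M -> wclose M f one -> wclose (L n * M) (Bn n f) (fun=> 0).
Proof. by move=> fK M0 f1 x; have := lip n fK K1 M0 f1 x; rewrite Bn1. Qed.

Lemma B_bound f M : K f -> 0 <= M -> wclose M f one -> wclose (op_bound * M) (B f) (fun=> 0).
Proof.
move=> fK M0 f1; apply: wclose_le (wclose_trans (trunc 0 fK M0 f1) (Bn0_bound 0 fK M0 f1)).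
by rewrite -mulrDl ler_wpM2r// /op_bound lerD// mulrDl mul1r lerDl.
Qed.

Lemma Bn_bound n f M : K f -> 0 <= M -> wclose M f one -> wclose (op_bound * M) (Bn n f) (fun=> 0).
Proof.
move=> fK M0 f1.
have h := wclose_trans (wclose_sym (trunc n fK M0 f1))
  (wclose_trans (trunc 0 fK M0 f1) (Bn0_bound 0 fK M0 f1)).
apply: wclose_le h; rewrite -!mulrDl ler_wpM2r// /op_bound addrA lerD//.
by rewrite mulrDl !mul1r lerD// eps_noninc.
Qed.

(** Consistency with [B], locally uniform in time.  Taking [q] large and then
    [t - s] small makes the error negligible with respect to [t - s].  The
    estimate passes to limits and involves no derivative. *)
Definition mild (u : R -> state) := forall Tm, 0 <= Tm -> exists M, [/\ 0 <= M,
  forall t, 0 <= t <= Tm -> K (u t) /\ wclose M (u t) one &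
  forall q s t, 0 <= s -> s <= t -> t <= Tm ->
    wclose ((t - s) * (2 * eps q * M + L q * M * (t - s)))
      (fun x => u t x - u s x) (fun x => (t - s)%:C * B (u s) x)].

Section stability.
Variables (u v : R -> state).
Hypotheses (um : mild u) (vm : mild v).

(** Local error of the n-th Euler scheme along a mild curve: the consistency
    error for [q = n], plus [h (B - B_n)]. *)
Lemma mild_euler M n s h x : K (u s) -> 0 <= M -> wclose M (u s) one -> 0 <= h ->
   wclose (h * (2 * eps n * M + L n * M * h))
      (fun x => u (s + h) x - u s x) (fun x => h%:C * B (u s) x) ->
  normc (u (s + h) x - euler n h (u s) x) <= h * (M * (3 * eps n + L n * h)) * w x.
Proof.
move=> uK M0 u1 h0 /(_ x) H; have tr := trunc n uK M0 u1 x.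
have -> : u (s + h) x - euler n h (u s) x =
  (u (s + h) x - u s x - h%:C * B (u s) x) + h%:C * (B (u s) x - Bn n (u s) x).
  by rewrite /euler; ring.
rewrite (le_trans (le_normcD _ _))// normc_realM//.
rewrite (le_trans (lerD H (ler_wpM2l h0 tr)))//.
by rewrite le_eqVlt; apply/orP; left; apply/eqP; ring.
Qed.

End stability.

(** For each [n] both curves are compared with Euler steps of size [h = t / N];
    the local errors are at most [c] and accumulate to [N c exp (t Lam)].  The
    choice of [N] makes [h gam] at most 1 and [L h] at most [1 / (n + 1)], and
    [n] tends to infinity. *)
Lemma mild_stability (u v : R -> state) D t : mild u -> mild v -> 0 <= D ->
  wclose D (u 0) (v 0) -> 0 <= t -> wclose (expR (lambda * t) * D) (u t) (v t).
Proof.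
move=> um vm D0 uv0 t0.
have [Mu [Mu0 uK uc]] := um _ t0; have [Mv [Mv0 vK vc]] := vm _ t0.
have [Lam Lam0 lamL] := lam_bounded.
pose rho n := expR (t * lam n) * D + t * ((Mu + Mv) * (3 * eps n + n.+1%:R^-1)) * expR (t * Lam).
have main n : wclose (rho n) (u t) (v t).
  pose X := t * (`|gam n| + L n * n.+1%:R).
  have X0 : 0 <= X by rewrite mulr_ge0// addr_ge0// mulr_ge0.
  pose N := (Num.truncn X).+1.
  have N0 : 0 < N%:R :> R by rewrite ltr0n.
  have XN : X <= N%:R by rewrite ltW// truncnS_gt.
  pose h := t / N%:R; have h0 : 0 <= h by rewrite divr_ge0// ltW.
  have hN : h * N%:R = t by rewrite mulfVK// gt_eqF.
  have hg : h * gam n <= 1.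
    rewrite (le_trans (ler_wpM2l h0 (ler_norm _)))// /h mulrAC ler_pdivrMr// mul1r.
    by rewrite (le_trans _ XN)// /X mulrDr lerDl !mulr_ge0.
  have hL : L n * h <= n.+1%:R^-1.
    rewrite -[leRHS]mul1r ler_pdivlMr// /h mulrA mulrAC ler_pdivrMr// mul1r.
    rewrite (le_trans _ XN)// /X mulrDr.
    by rewrite (_ : L n * t * n.+1%:R = t * (L n * n.+1%:R)) ?lerDr ?mulr_ge0//; ring.
  pose E := expR (h * lam n); pose F := expR (h * Lam).
  have EF : E <= F by rewrite ler_expR ler_wpM2l.
  have F1 : 1 <= F by rewrite -expR0 ler_expR mulr_ge0.
  have E0 : 0 <= E by exact: expR_ge0.
  pose c := h * ((Mu + Mv) * (3 * eps n + L n * h)).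
  have c0 : 0 <= c by rewrite /c !mulr_ge0 ?addr_ge0 ?mulr_ge0.
  have step k : (k <= N)%N ->
      wclose (E ^+ k * D + k%:R * c * F ^+ k) (u (h *+ k)) (v (h *+ k)).
    elim: k => [_|k ih kN].
      by rewrite !mulr0n mul1r !mul0r addr0.
    have hk0 : 0 <= h *+ k by rewrite mulrn_wge0.
    have hk1 : h *+ k + h <= t by rewrite -mulrSr -[leRHS]hN -[leLHS]mulr_natr; apply: ler_wpM2l => //; rewrite ler_nat.
    have hkt : 0 <= h *+ k <= t by rewrite hk0/= (le_trans _ hk1)// lerDl.
    have hd : h *+ k + h - h *+ k = h by rewrite addrC addrA addNr add0r.
    have [uKk u1k] := uK _ hkt; have [vKk v1k] := vK _ hkt.
    have uc' := uc n (h *+ k) (h *+ k + h) hk0 _ hk1; rewrite hd lerDl in uc'.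
    have vc' := vc n (h *+ k) (h *+ k + h) hk0 _ hk1; rewrite hd lerDl in vc'.
    have D'0 : 0 <= E ^+ k * D + k%:R * c * F ^+ k.
      have F0 : 0 <= F by exact: expR_ge0.
      exact: addr_ge0 (mulr_ge0 (exprn_ge0 k E0) D0)
        (mulr_ge0 (mulr_ge0 (ler0n _ k) c0) (exprn_ge0 k F0)).
    have ct := contr uKk vKk D'0 (ih (ltnW kN)) h0 hg.
    rewrite -/E in ct.
    move=> x; rewrite mulrSr.
    have ue := mild_euler x uKk Mu0 u1k h0 (uc' h0).
    have ve := mild_euler x vKk Mv0 v1k h0 (vc' h0).
    rewrite (le_trans (normc_dist_trans (euler n h (u (h *+ k)) x) _ _))//.
    have h2 := normc_dist_trans (euler n h (v (h *+ k)) x) (euler n h (u (h *+ k)) x) (v (h *+ k + h) x).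
    rewrite normc_distC in ve.
    rewrite (le_trans (lerD ue (le_trans h2 (lerD (ct x) ve))))//.
    rewrite [X in X <= _](_ : _ = (E * (E ^+ k * D + k%:R * c * F ^+ k) + c) * w x); last first.
      by rewrite /c; ring.
    rewrite ler_wpM2r// mulrDr mulrA -exprS -addrA lerD2l -natr1.
    have kc0 : 0 <= k%:R * c by rewrite mulr_ge0.
    have Fk : 1 <= F ^+ k.+1 by exact: exprn_ege1.
    have i1 : E * (k%:R * c * F ^+ k) <= k%:R * c * F ^+ k.+1.
      have F0 : 0 <= F ^+ k by rewrite exprn_ge0// expR_ge0.
      have := ler_wpM2l kc0 (ler_wpM2r F0 EF); rewrite -exprS; apply: le_trans.
      by rewrite mulrA (mulrC E) -mulrA.
    have i2 : c <= c * F ^+ k.+1 by rewrite ler_peMr.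
    by rewrite (le_trans (lerD i1 i2))// le_eqVlt; apply/orP; left; apply/eqP; ring.
  have hNn : h *+ N = t by rewrite -[LHS]mulr_natr.
  have := step N (leqnn N); rewrite hNn; apply: wclose_le.
  have expN r : expR (h * r) ^+ N = expR (t * r).
    by rewrite -expRM_natl mulrC -hN; congr expR; ring.
  rewrite /rho /E /F !expN lerD2l ler_wpM2r ?expR_ge0//.
  have -> : N%:R * c = t * ((Mu + Mv) * (3 * eps n + L n * h)) by rewrite /c -hN; ring.
  by rewrite ler_wpM2l// ler_wpM2l ?addr_ge0// lerD2l.
move=> x; have H n := main n x.
apply: (le_of_cvg H); apply: cvgMl.
have -> : expR (lambda * t) * D =
    expR (t * lambda) * D + t * ((Mu + Mv) * (3 * 0 + 0)) * expR (t * Lam).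
  by rewrite mulr0 addr0 !mulr0 mul0r addr0 (mulrC t).
apply: cvgD.
  apply: cvgMl; apply: continuous_cvg; first exact: continuous_expR.
  exact: cvgMr.
apply: cvgMl; apply: cvgMr; apply: cvgMr; apply: cvgD; first exact: cvgMr.
exact: cvg_harmonic.
Qed.

Local Notation S n h := (euler n h).

Lemma euler1 n h : S n h one = one.
Proof. by apply/funext => x; rewrite /euler Bn1 mulr0 addr0. Qed.

Lemma iter_eulerK n h f k : K f -> 0 <= h -> h * gam n <= 1 -> K (iter k (S n h) f).
Proof. by move=> fK h0 hg; elim: k => //= k ih; exact: eulerK. Qed.

Lemma iter_euler_one Lam n h f M k : K f -> 0 <= M -> wclose M f one -> 0 <= h ->
  h * gam n <= 1 -> 0 <= Lam -> lam n <= Lam ->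
  wclose (expR (k%:R * h * Lam) * M) (iter k (S n h) f) one.
Proof.
move=> fK M0 f1 h0 hg L0 lL; elim: k => [|k ih]; first by rewrite !mul0r expR0 mul1r.
have M'0 : 0 <= expR (k%:R * h * Lam) * M by rewrite mulr_ge0// expR_ge0.
have := contr (iter_eulerK k fK h0 hg) K1 M'0 ih h0 hg; rewrite euler1.
apply: wclose_le; rewrite mulrA ler_wpM2r// -expRD ler_expR -natr1.
have : h * lam n <= h * Lam by rewrite ler_wpM2l.
by rewrite !mulrDl mul1r addrC lerD2l.
Qed.

(** The increments of the Euler iteration sum up; when all the values of the
    operator along the path are close to [c], the path is close to a straight
    line of slope [c]. *)
Lemma euler_path n h g (c : state) beta j : 0 <= h ->
  (forall l, (l < j)%N -> wclose beta (Bn n (iter l (S n h) g)) c) ->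
  wclose (j%:R * h * beta) (fun x => iter j (S n h) g x - g x)
    (fun x => (j%:R * h)%:C * c x).
Proof.
move=> h0; elim: j => [_ x|j ih H x].
  by rewrite (_ : iter 0 _ g x = g x)// !mul0r !subrr ComplexField.Normc.normc0.
have -> : iter j.+1 (S n h) g x - g x - (j.+1%:R * h)%:C * c x =
  (iter j (S n h) g x - g x - (j%:R * h)%:C * c x) + h%:C * (Bn n (iter j (S n h) g) x - c x).
  by rewrite iterS /euler -natr1 mulrDl mul1r rmorphD/=; ring.
rewrite (le_trans (le_normcD _ _))// normc_realM//.
have h1 := ih (fun l lj => H l (leqW lj)) x.
rewrite (le_trans (lerD h1 (ler_wpM2l h0 (H j (ltnSn j) x))))//.
by rewrite -natr1 le_eqVlt; apply/orP; left; apply/eqP; ring.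
Qed.

Section existence.
Variables (f0 : state) (M0 : R) (Lam : R).
Hypotheses (f0K : K f0) (M00 : 0 <= M0) (f01 : wclose M0 f0 one).
Hypotheses (Lam0 : 0 <= Lam) (lamL : forall n, lam n <= Lam).

(** The step of the n-th scheme is [2 ^ - step_exp n].  The sum makes the
    exponents monotone, so that the grids are nested, and its last term makes
    the step small with respect to the constants of the n-th operator. *)
Definition step_exp n : nat :=
  \sum_(i < n.+1) (Num.truncn (i.+1%:R * (`|gam i| + L i + 1))).+1.
Definition step_size n : R := (2 ^ step_exp n)%:R^-1.
Local Notation p := step_exp.
Local Notation hh := step_size.

Lemma step_exp_mono n m : (n <= m)%N -> (p n <= p m)%N.
Proof.
elim: m => [|m ih]; first by rewrite leqn0 => /eqP ->.
rewrite leq_eqVlt => /orP[/eqP ->//|]; rewrite ltnS => /ih h.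
by rewrite (leq_trans h)// /p [leqRHS]big_ord_recr/= leq_addr.
Qed.

Lemma step_size_gt0 n : 0 < hh n.
Proof. by rewrite invr_gt0 ltr0n expn_gt0. Qed.

Let step_size_ge0 n : 0 <= hh n. Proof. exact: ltW (step_size_gt0 n). Qed.

Lemma step_size_inv n : n.+1%:R * (`|gam n| + L n + 1) <= (2 ^ p n)%:R :> R.
Proof.
rewrite ltW// (lt_le_trans (truncnS_gt _))// ler_nat.
rewrite (leq_trans _ (ltnW (ltn_expl _ _)))// /p big_ord_recr/= leq_addl//.
Qed.

Lemma step_size_bound n y : 0 <= y -> y <= `|gam n| + L n + 1 -> hh n * y <= n.+1%:R^-1.
Proof.
move=> y0 yn; rewrite /hh mulrC ler_pdivrMr ?ltr0n ?expn_gt0// mulrC -ler_pdivrMr ?invr_gt0//.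
rewrite invrK mulrC (le_trans _ (step_size_inv n))// ler_wpM2l//.
Qed.

Lemma step_size_gam n : hh n * gam n <= 1.
Proof.
rewrite (le_trans (ler_wpM2l (step_size_ge0 n) (ler_norm _)))//.
rewrite (le_trans (step_size_bound (normr_ge0 _) _))//.
  by rewrite -addrA lerDl addr_ge0.
by rewrite invf_le1// ler1n.
Qed.

Lemma step_size_L n : hh n * L n <= n.+1%:R^-1.
Proof. by apply: step_size_bound => //; rewrite addrAC lerDr addr_ge0. Qed.

Lemma step_size_le n : hh n <= n.+1%:R^-1.
Proof. by rewrite -[leLHS]mulr1; apply: step_size_bound => //; rewrite lerDr addr_ge0. Qed.

Definition steps n t : nat := Num.truncn (t * (2 ^ p n)%:R).
Definition approx n t : state := iter (steps n t) (S n (hh n)) f0.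

Lemma steps_le n t : 0 <= t -> (steps n t)%:R * hh n <= t.
Proof.
move=> t0; rewrite /hh ler_pdivrMr ?ltr0n ?expn_gt0//.
by have /andP[] := truncn_itv (mulr_ge0 t0 (ler0n R (2 ^ p n))).
Qed.

Lemma steps_gt n t : 0 <= t -> t < ((steps n t)%:R + 1) * hh n.
Proof.
move=> t0; rewrite /hh ltr_pdivlMr ?ltr0n ?expn_gt0// natr1.
by have /andP[] := truncn_itv (mulr_ge0 t0 (ler0n R (2 ^ p n))).
Qed.

Lemma steps_mono n s t : 0 <= s -> s <= t -> (steps n s <= steps n t)%N.
Proof. by move=> s0 st; apply: le_truncn; rewrite ler_wpM2r. Qed.

Definition ratio n m := (2 ^ (p m - p n))%N.

Lemma ratio_step n m : (n <= m)%N -> (ratio n m)%:R * hh m = hh n.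
Proof.
move=> nm; rewrite /hh.
have -> : (2 ^ p m)%:R = (ratio n m)%:R * (2 ^ p n)%:R :> R.
  by rewrite -natrM /ratio -expnD subnK// step_exp_mono.
by rewrite invfM mulrA divff ?mul1r// pnatr_eq0 -lt0n expn_gt0.
Qed.

(** The number of fine steps before [t] lies between the numbers of fine steps
    that correspond to the coarse steps before and after [t]. *)
Lemma steps_refine n m t : 0 <= t -> (n <= m)%N ->
  (ratio n m * steps n t <= steps m t < ratio n m * (steps n t).+1)%N.
Proof.
move=> t0 nm; set k := ratio n m.
have kE : (2 ^ p m)%:R = k%:R * (2 ^ p n)%:R :> R.
  by rewrite -natrM /k -expnD subnK// step_exp_mono.
have k0 : 0 < k%:R :> R by rewrite ltr0n expn_gt0.
have tm : 0 <= t * (2 ^ p m)%:R by rewrite mulr_ge0.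
have /andP[a1 a2] := truncn_itv (mulr_ge0 t0 (ler0n R (2 ^ p n))).
have /andP[b1 b2] := truncn_itv tm.
apply/andP; split.
  rewrite -ltnS -(ltr_nat R) (le_lt_trans _ b2)// kE natrM mulrCA ler_pM2l//.
rewrite -(ltr_nat R) (le_lt_trans b1)// kE natrM mulrCA ltr_pM2l//.
Qed.

Section horizon.
Variable Tm : R.
Hypothesis Tm0 : 0 <= Tm.
Let M := expR (Tm * Lam) * M0.

Lemma horizon_ge0 : 0 <= M. Proof. by rewrite mulr_ge0// expR_ge0. Qed.

Lemma iter_horizon n h k : 0 <= h -> h * gam n <= 1 -> k%:R * h <= Tm ->
  K (iter k (S n h) f0) /\ wclose M (iter k (S n h) f0) one.
Proof.
move=> h0 hg kh; split; first exact: iter_eulerK.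
apply: wclose_le (iter_euler_one k f0K M00 f01 h0 hg Lam0 (lamL n)).
by rewrite ler_wpM2r// ler_expR ler_wpM2r.
Qed.

Let A1M := op_bound * M.
Let A1M0 : 0 <= A1M. Proof. by rewrite mulr_ge0 ?op_bound_ge0 ?horizon_ge0. Qed.

Lemma iter_add (F : state -> state) a c (f : state) : iter (a + c) F f = iter c F (iter a F f).
Proof. by rewrite addnC iterD. Qed.

Lemma euler_increment n a c : (a + c)%:R * hh n <= Tm ->
  wclose (c%:R * hh n * A1M) (iter (a + c) (S n (hh n)) f0) (iter a (S n (hh n)) f0).
Proof.
move=> ac.
have H l : (l < c)%N ->
    wclose A1M (Bn n (iter l (S n (hh n)) (iter a (S n (hh n)) f0))) (fun=> 0).
  move=> lc.
  have [lK l1] : K (iter (a + l) (S n (hh n)) f0) /\ wclose M (iter (a + l) (S n (hh n)) f0) one.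
    apply: iter_horizon; [exact: step_size_ge0|exact: step_size_gam|].
    by rewrite (le_trans _ ac)// ler_wpM2r// ler_nat leq_add2l ltnW.
  by rewrite -iter_add; apply: Bn_bound l1; first exact: lK; exact: horizon_ge0.
move=> x; have := euler_path (step_size_ge0 n) H x.
by rewrite iter_add mulr0 subr0.
Qed.

Let eta n := 2 * eps n * M + n.+1%:R^-1 * A1M.

Lemma eta_ge0 n : 0 <= eta n.
Proof.
have M_ge0 := horizon_ge0.
by apply: addr_ge0; [apply: mulr_ge0 => //; exact: mulr_ge0|apply: mulr_ge0; rewrite ?invr_ge0].
Qed.

(** During one coarse step the fine scheme moves by at most
    [hh n * op_bound * M]; so the fine operator stays close to the value of the coarse
    one at the beginning of the step. *)
Lemma coarse_fine n m a : (n <= m)%N ->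
  let k := ratio n m in
  (a + k)%:R * hh m <= Tm ->
  wclose (hh n * eta n) (iter (a + k) (S m (hh m)) f0) (S n (hh n) (iter a (S m (hh m)) f0)).
Proof.
move=> nm k ak x; set g := iter a _ f0.
have kh : k%:R * hh m = hh n by exact: ratio_step.
have [gK g1] : K g /\ wclose M g one.
  apply: iter_horizon; [exact: step_size_ge0|exact: step_size_gam|].
  by rewrite (le_trans _ ak)// ler_wpM2r// ler_nat leq_addr.
have H l : (l < k)%N -> wclose (eta n) (Bn m (iter l (S m (hh m)) g)) (Bn n g).
  move=> lk; have al : (a + l)%:R * hh m <= Tm.
    by rewrite (le_trans _ ak)// ler_wpM2r// ler_nat leq_add2l ltnW.
  have [lK l1] : K (iter (a + l) (S m (hh m)) f0) /\ wclose M (iter (a + l) (S m (hh m)) f0) one.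
    by apply: iter_horizon; [exact: step_size_ge0|exact: step_size_gam|].
  have inc := euler_increment al; rewrite -/g iter_add -/g in inc lK l1.
  have D0 : 0 <= l%:R * hh m * A1M.
    exact: mulr_ge0 (mulr_ge0 (ler0n _ _) (step_size_ge0 m)) A1M0.
  have h1 := wclose_sym (trunc m lK horizon_ge0 l1).
  have h2 := trunc n lK horizon_ge0 l1.
  have h3 := lip n lK gK D0 inc.
  apply: wclose_le (wclose_trans h1 (wclose_trans h2 h3)).
  rewrite addrA /eta lerD//.
    by rewrite mulr2n -mulrDl ler_wpM2r ?horizon_ge0// mulrDl !mul1r lerD2r eps_noninc.
  rewrite mulrA ler_wpM2r// (le_trans _ (step_size_L n))// mulrC ler_wpM2r//.
  by rewrite -kh ler_wpM2r// ler_nat ltnW.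
have := euler_path (step_size_ge0 m) H x; rewrite kh -iter_add; congr (normc _ <= _).
by rewrite /euler; ring.
Qed.

(** Discrete Gronwall estimate: a local error at each coarse step, transported
    by the contraction property of the coarse scheme. *)
Lemma grid_compare n m i : (n <= m)%N ->
  let k := ratio n m in
  (k * i)%:R * hh m <= Tm ->
  wclose (i%:R * hh n * eta n * expR (hh n * Lam) ^+ i)
    (iter (k * i) (S m (hh m)) f0) (iter i (S n (hh n)) f0).
Proof.
move=> nm k; set F := expR _.
have F1 : 1 <= F by rewrite -expR0 ler_expR mulr_ge0.
have F0 : 0 <= F by exact: expR_ge0.
elim: i => [_|i ih iT].
  by rewrite muln0 !mul0r; exact: wclose_refl.
have iT' : (k * i + k)%:R * hh m <= Tm by rewrite -mulnSr.
have iT0 : (k * i)%:R * hh m <= Tm.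
  by rewrite (le_trans _ iT)// ler_wpM2r// ler_nat leq_mul2l leqnSn orbT.
have cf := coarse_fine nm iT'.
have D0 : 0 <= i%:R * hh n * eta n * F ^+ i.
  exact: mulr_ge0 (mulr_ge0 (mulr_ge0 (ler0n _ i) (step_size_ge0 n)) (eta_ge0 n)) (exprn_ge0 i F0).
have ct := contr (iter_eulerK (k * i) f0K (step_size_ge0 m) (step_size_gam m))
  (iter_eulerK i f0K (step_size_ge0 n) (step_size_gam n)) D0 (ih iT0) (step_size_ge0 n) (step_size_gam n).
rewrite mulnSr iterS; apply: wclose_le (wclose_trans cf ct).
set E := expR (hh n * lam n).
have EF : E <= F by rewrite ler_expR ler_wpM2l.
have he : 0 <= hh n * eta n by rewrite mulr_ge0// eta_ge0.
have Fk : 1 <= F ^+ i.+1 by exact: exprn_ege1.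
have i1 : E * (i%:R * hh n * eta n * F ^+ i) <= i%:R * hh n * eta n * F ^+ i.+1.
  rewrite (le_trans (ler_wpM2r D0 EF))// exprS le_eqVlt; apply/orP; left; apply/eqP; ring.
have i2 : hh n * eta n <= hh n * eta n * F ^+ i.+1 by rewrite ler_peMr.
rewrite (le_trans (lerD i2 i1))// le_eqVlt -natr1; apply/orP; left; apply/eqP; ring.
Qed.

Definition rate n := Tm * eta n * expR (Tm * Lam) + n.+1%:R^-1 * A1M.

Lemma approx_cauchy n m t : 0 <= t <= Tm -> (n <= m)%N ->
  wclose (rate n) (approx m t) (approx n t).
Proof.
move=> /andP[t0 tT] nm; have /andP[k1 k2] := steps_refine t0 nm.
set k := ratio n m in k1 k2; set i := steps n t in k1 k2.
have sm := le_trans (steps_le m t0) tT; have sn := le_trans (steps_le n t0) tT.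
have iT : (k * i)%:R * hh m <= Tm by rewrite (le_trans _ sm)// ler_wpM2r// ler_nat.
have h1 := grid_compare nm iT.
have smE : steps m t = (k * i + (steps m t - k * i))%N by rewrite subnKC.
have h2 : wclose ((steps m t - k * i)%:R * hh m * A1M) (approx m t) (iter (k * i) (S m (hh m)) f0).
  by rewrite /approx [X in iter X]smE; apply: euler_increment; rewrite -smE.
apply: wclose_le (wclose_trans h2 h1); rewrite /rate addrC lerD//.
  have F0 : 0 <= expR (hh n * Lam) by exact: expR_ge0.
  have a0 : 0 <= i%:R * hh n * eta n.
    exact: mulr_ge0 (mulr_ge0 (ler0n _ _) (step_size_ge0 n)) (eta_ge0 n).
  have a1 : i%:R * hh n * eta n <= Tm * eta n by rewrite ler_wpM2r// eta_ge0.
  have a2 : expR (hh n * Lam) ^+ i <= expR (Tm * Lam).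
    by rewrite -expRM_natl ler_expR mulrA ler_wpM2r.
  exact: ler_pM a0 (exprn_ge0 i F0) a1 a2.
rewrite ler_wpM2r// (le_trans _ (step_size_le n))//.
have kh : k%:R * hh m = hh n by exact: ratio_step.
rewrite -kh ler_wpM2r// ler_nat leq_subLR -mulnSr ltnW//.
Qed.

Lemma rate_cvg : rate n @[n --> \oo] --> (0 : R).
Proof.
have -> : (0 : R) = Tm * (2 * 0 * M + 0 * A1M) * expR (Tm * Lam) + 0 * A1M.
  by rewrite !(mul0r, mulr0, addr0).
apply: cvgD; last by apply: cvgMl; exact: cvg_harmonic.
apply: cvgMl; apply: cvgMr; apply: cvgD; last by apply: cvgMl; exact: cvg_harmonic.
by apply: cvgMl; apply: cvgMr.
Qed.

End horizon.

Lemma approx_limit : exists u : R -> state, forall t x, 0 <= t ->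
  normc (approx n t x - u t x) @[n --> \oo] --> (0 : R).
Proof.
have H (tx : R * T) : exists l : R[i], 0 <= tx.1 ->
    normc (approx n tx.1 tx.2 - l) @[n --> \oo] --> (0 : R).
  have [t0|t0] := boolP (0 <= tx.1); last by exists 0.
  have r0 : rate tx.1 n * w tx.2 @[n --> \oo] --> (0 : R).
    by rewrite -[X in _ --> X](mul0r (w tx.2)); apply: cvgMl; exact: rate_cvg.
  have [|l hl] := @complex_cauchy_limit R (fun n => approx n tx.1 tx.2) _ r0.
    by move=> n m nm; apply: approx_cauchy => //; rewrite t0 lexx.
  by exists l.
have [u uP] := choice H.
by exists (fun t x => u (t, x)) => t x t0; exact: (uP (t, x)).
Qed.

Section limit.
Variable u : R -> state.
Hypothesis uP : forall t x, 0 <= t -> normc (approx n t x - u t x) @[n --> \oo] --> (0 : R).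

Lemma limit_rate Tm n t : 0 <= t <= Tm -> wclose (rate Tm n) (approx n t) (u t).
Proof.
move=> tT x; have /andP[t0 tT'] := tT; rewrite normc_distC.
apply: (normc_limit_le (N0 := n) _ (uP x t0)) => m nm.
by apply: approx_cauchy nm _ => //; exact: le_trans tT'.
Qed.

Lemma approx_horizon Tm n t : 0 <= t <= Tm ->
  K (approx n t) /\ wclose (expR (Tm * Lam) * M0) (approx n t) one.
Proof.
move=> /andP[t0 tT]; apply: iter_horizon; [exact: step_size_ge0|exact: step_size_gam|].
by rewrite (le_trans (steps_le n t0)).
Qed.

Lemma limit_horizon Tm t : 0 <= t <= Tm ->
  K (u t) /\ wclose (expR (Tm * Lam) * M0) (u t) one.
Proof.
move=> tT; have /andP[t0 tT'] := tT; split.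
  have h n := approx_horizon n tT.
  apply: (closed (M := expR (Tm * Lam) * M0) (f_ := fun n => approx n t)).
  - by rewrite mulr_ge0// expR_ge0.
  - by move=> n; case: (h n).
  - by move=> n; case: (h n).
  - by move=> x; exact: uP.
move=> x; apply: (normc_limit_le (N0 := 0) _ (uP x t0)) => n _.
by have [_] := approx_horizon n tT; apply.
Qed.

(** The operator along the n-th scheme between [s] and [t] is compared with
    [B (u s)] through the Lipschitz operator of index [q]. *)
Lemma approx_path n q s t Tm (M := expR (Tm * Lam) * M0) : 0 <= s -> s <= t -> t <= Tm ->
  let j := (steps n t - steps n s)%N in
  wclose (j%:R * hh n * (eps n * M + 2 * eps q * M + L q * (j%:R * hh n * (op_bound * M))
     + L q * rate Tm n))
    (fun x => approx n t x - approx n s x) (fun x => (j%:R * hh n)%:C * B (u s) x).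
Proof.
move=> s0 st tT j; set i := steps n s.
have t0 : 0 <= t := le_trans s0 st.
have sT : 0 <= s <= Tm by rewrite s0 (le_trans st).
have M_ge0 : 0 <= M by rewrite mulr_ge0// expR_ge0.
have ij : steps n t = (i + j)%N by rewrite subnKC// steps_mono.
have [uK u1] := limit_horizon sT; have [aK a1] := approx_horizon n sT.
have ijT : (i + j)%:R * hh n <= Tm by rewrite -ij (le_trans (steps_le n t0)).
have A1M0 : 0 <= op_bound * M by rewrite mulr_ge0// op_bound_ge0.
have r0 : 0 <= rate Tm n.
  have Tm0 : 0 <= Tm by rewrite (le_trans s0)//; case/andP: sT.
  by rewrite addr_ge0// mulr_ge0 ?invr_ge0// ?expR_ge0// mulr_ge0// eta_ge0.
have H l : (l < j)%N -> wclose (eps n * M + 2 * eps q * M +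
     L q * (j%:R * hh n * (op_bound * M)) + L q * rate Tm n)
    (Bn n (iter l (S n (hh n)) (approx n s))) (B (u s)).
  move=> lj; have ilT : (i + l)%:R * hh n <= Tm.
    by rewrite (le_trans _ ijT)// ler_wpM2r// ler_nat leq_add2l ltnW.
  have [gK g1] := iter_horizon (step_size_ge0 n) (step_size_gam n) ilT.
  have inc := euler_increment ilT; rewrite !iter_add in inc gK g1.
  have l0 : 0 <= l%:R * hh n * (op_bound * M).
    exact: mulr_ge0 (mulr_ge0 (ler0n _ _) (step_size_ge0 n)) A1M0.
  have e1 := wclose_sym (trunc n gK M_ge0 g1).
  have e2 := trunc q gK M_ge0 g1.
  have e3 := lip q gK aK l0 inc.
  have e4 := lip q aK uK r0 (limit_rate n sT).
  have e5 := wclose_sym (trunc q uK M_ge0 u1).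
  apply: wclose_le (wclose_trans e1 (wclose_trans e2 (wclose_trans e3 (wclose_trans e4 e5)))).
  have lj' : L q * (l%:R * hh n * (op_bound * M)) <= L q * (j%:R * hh n * (op_bound * M)).
    by rewrite ler_wpM2l// ler_wpM2r// ler_wpM2r// ler_nat ltnW.
  lra.
have := euler_path (step_size_ge0 n) H.
by rewrite -iter_add -ij.
Qed.

(** [approx_path] in the limit; [M] is enlarged by the factor [1 + op_bound] in
    order to absorb the speed of the curve. *)
Lemma limit_mild : mild u.
Proof.
move=> Tm Tm0; set M := expR (Tm * Lam) * M0.
have M_ge0 : 0 <= M by rewrite mulr_ge0// expR_ge0.
have A10 := op_bound_ge0; have A1M0 : 0 <= op_bound * M by rewrite mulr_ge0.
exists (M * (1 + op_bound)); split; first by rewrite mulr_ge0// addr_ge0.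
  move=> t tT; have [uK u1] := limit_horizon tT; split => //.
  by apply: wclose_le u1; rewrite ler_peMr// lerDl.
move=> q s t s0 st tT x; have t0 : 0 <= t := le_trans s0 st.
have sT' : 0 <= s <= Tm by rewrite s0 (le_trans st).
have tT' : 0 <= t <= Tm by rewrite t0.
have [uK u1] := limit_horizon sT'.
have bB := B_bound uK M_ge0 u1 x; rewrite subr0 in bB.
pose dt n := n.+1%:R^-1 : R.
pose rho n := 2 * rate Tm n + (t - s + dt n) * (eps n * M + 2 * eps q * M +
   L q * ((t - s + dt n) * (op_bound * M)) + L q * rate Tm n) + dt n * (op_bound * M).
have main n : normc (u t x - u s x - (t - s)%:C * B (u s) x) <= rho n * w x.
  pose j := (steps n t - steps n s)%N; pose kappa := j%:R * hh n.
  have ap := approx_path n q s0 st tT x; rewrite -/j -/kappa -/M in ap.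
  have ut := limit_rate n tT' x; have us := limit_rate n sT' x.
  have r0 : 0 <= rate Tm n.
    by rewrite addr_ge0// mulr_ge0 ?invr_ge0// ?expR_ge0// mulr_ge0// eta_ge0.
  have kE : kappa = (steps n t)%:R * hh n - (steps n s)%:R * hh n.
    by rewrite /kappa natrB ?steps_mono// mulrBl.
  have h1 := steps_gt n s0; have h2 := steps_le n s0.
  have h3 := steps_gt n t0; have h4 := steps_le n t0.
  rewrite mulrDl mul1r in h1; rewrite mulrDl mul1r in h3; have hle := step_size_le n; rewrite -/(dt n) in hle.
  have k1 : kappa <= t - s + dt n by rewrite kE; lra.
  have k2 : `|kappa - (t - s)| <= dt n by rewrite ler_norml kE; apply/andP; split; lra.
  have k0 : 0 <= kappa by rewrite mulr_ge0.
  have -> : u t x - u s x - (t - s)%:C * B (u s) x =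
    - (approx n t x - u t x) + (approx n s x - u s x) +
    ((approx n t x - approx n s x - kappa%:C * B (u s) x) + (kappa - (t - s))%:C * B (u s) x).
    by rewrite rmorphB/=; ring.
  rewrite (le_trans (le_normcD _ _))//.
  rewrite (le_trans (lerD (le_normcD _ _) (le_normcD _ _)))// normcN normcM normc_real.
  have d0 : 0 <= dt n by rewrite invr_ge0.
  have kB : `|kappa - (t - s)| * normc (B (u s) x) <= dt n * (op_bound * M * w x).
    exact: ler_pM (normr_ge0 _) (normc_ge0 _) k2 bB.
  apply: le_trans (lerD (lerD ut us) (lerD ap kB)) _.
  set X := eps n * M + 2 * eps q * M; set Y := L q * rate Tm n.
  have X0 : 0 <= X by rewrite addr_ge0 ?mulr_ge0.
  have Y0 : 0 <= Y by rewrite mulr_ge0.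
  have Z0 : 0 <= L q * (kappa * (op_bound * M)) by rewrite mulr_ge0// mulr_ge0.
  have ZZ : L q * (kappa * (op_bound * M)) <= L q * ((t - s + dt n) * (op_bound * M)).
    by rewrite ler_wpM2l// ler_wpM2r.
  have big : kappa * (X + L q * (kappa * (op_bound * M)) + Y) <=
      (t - s + dt n) * (X + L q * ((t - s + dt n) * (op_bound * M)) + Y).
    exact: ler_pM k0 (addr_ge0 (addr_ge0 X0 Z0) Y0) k1 (lerD (lerD (lexx X) ZZ) (lexx Y)).
  have QQ := ler_wpM2r (w_ge0 x) big.
  have RE : rho n * w x = rate Tm n * w x + rate Tm n * w x +
    ((t - s + dt n) * (X + L q * ((t - s + dt n) * (op_bound * M)) + Y) * w x + dt n * (op_bound * M * w x)).
    by rewrite /rho /X /Y; ring.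
  by rewrite [leRHS]RE lerD2l lerD2r.
have lim : rho n * w x @[n --> \oo] -->
    (2 * 0 + (t - s + 0) * (0 * M + 2 * eps q * M + L q * ((t - s + 0) * (op_bound * M)) + L q * 0)
      + 0 * (op_bound * M)) * w x.
  have cdt : dt n @[n --> \oo] --> (0 : R) by exact: cvg_harmonic.
  have cr := rate_cvg Tm.
  have cts : t - s + dt n @[n --> \oo] --> t - s + 0 by apply: cvgD => //; exact: cvg_cst.
  apply: cvgMl; apply: cvgD; last exact: cvgMl.
  apply: cvgD; first exact: cvgMr.
  apply: cvgM => //; apply: cvgD; last exact: cvgMr.
  apply: cvgD; last by apply: cvgMr; exact: cvgMl.
  by apply: cvgD; [exact: cvgMl|exact: cvg_cst].
apply: le_trans (le_of_cvg main lim) _; rewrite ler_wpM2r//.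
rewrite !(mul0r, mulr0, addr0, add0r) ler_wpM2l ?subr_ge0//.
have ts : 0 <= t - s by rewrite subr_ge0.
apply: lerD.
  by rewrite ler_wpM2l ?mulr_ge0// ler_peMr// lerDl.
rewrite -[leRHS]mulrA ler_wpM2l// [leRHS]mulrC ler_wpM2l//.
by rewrite mulrC ler_wpM2l// lerDr.
Qed.

Lemma limit_initial : u 0 = f0.
Proof.
apply/funext => x; apply/eqP; rewrite -subr_eq0; apply/eqP.
apply: ComplexField.Normc.eq0_normc; apply/eqP; rewrite eq_le normc_ge0 andbT.
apply: (normc_limit_le (N0 := 0) _ (uP x (lexx 0))) => n _.
by rewrite /approx /steps mul0r truncn0 /= subrr ComplexField.Normc.normc0.
Qed.

End limit.
End existence.

Theorem mild_existence f0 M0 : K f0 -> 0 <= M0 -> wclose M0 f0 one ->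
  exists2 u, u 0 = f0 & mild u.
Proof.
move=> fK M00 f01; have [Lam Lam0 lamL] := lam_bounded.
have [u uP] := approx_limit fK M00 f01 Lam0 lamL.
by exists u; [exact: limit_initial uP|exact: limit_mild fK M00 f01 Lam0 lamL u uP].
Qed.

(** [B] itself is only uniformly continuous on bounded sets, with a modulus that
    combines a truncation error and a Lipschitz constant. *)
Lemma B_difference q f g M D : K f -> K g -> 0 <= M -> 0 <= D ->
  wclose M f one -> wclose M g one -> wclose D f g ->
  wclose (2 * eps q * M + L q * D) (B f) (B g).
Proof.
move=> fK gK M0 D0 f1 g1 fg.
apply: wclose_le (wclose_trans (trunc q fK M0 f1)
  (wclose_trans (lip q fK gK D0 fg) (wclose_sym (trunc q gK M0 g1)))).
by rewrite le_eqVlt; apply/orP; left; apply/eqP; ring.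
Qed.

Lemma mild_lipschitz u Tm : mild u -> 0 <= Tm -> exists M C, [/\ 0 <= M, 0 <= C,
  forall t, 0 <= t <= Tm -> K (u t) /\ wclose M (u t) one,
  forall s t, 0 <= s -> s <= t -> t <= Tm -> wclose (C * (t - s)) (u t) (u s) &
  forall q s t, 0 <= s -> s <= t -> t <= Tm ->
    wclose ((t - s) * (2 * eps q * M + L q * M * (t - s)))
      (fun x => u t x - u s x) (fun x => (t - s)%:C * B (u s) x)].
Proof.
move=> um Tm0; have [M [M0 uK uc]] := um Tm Tm0.
have LM0 : 0 <= L 0 * M by rewrite mulr_ge0.
exists M, (2 * eps 0 * M + L 0 * M * Tm + op_bound * M); split => //.
  by rewrite !addr_ge0 ?mulr_ge0 ?op_bound_ge0.
move=> s t s0 st tT x; have ts : 0 <= t - s by rewrite subr_ge0.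
have sT : 0 <= s <= Tm by rewrite s0 (le_trans st).
have [sK s1] := uK s sT.
have e1 := uc 0 s t s0 st tT x; have e2 := B_bound sK M0 s1 x; rewrite subr0 in e2.
rewrite -[u t x - u s x](subrK ((t - s)%:C * B (u s) x)).
rewrite (le_trans (le_normcD _ _))// normc_realM//.
rewrite (le_trans (lerD e1 (ler_wpM2l ts e2)))//.
have -> : (t - s) * (2 * eps 0 * M + L 0 * M * (t - s)) * w x + (t - s) * (op_bound * M * w x) =
  (2 * eps 0 * M + L 0 * M * (t - s) + op_bound * M) * (t - s) * w x by ring.
rewrite ler_wpM2r// ler_wpM2r// lerD2r lerD2l ler_wpM2l//.
by rewrite lerBlDr (le_trans tT)// lerDl.
Qed.

Lemma mild_continuous u t (e : R) : mild u -> 0 <= t -> 0 < e ->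
  exists2 d : R, 0 < d & forall s, 0 <= s -> `|s - t| < d -> wclose e (u s) (u t).
Proof.
move=> um t0 e0; have Tm0 : 0 <= t + 1 by rewrite addr_ge0.
have [M [C [M0 C0 uK uL _]]] := mild_lipschitz um Tm0.
exists (Num.min 1 (e / (C + 1))); first by rewrite lt_min ltr01 divr_gt0// ltr_wpDl.
move=> s s0; rewrite lt_min => /andP[st1]; rewrite ltr_pdivlMr ?ltr_wpDl// => ste.
have Ce : C * `|s - t| <= e.
  by rewrite mulrC (le_trans _ (ltW ste))// ler_wpM2l// lerDl.
have sT : s <= t + 1 by move: st1; rewrite ltr_norml => /andP[]; lra.
have [ts|/ltW ts] := leP t s.
  by apply: wclose_le (uL _ _ t0 ts sT); rewrite -[X in C * X]ger0_norm ?subr_ge0.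
apply: wclose_sym; apply: wclose_le (uL _ _ s0 ts _); last by rewrite lerDl.
by rewrite -[X in C * X]ger0_norm ?subr_ge0// distrC.
Qed.

Lemma mild_derivative u x : mild u ->
  C1_with_derivative (fun t => u t x) (fun t => B (u t) x).
Proof.
move=> um t t0; have Tm0 : 0 <= t + 1 by rewrite addr_ge0.
have [M [C [M0 C0 uK uL uc]]] := mild_lipschitz um Tm0.
have tT : 0 <= t <= t + 1 by rewrite t0 lerDl/=.
have Bd q s : 0 <= s <= t + 1 ->
    normc (B (u s) x - B (u t) x) <= (2 * eps q * M + L q * (C * `|s - t|)) * w x.
  move=> sT; have /andP[s0 s1] := sT.
  have [sK su1] := uK s sT; have [tK tu1] := uK t tT.
  apply: B_difference => //; first by rewrite mulr_ge0.
  have [ts|/ltW ts] := leP t s.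
    by apply: wclose_le (uL _ _ t0 ts s1); rewrite ger0_norm ?subr_ge0.
  apply: wclose_sym; apply: wclose_le (uL _ _ s0 ts _); last by case/andP: tT.
  by rewrite distrC ger0_norm ?subr_ge0.
(* [q] is chosen first, with [4 eps q M w x] at most half of the tolerance;
   then the time increment, which may depend on [L q] *)
have small (e : R) : 0 < e -> exists q, exists2 d : R, 0 < d & d <= 1 /\
    forall y : R, 0 <= y -> y < d -> (4 * eps q * M + L q * (M + C) * y) * w x <= e.
  move=> e0; have W0 : 0 < 8 * (M * w x + 1) by rewrite mulr_gt0// ltr_wpDl// mulr_ge0.
  have [q _ /(_ q (leqnn q)) /=] := (proj1 (@cvgrPdist_lt _ _ _ _ _ _ _) eps_cvg) _ (divr_gt0 e0 W0).
  rewrite sub0r normrN ger0_norm// => qe.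
  have V0 : 0 < 2 * (L q * (M + C) * w x + 1).
    by rewrite mulr_gt0// ltr_wpDl// !mulr_ge0// addr_ge0.
  exists q, (Num.min 1 (e / (2 * (L q * (M + C) * w x + 1)))).
    by rewrite lt_min ltr01 divr_gt0.
  split; first by rewrite ge_min lexx.
  move=> y y0; rewrite lt_min => /andP[_]; rewrite ltr_pdivlMr// => ye.
  have Mw : 0 <= M * w x by rewrite mulr_ge0.
  have Lw : 0 <= L q * (M + C) * w x by rewrite !mulr_ge0// addr_ge0.
  rewrite mulrDl; rewrite ltr_pdivlMr// in qe.
  have i1 : 4 * eps q * M * w x <= e / 2.
    have : eps q * (M * w x) <= eps q * (M * w x + 1) by rewrite ler_wpM2l// lerDl.
    move: qe; rewrite -!mulrA; set X := M * w x; lra.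
  have i2 : L q * (M + C) * y * w x <= e / 2.
    have : y * (L q * (M + C) * w x) <= y * (L q * (M + C) * w x + 1) by rewrite ler_wpM2l// lerDl.
    have -> : L q * (M + C) * y * w x = y * (L q * (M + C) * w x) by ring.
    move: ye; set X := L q * (M + C) * w x; lra.
  lra.
have dist_bound s : `|s - t| < 1 -> 0 <= s -> 0 <= s <= t + 1.
  by rewrite ltr_norml => /andP[] ? ? ?; apply/andP; split; lra.
split; apply: ccvg_within_intro => e e0; have [q [d d0 [d1 dP]]] := small e e0; exists d => // s sd.
  move=> [s0 st]; have sT := dist_bound s (lt_le_trans sd d1) s0.
  rewrite (le_trans _ (dP _ (normr_ge0 (s - t)) sd))//.
  have st0 : 0 < `|s - t| by rewrite normr_gt0 subr_eq0; apply/eqP.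
  rewrite -(ler_pM2r st0) -/(quotient (fun r => u r x) t s) quotientE//=.
  have [ts|/ltW ts] := leP t s.
    rewrite (ger0_norm (_ : 0 <= s - t)) ?subr_ge0// [leRHS]mulrC [leRHS]mulrA.
    rewrite (le_trans (uc q t s t0 ts _ x)) ?ler_wpM2r//; first by case/andP: sT.
    rewrite ler_wpM2l ?subr_ge0//; apply: lerD.
      by rewrite ler_wpM2r// ler_wpM2r// ler_nat.
    by rewrite ler_wpM2r ?subr_ge0// ler_wpM2l// lerDl.
  have s0T : t <= t + 1 by rewrite lerDl.
  have h1 := uc q s t s0 ts s0T x; have h2 := Bd q s sT.
  rewrite distrC in h2 *; rewrite (ger0_norm (_ : 0 <= t - s)) ?subr_ge0// in h2 *.
  have ts0 : 0 <= t - s by rewrite subr_ge0.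
  have -> : u s x - u t x - (s - t)%:C * B (u t) x =
     - (u t x - u s x - (t - s)%:C * B (u s) x) - (t - s)%:C * (B (u s) x - B (u t) x).
    by rewrite !rmorphB/=; ring.
  rewrite (le_trans (normcB _ _))// normcN normc_realM//.
  rewrite (le_trans (lerD h1 (ler_wpM2l ts0 h2)))//.
  by rewrite le_eqVlt; apply/orP; left; apply/eqP; ring.
move=> /= s0; have sT := dist_bound s (lt_le_trans sd d1) s0.
rewrite (le_trans (Bd q s sT))// (le_trans _ (dP _ (normr_ge0 (s - t)) sd))//.
rewrite ler_wpM2r//; apply: lerD; first by rewrite ler_wpM2r// ler_wpM2r// ler_nat.
by rewrite mulrA ler_wpM2r// ler_wpM2l// lerDr.
Qed.

(** Compactness of the interval of time. *)
Lemma bounded_horizon (u : R -> state) Tm : 0 <= Tm ->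
  (forall t, 0 <= t -> exists M, wclose M (u t) one) ->
  (forall t (e : R), 0 <= t -> 0 < e -> exists2 d : R, 0 < d &
     forall s, 0 <= s -> `|s - t| < d -> wclose e (u s) (u t)) ->
  exists2 M, 0 <= M & forall t, 0 <= t <= Tm -> wclose M (u t) one.
Proof.
move=> Tm0 uM uc.
have := proj1 (compact_near_coveringP _) (@segment_compact R 0 Tm).
move=> /(_ R (pinfty_nbhs R) (fun M t => 0 <= t -> wclose M (u t) one) _).
case.
  move=> t /=; rewrite in_itv/= => /andP[t0 _].
  have [M uM1] := uM t t0; have [d d0 dP] := uc t 1 t0 ltr01.
  exists ([set s | `|t - s| < d], [set M' | M + 1 < M']).
    by split; [exact: near_dist|exists (M + 1); split; rewrite ?num_real].
  move=> [s M'] /= [sd MM'] s0; rewrite distrC in sd.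
  by apply: wclose_le (wclose_trans (dP s s0 sd) uM1); rewrite addrC ltW.
move=> M [_ MP]; exists (`|M| + 1); first by rewrite addr_ge0.
move=> t tT; apply: MP => //=.
- by rewrite (le_lt_trans (ler_norm _))// ltrDl.
- by case/andP: tT.
Qed.

(** Two applications of the mean value inequality: the first, with [B] bounded,
    shows that the curve is Lipschitz; the second uses that [B] then varies
    little between [s] and [t]. *)
Lemma classical_mild (u : R -> state) :
  (forall t, 0 <= t -> K (u t) /\ exists M, wclose M (u t) one) ->
  (forall t (e : R), 0 <= t -> 0 < e -> exists2 d : R, 0 < d &
     forall s, 0 <= s -> `|s - t| < d -> wclose e (u s) (u t)) ->
  (forall x t, 0 <= t -> ccvg (within [set s : R | 0 <= s /\ s <> t] (nbhs t))
     (fun s => (u s x - u t x) / (s - t)%:C) (B (u t) x)) ->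
  mild u.
Proof.
move=> uK uc du Tm Tm0.
have [M M0 uM] := bounded_horizon Tm0 (fun (t : R) (t0 : 0 <= t) => proj2 (uK t t0)) uc.
have A10 := op_bound_ge0; have A1M0 : 0 <= op_bound * M by rewrite mulr_ge0.
have H c : 0 <= c <= Tm -> K (u c) /\ wclose M (u c) one.
  by move=> cT; split; [case/andP: cT => /uK[]|exact: uM].
exists (M * (1 + op_bound)); split; first by rewrite mulr_ge0// addr_ge0.
  move=> t tT; have [tK t1] := H t tT; split => //.
  by apply: wclose_le t1; rewrite ler_peMr// lerDl.
have lipu s t : 0 <= s -> s <= t -> t <= Tm -> wclose ((t - s) * (op_bound * M)) (u t) (u s).
  move=> s0 st tT x.
  have := @curve_mean_value R (fun r => u r x) (fun r => B (u r) x) s t (op_bound * M * w x) 0 s0 st.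
  rewrite mulr0 subr0 mulrA; apply; first by rewrite mulr_ge0.
    by move=> c /andP[sc ct]; apply: du; rewrite (le_trans s0).
  move=> c /andP[sc ct].
  have cT : 0 <= c <= Tm by rewrite (le_trans s0 sc) (le_trans ct tT).
  have [cK c1] := H c cT.
  exact: B_bound c1 x.
move=> q s t s0 st tT x; have ts : 0 <= t - s by rewrite subr_ge0.
have sT : 0 <= s <= Tm by rewrite s0 (le_trans st tT).
have [sK s1] := H s sT.
have := @curve_mean_value R (fun r => u r x) (fun r => B (u r) x) s t
  ((2 * eps q * M + L q * ((t - s) * (op_bound * M))) * w x) (B (u s) x) s0 st.
have b0 : 0 <= 2 * eps q * M + L q * ((t - s) * (op_bound * M)).
  by rewrite addr_ge0 ?mulr_ge0.
move=> /(_ (mulr_ge0 b0 (w_ge0 x))) h.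
apply: le_trans (h _ _) _.
- by move=> c /andP[sc ct]; apply: du; rewrite (le_trans s0).
- move=> c /andP[sc ct].
  have cT : 0 <= c <= Tm by rewrite (le_trans s0 sc) (le_trans ct tT).
  have [cK c1] := H c cT.
  have D0 : 0 <= (c - s) * (op_bound * M) by rewrite mulr_ge0// subr_ge0.
  have := B_difference q cK sK M0 D0 c1 s1 (lipu s c s0 sc (le_trans ct tT)) x.
  move=> /le_trans; apply; rewrite ler_wpM2r// lerD2l ler_wpM2l// ler_wpM2r// lerD2r.
  exact: ct.
rewrite mulrA ler_wpM2r// ler_wpM2l//; apply: lerD.
  by rewrite ler_wpM2l ?mulr_ge0// ler_peMr// lerDl.
rewrite -[leRHS]mulrA ler_wpM2l// [leRHS]mulrC ler_wpM2l//.
by rewrite mulrC ler_wpM2l// lerDr.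
Qed.

End truncated_evolution.

(** * The Cauchy problem *)

Section cauchy_problem.
Variables (R : realType) (s : R) (b : R -> R) (alpha : R).
Hypotheses (b_kernel : collision_kernel b) (b_singular : debye_yukawa s b).
Hypothesis alpha_gt0 : 0 < alpha.
Local Notation V := ('rV[R]_3).
Local Notation state := (V -> R[i]).
Implicit Types (f g : state) (D M : R).

Let w (xi : V) : R := enorm xi `^ alpha.
Let w_ge0 xi : 0 <= w xi. Proof. exact: powR_ge0. Qed.
Let w0 : w 0 = 0.
Proof. by rewrite /w enorm0 powR0// gt_eqF. Qed.

(** The law of a particle at rest. *)
Lemma is_char_fun1 : @is_char_fun R (fun=> 1).
Proof.
apply/is_char_funP; exists (\d_(0 : borelR3 R)) => xi.
have E (h : R -> R) : bounded_measurable h ->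
    \int[\d_(0 : borelR3 R)]_v h (dot (v : 'rV[R]_3) xi) = h 0.
  move=> bh; rewrite /Rintegral integral_dirac//.
    by rewrite diracT mul1e /= dotE !mxE !mul0r !addr0.
  by apply/measurable_EFinP; case: (bounded_measurable_comp (measurable_dotl xi) bh).
rewrite /charC /charS !E ?cos0 ?sin0 ?oppr0//.
- exact: (bounded_measurable_sin (X := id)).
- exact: (bounded_measurable_cos (X := id)).
Qed.

Lemma dist_alpha_le f g D : wclose w D f g -> (dist_alpha alpha f g <= D%:E)%E.
Proof.
move=> fg; apply: ge_ereal_sup => _ [xi xi0 <-]; rewrite lee_fin.
rewrite ler_pdivrMr; first exact: fg.
by rewrite powR_gt0// enorm_gt0.
Qed.

(** The supremum excludes 0, where the equality of the two functions has to be
    known separately. *)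
Lemma dist_alpha_wclose f g D : f 0 = g 0 -> (dist_alpha alpha f g <= D%:E)%E ->
  wclose w D f g.
Proof.
move=> fg0 fg xi; have [->|xi0] := eqVneq xi 0.
  by rewrite fg0 subrr ComplexField.Normc.normc0 w0 mulr0.
rewrite -ler_pdivrMr; last by rewrite powR_gt0// enorm_gt0.
rewrite -lee_fin; apply: le_trans fg; apply: ereal_sup_ubound.
by exists xi.
Qed.

Lemma e3_neq0 : e3 R != 0.
Proof. by rewrite -enorm_gt0 /enorm dot_e3 sqrtr1. Qed.

Lemma dist_alpha_ge0 f g : (0 <= dist_alpha alpha f g)%E.
Proof.
apply: (@le_trans _ _ (normc (f (e3 R) - g (e3 R)) / enorm (e3 R) `^ alpha)%:E).
  by rewrite lee_fin divr_ge0 ?normc_ge0 ?powR_ge0.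
by apply: ereal_sup_ubound; exists (e3 R) => //; exact: e3_neq0.
Qed.

Lemma Kalpha_wclose f : Kalpha alpha f ->
  is_char_fun f /\ exists2 M, 0 <= M & wclose w M f (fun=> 1).
Proof.
move=> [fK foo]; split => //.
have fin : dist_alpha alpha f (fun=> 1) \is a fin_num.
  by rewrite ge0_fin_numE// dist_alpha_ge0.
exists (fine (dist_alpha alpha f (fun=> 1))); first by rewrite fine_ge0// dist_alpha_ge0.
by apply: dist_alpha_wclose; rewrite ?fineK// (char_fun0 fK).
Qed.

Lemma wclose_Kalpha f M : is_char_fun f -> wclose w M f (fun=> 1) -> Kalpha alpha f.
Proof.
by move=> fK f1; split => //; exact: le_lt_trans (dist_alpha_le f1) (ltry _).
Qed.

Let beta n := kernel_trunc b n.
Let B := collision_op (kernel_ext b).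
Let Bn n := collision_op (beta n).
Let eps := trunc_error b alpha.
Let gam n := zonal_mass (beta n).
Let L n := zonal_mass (fun x => beta n x * spread alpha x) + gam n.
Let lam n := growth_rate alpha (beta n).
Local Notation one := (fun=> 1 : R[i]).

Let bbeta n : bounded_measurable (beta n). Proof. exact: bounded_kernel_trunc. Qed.
Let beta_ge0 n x : 0 <= beta n x. Proof. exact: kernel_trunc_ge0. Qed.
Let eps_ge0 n : 0 <= eps n. Proof. exact: (trunc_error_ge0 b_kernel b_singular). Qed.
Let eps_noninc n m : (n <= m)%N -> eps m <= eps n.
Proof. exact: (trunc_error_noninc b_kernel b_singular). Qed.
Let eps_cvg : eps n @[n --> \oo] --> (0 : R).
Proof. exact: (trunc_error_cvg b_kernel b_singular). Qed.
Let L_ge0 n : 0 <= L n.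
Proof.
apply: addr_ge0; first exact: zonal_mass_ge0 (zonal_spread alpha_gt0 (bbeta n) (beta_ge0 n)).
exact: zonal_mass_ge0 (zonal_beta (bbeta n) (beta_ge0 n)).
Qed.
Let lam_cvg : lam n @[n --> \oo] --> lambda_alpha b alpha.
Proof. exact: (growth_rate_cvg b_kernel b_singular). Qed.

Let trunc n M f : is_char_fun f -> 0 <= M -> wclose w M f one ->
  wclose w (eps n * M) (B f) (Bn n f).
Proof.
move=> fK M0 f1 xi.
have le x : 0 <= beta n x <= kernel_ext b x by rewrite kernel_trunc_ge0// kernel_trunc_le.
have z1 : zonal_weight (fun x => kernel_ext b x * half_sin2 x `^ (alpha / 4)).
  by apply: (zonal_kernel b_kernel b_singular); rewrite divr_gt0.
exact: (collision_op_kernel alpha_gt0 xi (measurable_kernel_ext b_kernel) (proj1 (bbeta n))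
  le z1 fK M0 f1).
Qed.

Let lip n D f g : is_char_fun f -> is_char_fun g -> 0 <= D -> wclose w D f g ->
  wclose w (L n * D) (Bn n f) (Bn n g).
Proof. exact: (collision_op_lipschitz alpha_gt0 (bbeta n) (beta_ge0 n)). Qed.

Let Bn1 n xi : Bn n one xi = 0.
Proof.
rewrite /Bn /collision_op; case: ifP => // _.
have -> : (fun p => (beta n (sphere_dot (direction xi) p))%:C * collision_defect one xi p) = (fun=> 0).
  by apply/funext => p; rewrite /collision_defect subrr mulr0.
by rewrite /surface_cintegral /= Rintegral_cst// mul0r.
Qed.

Let contr n h D f g : is_char_fun f -> is_char_fun g -> 0 <= D -> wclose w D f g ->
  0 <= h -> h * gam n <= 1 ->
  wclose w (expR (h * lam n) * D) (euler Bn n h f) (euler Bn n h g).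
Proof. exact: (euler_step_contraction alpha_gt0 (bbeta n) (beta_ge0 n)). Qed.

Let eulerK n h f : is_char_fun f -> 0 <= h -> h * gam n <= 1 ->
  is_char_fun (euler Bn n h f).
Proof. exact: (euler_step_char (bbeta n) (beta_ge0 n)). Qed.

Let closed M (f_ : nat -> state) f : 0 <= M -> (forall n, is_char_fun (f_ n)) ->
  (forall n, wclose w M (f_ n) one) ->
  (forall x, normc (f_ n x - f x) @[n --> \oo] --> (0 : R)) -> is_char_fun f.
Proof. exact: char_fun_closed. Qed.

Lemma collision_rhs_op f xi : Kalpha alpha f -> collision_rhs b f xi = B f xi.
Proof.
move=> /Kalpha_wclose[fK [M M0 f1]]; have [->|xi0] := eqVneq xi 0.
  by rewrite /collision_rhs /B /collision_op eqxx.
exact: (collision_rhsE b_kernel fK xi0).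
Qed.

Lemma mild_solution psi0 (u : R -> state) : mild w (@is_char_fun R) B eps L u -> u 0 = psi0 ->
  is_solution b alpha psi0 u.
Proof.
move=> um u0.
have uK t : 0 <= t -> is_char_fun (u t) /\ exists2 M, 0 <= M & wclose w M (u t) one.
  move=> t0; have [M [M0 uM _]] := um t t0; have [|K1 c1] := uM t; first by rewrite t0 lexx.
  by split => //; exists M.
have uKa t : 0 <= t -> Kalpha alpha (u t).
  by move=> /uK[fK [M _ f1]]; exact: wclose_Kalpha f1.
split => //.
- move=> t t0; have uc := mild_continuous w_ge0 is_char_fun1 eps_ge0 L_ge0 trunc lip Bn1 um t0.
  have near_small (e : R) : 0 < e -> \forall r \near within [set r : R | 0 <= r] (nbhs t),
      (dist_alpha alpha (u r) (u t) <= e%:E)%E.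
    move=> e0; have [d d0 dP] := uc e e0.
    rewrite near_withinE; near=> r => r0; apply: dist_alpha_le; apply: dP => //.
  apply/fine_cvgP; split.
    apply: filterS (near_small 1 ltr01) => r h.
    by rewrite ge0_fin_numE ?dist_alpha_ge0// (le_lt_trans h)// ltry.
  apply/cvgrPdist_le => e e0; apply: filterS (near_small e e0) => r h /=.
  rewrite sub0r normrN ger0_norm ?fine_ge0 ?dist_alpha_ge0// -lee_fin fineK//.
  by rewrite ge0_fin_numE ?dist_alpha_ge0// (le_lt_trans h)// ltry.
- move=> t xi t0 xi0; have [fK [M M0 f1]] := uK t t0.
  exact: (collision_sphere_integrable b_kernel b_singular alpha_gt0 fK M0 f1 xi0).
- move=> xi; exists (fun t => B (u t) xi).
    exact: (mild_derivative w_ge0 is_char_fun1 eps_ge0 eps_cvg L_ge0 trunc lip Bn1).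
  by move=> t t0; rewrite collision_rhs_op//; exact: uKa.
- by move=> xi; rewrite u0.
Unshelve. all: by end_near. Qed.

Lemma solution_mild psi0 (u : R -> state) : is_solution b alpha psi0 u ->
  mild w (@is_char_fun R) B eps L u.
Proof.
move=> [uKa uc _ ueq _].
apply: (classical_mild w_ge0 is_char_fun1 eps_ge0 L_ge0 trunc lip Bn1).
- move=> t /uKa/Kalpha_wclose[fK [M _ f1]]; split => //; by exists M.
- move=> t e t0 e0; have /fine_cvgP[fin cv] := uc t t0.
  have : \forall r \near within [set r : R | 0 <= r] (nbhs t),
      (dist_alpha alpha (u r) (u t) <= e%:E)%E.
    move/cvgrPdist_le : cv => /(_ e e0); apply: filterS2 fin => r rfin /=.
    rewrite sub0r normrN => h; rewrite -(fineK rfin) lee_fin.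
    by rewrite (le_trans (ler_norm _)).
  rewrite near_withinE => /nbhs_ballP[d /= d0 dP]; exists d => // r r0 rt.
  apply: dist_alpha_wclose.
    by rewrite !char_fun0//; [case: (uKa t t0)|case: (uKa r r0)].
  by apply: (dP r) => //; rewrite -ball_normE /= distrC.
- move=> xi t t0; have [du duC duE] := ueq xi.
  rewrite -(collision_rhs_op xi (uKa t t0)) -duE//.
  by have [] := duC t t0.
Qed.

Lemma solution_stability psi0 phi0 psi phi D : is_solution b alpha psi0 psi ->
  is_solution b alpha phi0 phi -> 0 <= D -> wclose w D psi0 phi0 -> forall t, 0 <= t ->
  wclose w (expR (lambda_alpha b alpha * t) * D) (psi t) (phi t).
Proof.
move=> ps ph D0 d0 t t0.
apply: (mild_stability w_ge0 eps_ge0 eps_cvg L_ge0 lam_cvg trunc contr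
  (solution_mild ps) (solution_mild ph) D0 _ t0) => xi.
by rewrite (solution_initial ps) (solution_initial ph).
Qed.

Lemma solution_existence psi0 : Kalpha alpha psi0 -> exists psi, is_solution b alpha psi0 psi.
Proof.
move=> /Kalpha_wclose[fK [M M0 f1]].
have [u u0 um] := mild_existence w_ge0 is_char_fun1 eps_ge0 eps_noninc eps_cvg L_ge0
  lam_cvg trunc lip Bn1 contr eulerK closed fK M0 f1.
by exists u; exact: mild_solution.
Qed.

End cauchy_problem.

Local Close Scope complex_scope.

Theorem theorem1p1 (R : realType) (s : R) (b : R -> R) (alpha : R)
    (s_gt0 : 0 < s) (b_kernel : collision_kernel b)
    (b_singular : debye_yukawa s b) (alpha_gt0 : 0 < alpha) :
  (forall psi0 : 'rV[R]_3 -> R[i], Kalpha alpha psi0 ->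
     exists psi : R -> 'rV[R]_3 -> R[i],
       is_solution b alpha psi0 psi /\
       forall phi : R -> 'rV[R]_3 -> R[i], is_solution b alpha psi0 phi ->
         forall (t : R) (xi : 'rV[R]_3), 0 <= t -> phi t xi = psi t xi) /\
  (forall psi0 phi0 : 'rV[R]_3 -> R[i],
     Kalpha alpha psi0 -> Kalpha alpha phi0 ->
     forall psi phi : R -> 'rV[R]_3 -> R[i],
       is_solution b alpha psi0 psi -> is_solution b alpha phi0 phi ->
       forall t : R, 0 < t ->
         (dist_alpha alpha (psi t) (phi t) <=
          (expR (lambda_alpha b alpha * t))%:E *
          dist_alpha alpha psi0 phi0)%E).
Proof.
have stab := solution_stability b_kernel b_singular alpha_gt0; split.
  move=> psi0 K0; have [psi ps] := solution_existence b_kernel b_singular alpha_gt0 K0.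
  exists psi; split => // phi ph t xi t0.
  have d0 : wclose (fun xi => enorm xi `^ alpha) 0 psi0 psi0 by exact: wclose_refl.
  have := stab _ _ _ _ _ ph ps (lexx 0) d0 t t0 xi; rewrite mulr0 mul0r => n0.
  apply/eqP; rewrite -subr_eq0; apply/eqP; apply: ComplexField.Normc.eq0_normc.
  by apply/eqP; rewrite eq_le n0 normc_ge0.
move=> psi0 phi0 K0 K0' psi phi ps ph t t0.
have [fK [M1 M10 c1]] := Kalpha_wclose alpha_gt0 K0.
have [gK [M2 M20 c2]] := Kalpha_wclose alpha_gt0 K0'.
have fin : dist_alpha alpha psi0 phi0 \is a fin_num.
  rewrite ge0_fin_numE ?dist_alpha_ge0//.
  by apply: le_lt_trans (dist_alpha_le (wclose_trans c1 (wclose_sym c2))) (ltry _).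
have d0 : wclose (fun xi => enorm xi `^ alpha) (fine (dist_alpha alpha psi0 phi0)) psi0 phi0.
  by apply: dist_alpha_wclose => //; rewrite ?fineK// !char_fun0.
rewrite -(fineK fin) -EFinM; apply: dist_alpha_le.
by apply: stab d0 _ (ltW t0) => //; rewrite fine_ge0// dist_alpha_ge0.
Qed.
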